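(* Let $k\geq 2$. (i) Putting the $x$'s and $y$'s in degree one turns the algebra $\hat B^k$ into a Koszul algebra. (ii) The algebra $B^k$ has the structure of a one-parameter flat deformation of $A^k$, isomorphic, as a deformation, to the deformation $A^k[[t]]$ with product $x\star y=xy+\mu(x,y)t$.
   Context: Everything is over $\mathbb C$, and paths are composed from right to left. $A^{k}$ ($k\ge2$) is the path algebra of the quiver with vertices $1,\dots,k$ and arrows $a_i:i\to i+1$, $b_i:i+1\to i$ ($1\le i\le k-1$), modulo $a_{i+1}a_i=0=b_ib_{i+1}$ and $b_ia_i=a_{i-1}b_{i-1}$ (whenever the expression makes sense) if $k>2$, and modulo $a_1b_1a_1=0=b_1a_1b_1$ if $k=2$. With $e_j$ the trivial path at $j$, a basis of $A^k$ is $\mathbf B_k=\{e_j,a_i,b_i,a_ib_i,b_1a_1: 1\le j\le k,\ 1\le i\le k-1\}$. $\hat B^k$ is the path algebra of the following quiver with vertices $1,\dots,k$ modulo relations. Arrows: for each odd $i$ with $1\le i\le k-1$, arrows $x_i:i\to i+1$ and $x_{i+1}:i+1\to i$; for each even $i$ with $1\le i\le k-1$, arrows $y_i:i\to i+1$ and $y_{i+1}:i+1\to i$; a loop $y_1$ at vertex $1$; and a loop at vertex $k$, called $y_k$ if $k$ is even and $x_k$ if $k$ is odd. Relations: $x_iy_j=0=y_jx_i$ whenever the expression makes sense. $B^k$ is the completion of $\hat B^k$ with respect to the ideal generated by all arrows. $\mu:A^k\otimes A^k\to A^k$ is the linear map given on pairs of elements of $\mathbf B_k$ by $$a_s\otimes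 b_s\mapsto(-1)^{s+1}e_{s+1},\quad b_1\otimes a_1\mapsto e_1,\quad a_sb_s\otimes a_sb_s\mapsto(-1)^sa_sb_s,\quad b_1a_1\otimes b_1a_1\mapsto -b_1a_1,$$ $$a_s\otimes a_{s-1}b_{s-1}\mapsto(-1)^{s-1}a_s,\quad a_{s-1}b_{s-1}\otimes b_s\mapsto(-1)^{s-1}b_s$$ (for all $s$ for which the expressions make sense, i.e. $1\le s\le k-1$, and $2\le s\le k-1$ in the last two), and zero on all other pairs of basis vectors. The product $\star$ is extended $\mathbb C[[t]]$-linearly (and continuously) to $A^k[[t]]$. A (flat) one-parameter deformation of a finite dimensional algebra $A$ is a $\mathbb C[[t]]$-algebra $B$ which is topologically free as a $\mathbb C[[t]]$-module together with an algebra isomorphism $B/tB\cong A$; two deformations are isomorphic if there is a $\mathbb C[[t]]$-algebra isomorphism between them which is the identity modulo $t$. *)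

(* Defs.v *)
From HB Require Import structures.
From mathcomp Require Import all_boot all_order all_algebra.
From mathcomp Require Import complex finmap monalg.
From mathcomp Require Import boolp classical_sets reals.

Set Implicit Arguments.
Unset Strict Implicit.
Unset Printing Implicit Defensive.
Import GRing.Theory.
Local Open Scope ring_scope.
Local Open Scope quotient_scope.
Local Obligation Tactic := idtac.

Section Ideals.
Variable A : nzRingType.

Record ideal := Ideal {
  ideal_set :> A -> Prop;
  ideal0 : ideal_set 0;
  idealD : forall x y, ideal_set x -> ideal_set y -> ideal_set (x + y);
  idealMl : forall a x, ideal_set x -> ideal_set (a * x);
  idealMr : forall a x, ideal_set x -> ideal_set (x * a) }.

Program Definition ideal_gen (S : set A) : ideal :=
  @Ideal (fun x => forall J : ideal, (forall y, S y -> J y) -> J x) _ _ _ _.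
Next Obligation. by move=> S J _; apply: ideal0. Qed.
Next Obligation. by move=> S x y hx hy J hJ; apply: idealD; [exact: hx|exact: hy]. Qed.
Next Obligation. by move=> S a x hx J hJ; apply: idealMl; exact: hx. Qed.
Next Obligation. by move=> S a x hx J hJ; apply: idealMr; exact: hx. Qed.

Lemma ideal_gen_min (S : set A) (J : ideal) :
  (forall y, S y -> J y) -> forall x, ideal_gen S x -> J x.
Proof. by move=> h x; apply. Qed.

Program Definition ideal_full : ideal := @Ideal (fun=> True) _ _ _ _.
Solve Obligations with by [].

Fixpoint ideal_exp (I : ideal) (n : nat) : ideal :=
  if n is m.+1 then
    ideal_gen [set z | exists x y, [/\ I x, ideal_exp I m y & z = x * y]]
  else ideal_full.

Definition ideal_pred (I : ideal) : A -> bool := fun x => `[< I x >].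

Lemma ideal_pred_zmod I : zmod_closed (ideal_pred I).
Proof.
split=> [|x y]; rewrite !unfold_in; first exact/asboolP/ideal0.
move=> /asboolP hx /asboolP hy; apply/asboolP.
by rewrite -mulN1r; apply: idealD => //; apply: idealMl.
Qed.

(* The additive quotient is MathComp's; MathComp only provides its ring
   structure for commutative rings and proper ideals. *)
Definition ideal_zmod (I : ideal) : zmodClosed A :=
  HB.pack (ideal_pred I)
    (GRing.isZmodClosed.Build A (ideal_pred I) (ideal_pred_zmod I)).

Definition quot_ring (I : ideal) : Type := Quotient.quot (ideal_zmod I).
HB.instance Definition _ I := GRing.Zmodule.on (quot_ring I).

Definition qpi (I : ideal) (x : A) : quot_ring I :=
  \pi_(Quotient.quot (ideal_zmod I)) x.
Definition qrepr (I : ideal) (x : quot_ring I) : A := repr x.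

Lemma qreprK I : cancel (@qrepr I) (@qpi I).
Proof. by move=> x; rewrite /qpi /qrepr reprK. Qed.

Lemma qpiP (I : ideal) x y : reflect (qpi I x = qpi I y) (`[< I (x - y) >]).
Proof.
have -> : `[< I (x - y) >] = (qpi I x == qpi I y)
  by rewrite /qpi -Quotient.idealrBE unfold_in.
exact: eqP.
Qed.

Lemma qpi_eq (I : ideal) x y : I (x - y) -> qpi I x = qpi I y.
Proof. by move=> h; apply/qpiP/asboolP. Qed.

Lemma qrepr_pi (I : ideal) x : I (qrepr (qpi I x) - x).
Proof. by apply/asboolP/qpiP; rewrite qreprK. Qed.

Lemma qpiD I : {morph qpi I : x y / x + y}.
Proof. by move=> x y; rewrite /qpi !piE. Qed.
Lemma qpi0 I : qpi I 0 = 0.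
Proof. by rewrite /qpi !piE. Qed.

Definition quot_one I : quot_ring I := qpi I 1.
Definition quot_mul I (x y : quot_ring I) : quot_ring I :=
  qpi I (qrepr x * qrepr y).

Lemma qpiM_subproof I x y : quot_mul (qpi I x) (qpi I y) = qpi I (x * y).
Proof.
apply: qpi_eq; set x' := qrepr _; set y' := qrepr _.
have -> : x' * y' - x * y = x' * (y' - y) + (x' - x) * y.
  by rewrite mulrBr mulrBl addrA subrK.
by apply: idealD; [apply: idealMl|apply: idealMr]; apply: qrepr_pi.
Qed.

Section QuotRing.
Variable I : ideal.
Let pM := @qpiM_subproof I.
Let mulA : associative (@quot_mul I).
Proof.
by move=> x y z; rewrite -[x]qreprK -[y]qreprK -[z]qreprK !pM mulrA.
Qed.
Let mul1 : left_id (quot_one I) (@quot_mul I).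
Proof. by move=> x; rewrite -[x]qreprK !pM mul1r. Qed.
Let mulr1' : right_id (quot_one I) (@quot_mul I).
Proof. by move=> x; rewrite -[x]qreprK !pM mulr1. Qed.
Let mulDl : left_distributive (@quot_mul I) +%R.
Proof.
by move=> x y z; rewrite -[x]qreprK -[y]qreprK -[z]qreprK -qpiD !pM mulrDl qpiD.
Qed.
Let mulDr : right_distributive (@quot_mul I) +%R.
Proof.
by move=> x y z; rewrite -[x]qreprK -[y]qreprK -[z]qreprK -qpiD !pM mulrDr qpiD.
Qed.
HB.instance Definition _ := GRing.Zmodule_isPzRing.Build (quot_ring I)
  mulA mul1 mulr1' mulDl mulDr.

Lemma qpiM : {morph qpi I : x y / x * y}.
Proof. by move=> x y; rewrite -pM. Qed.
Lemma qpi1 : qpi I 1 = 1. Proof. by []. Qed.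
Lemma qpiB : {morph qpi I : x y / x - y}.
Proof. by move=> x y; rewrite /qpi !piE. Qed.
HB.instance Definition _ :=
  GRing.isZmodMorphism.Build A (quot_ring I) (qpi I) qpiB.
HB.instance Definition _ :=
  GRing.isMonoidMorphism.Build A (quot_ring I) (qpi I) (qpi1, qpiM).

Lemma quot_ring_neq0 : ~ I 1 -> 1 != 0 :> quot_ring I.
Proof.
move=> h; apply/eqP; rewrite -qpi1 -qpi0 => /qpiP/asboolP.
by rewrite subr0.
Qed.
End QuotRing.

Definition quot_module (I : ideal) : Type := quot_ring I.
HB.instance Definition _ I := GRing.Zmodule.on (quot_module I).

Section QuotModule.
Variable I : ideal.
Let scale (a : A) (x : quot_module I) : quot_module I :=
  (qpi I a * (x : quot_ring I)).
Let scaleA a b x : scale a (scale b x) = scale (a * b) x.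
Proof. by rewrite /scale qpiM mulrA. Qed.
Let scale1 : left_id 1 scale.
Proof. by move=> x; rewrite /scale qpi1 mul1r. Qed.
Let scaleDr : right_distributive scale +%R.
Proof. by move=> a x y; rewrite /scale -mulrDr. Qed.
Let scaleDl x : {morph scale^~ x : a b / a + b}.
Proof. by move=> a b; rewrite /scale qpiD mulrDl. Qed.
HB.instance Definition _ := GRing.Zmodule_isLmodule.Build A (quot_module I)
  scaleA scale1 scaleDr scaleDl.
End QuotModule.

End Ideals.

Section QuotAlgebra.
Variables (K : comNzRingType) (A : algType K) (I : ideal A).
Let scale (c : K) (x : quot_ring I) : quot_ring I := qpi I (c%:A) * x.
Let scaleA a b x : scale a (scale b x) = scale (a * b) x.
Proof. by rewrite /scale mulrA -qpiM -scalerAl mul1r scalerA. Qed.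
Let scale1 : left_id 1 scale.
Proof. by move=> x; rewrite /scale scale1r qpi1 mul1r. Qed.
Let scaleDr : right_distributive scale +%R.
Proof. by move=> a x y; rewrite /scale -mulrDr. Qed.
Let scaleDl x : {morph scale^~ x : a b / a + b}.
Proof. by move=> a b; rewrite /scale scalerDl qpiD mulrDl. Qed.
HB.instance Definition _ := GRing.Zmodule_isLmodule.Build K (quot_ring I)
  scaleA scale1 scaleDr scaleDl.

Lemma quot_scalerAl (c : K) (x y : quot_ring I) : c *: (x * y) = (c *: x) * y.
Proof. exact: mulrA. Qed.
Lemma quot_scalerAr (c : K) (x y : quot_ring I) : c *: (x * y) = x * (c *: y).
Proof.
rewrite /GRing.scale /= /scale -[x]qreprK -[y]qreprK -!qpiM mulrA.
by rewrite -!(scalerAl, scalerAr) !mul1r.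
Qed.
Lemma qpiZ (c : K) (x : A) : qpi I (c *: x) = c *: qpi I x.
Proof. by rewrite /GRing.scale /= /scale -qpiM -scalerAl mul1r. Qed.
End QuotAlgebra.

(* The inverse limit of the algebras [A / I ^ n]: compatible families of
   classes.  Properness of [I] is only needed for [1 != 0]. *)
Section Completion.
Variables (K : comNzRingType) (A : algType K) (I : ideal A).

Definition coherent (f : forall n, quot_ring (ideal_exp I n)) :=
  forall m n, (m <= n)%N ->
  forall a, f n = qpi (ideal_exp I n) a -> f m = qpi (ideal_exp I m) a.

Record completion (I_proper : ~ I 1) := Completion {
  compl_val :> forall n, quot_ring (ideal_exp I n);
  compl_coh : coherent compl_val }.

Variable I_proper : ~ I 1.
Local Notation C := (completion I_proper).
HB.instance Definition _ := gen_eqMixin C.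
HB.instance Definition _ := gen_choiceMixin C.

Lemma compl_eq (x y : C) : (forall n, x n = y n) -> x = y.
Proof.
case: x y => [f hf] [g hg] /= h.
have e : f = g by apply: functional_extensionality_dep.
by case: g / e hg {h} => hg; congr Completion; apply: Prop_irrelevance.
Qed.

Lemma coherentE (x : C) m n : (m <= n)%N ->
  x m = qpi (ideal_exp I m) (qrepr (x n)).
Proof. by move=> h; apply: (compl_coh h); rewrite qreprK. Qed.

Lemma ideal_exp_anti m n : (m <= n)%N ->
  forall x, ideal_exp I n x -> ideal_exp I m x.
Proof.
elim: n m => [|n IH] [|m] // mn x h.
apply: (@ideal_gen_min _ _ (ideal_exp I m.+1) _ _ h) => _ [a [b [Ia Ib ->]]] J.
by apply; exists a, b; split=> //; apply: IH.
Qed.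

Lemma coherentW (f : forall n, quot_ring (ideal_exp I n)) :
  (forall m n, (m <= n)%N -> exists2 a, f n = qpi (ideal_exp I n) a &
     f m = qpi (ideal_exp I m) a) -> coherent f.
Proof.
move=> h m n mn a fn; case: (h m n mn) => b fnb ->.
apply: qpi_eq; apply: (ideal_exp_anti mn); apply/asboolP/qpiP.
by rewrite -fn fnb.
Qed.

Program Definition cst_compl (a : A) : C :=
  @Completion I_proper (fun n => qpi (ideal_exp I n) a) _.
Next Obligation. by move=> a; apply: coherentW => m n _; exists a. Qed.

Program Definition compl_add (x y : C) : C :=
  @Completion I_proper (fun n => x n + y n) _.
Next Obligation.
move=> x y; apply: coherentW => m n mn; exists (qrepr (x n) + qrepr (y n)).
  by rewrite qpiD !qreprK.
by rewrite qpiD -!coherentE.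
Qed.

Program Definition compl_opp (x : C) : C :=
  @Completion I_proper (fun n => - x n) _.
Next Obligation.
move=> x; apply: coherentW => m n mn; exists (- qrepr (x n)).
  by rewrite raddfN /= qreprK.
by rewrite raddfN /= -coherentE.
Qed.

Program Definition compl_mul (x y : C) : C :=
  @Completion I_proper (fun n => x n * y n) _.
Next Obligation.
move=> x y; apply: coherentW => m n mn; exists (qrepr (x n) * qrepr (y n)).
  by rewrite qpiM !qreprK.
by rewrite qpiM -!coherentE.
Qed.

Program Definition compl_scale (c : K) (x : C) : C :=
  @Completion I_proper (fun n => c *: x n) _.
Next Obligation.
move=> c x; apply: coherentW => m n mn; exists (c *: qrepr (x n)).
  by rewrite qpiZ qreprK.
by rewrite qpiZ -coherentE.
Qed.

Let addA : associative compl_add.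
Proof. by move=> x y z; apply: compl_eq => n /=; rewrite addrA. Qed.
Let addC : commutative compl_add.
Proof. by move=> x y; apply: compl_eq => n /=; rewrite addrC. Qed.
Let add0 : left_id (cst_compl 0) compl_add.
Proof. by move=> x; apply: compl_eq => n /=; rewrite qpi0 add0r. Qed.
Let addN : left_inverse (cst_compl 0) compl_opp compl_add.
Proof. by move=> x; apply: compl_eq => n /=; rewrite qpi0 addNr. Qed.
HB.instance Definition _ := GRing.isZmodule.Build C addA addC add0 addN.

Let mulA : associative compl_mul.
Proof. by move=> x y z; apply: compl_eq => n /=; rewrite mulrA. Qed.
Let mul1 : left_id (cst_compl 1) compl_mul.
Proof. by move=> x; apply: compl_eq => n /=; rewrite qpi1 mul1r. Qed.
Let mulr1' : right_id (cst_compl 1) compl_mul.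
Proof. by move=> x; apply: compl_eq => n /=; rewrite qpi1 mulr1. Qed.
Let mulDl : left_distributive compl_mul +%R.
Proof. by move=> x y z; apply: compl_eq => n /=; rewrite mulrDl. Qed.
Let mulDr : right_distributive compl_mul +%R.
Proof. by move=> x y z; apply: compl_eq => n /=; rewrite mulrDr. Qed.

Lemma ideal_exp1_proper : ~ ideal_exp I 1 1.
Proof.
move=> h; apply: I_proper; apply: (@ideal_gen_min _ _ I _ _ h).
move=> _ [a [b [Ia _ ->]]]; exact: idealMr.
Qed.

Let one_neq0 : cst_compl 1 != 0.
Proof.
apply/eqP => /(congr1 (fun x : C => x 1%N)) /= /eqP.
by rewrite qpi1 qpi0; apply/negP; apply: quot_ring_neq0 ideal_exp1_proper.
Qed.
HB.instance Definition _ := GRing.Zmodule_isNzRing.Build C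
  mulA mul1 mulr1' mulDl mulDr one_neq0.

Let scaleA a b x : compl_scale a (compl_scale b x) = compl_scale (a * b) x.
Proof. by apply: compl_eq => n /=; rewrite scalerA. Qed.
Let scale1 : left_id 1 compl_scale.
Proof. by move=> x; apply: compl_eq => n /=; rewrite scale1r. Qed.
Let scaleDr : right_distributive compl_scale +%R.
Proof. by move=> a x y; apply: compl_eq => n /=; rewrite scalerDr. Qed.
Let scaleDl x : {morph compl_scale^~ x : a b / a + b}.
Proof. by move=> a b; apply: compl_eq => n /=; rewrite scalerDl. Qed.
HB.instance Definition _ := GRing.Zmodule_isLmodule.Build K C
  scaleA scale1 scaleDr scaleDl.
Let scaleAl (c : K) (x y : C) : c *: (x * y) = (c *: x) * y.
Proof. by apply: compl_eq => n; apply: quot_scalerAl. Qed.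
HB.instance Definition _ := GRing.Lmodule_isLalgebra.Build K C scaleAl.
Let scaleAr (c : K) (x y : C) : c *: (x * y) = x * (c *: y).
Proof. by apply: compl_eq => n; apply: quot_scalerAr. Qed.
HB.instance Definition _ := GRing.Lalgebra_isAlgebra.Build K C scaleAr.
End Completion.

Record quiver := Quiver {
  vertex : finType;
  arrow : finType;
  src : arrow -> vertex;
  tgt : arrow -> vertex;
  base_vertex : vertex (* the path algebra of the empty quiver is zero *) }.

Section PathAlgebra.
Variables (F : fieldType) (Q : quiver).

(* [(v, [:: c_1; ...; c_n])] stands for the path that starts at [v] and
   traverses [c_1], then [c_2], etc., i.e. for the product [c_n ... c_2 c_1];
   [(v, [::])] is the trivial path at [v]. *)
Fixpoint composable (v : vertex Q) (s : seq (arrow Q)) : bool :=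
  if s is c :: s' then (src c == v) && composable (tgt c) s' else true.

Record qpath := QPath {
  path_val : vertex Q * seq (arrow Q);
  path_ok : composable path_val.1 path_val.2 }.
HB.instance Definition _ := [isSub for path_val].
HB.instance Definition _ := [Choice of qpath by <:].

Definition pstart (p : qpath) : vertex Q := (val p).1.
Definition parrows (p : qpath) : seq (arrow Q) := (val p).2.
Definition pend (p : qpath) : vertex Q :=
  last (pstart p) [seq tgt c | c <- parrows p].
Definition plength (p : qpath) : nat := size (parrows p).

Lemma composable_cat v s1 s2 : composable v (s1 ++ s2) =
  composable v s1 && composable (last v [seq tgt c | c <- s1]) s2.
Proof. by elim: s1 v => //= c s IH v; rewrite IH andbA. Qed.

Definition pjoin (p q : qpath) : option qpath :=
  if pend q == pstart p then insub (pstart q, parrows q ++ parrows p) else None.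

Definition ptriv (v : vertex Q) : qpath := @QPath (v, [::]) isT.
Lemma parrow_subproof (c : arrow Q) : composable (src c) [:: c].
Proof. by rewrite /= eqxx. Qed.
Definition parrow (c : arrow Q) : qpath :=
  @QPath (src c, [:: c]) (parrow_subproof c).

Definition path_algebra : Type := {malg F[qpath]}.
HB.instance Definition _ := GRing.Lmodule.on path_algebra.

Definition ppath (p : qpath) : path_algebra := << p >>.

(* [p q] is the path "first [q], then [p]", or 0. *)
Definition pbmul (p q : qpath) : path_algebra :=
  if pjoin p q is Some r then ppath r else 0.

Definition pmul (u v : path_algebra) : path_algebra :=
  \sum_(p <- msupp u) \sum_(q <- msupp v) (u@_p * v@_q) *: pbmul p q.

Definition pone : path_algebra := \sum_v ppath (ptriv v).

Lemma pmulw (d e : {fset qpath}) (u v : path_algebra) :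
  (msupp u `<=` d)%fset -> (msupp v `<=` e)%fset ->
  pmul u v = \sum_(p <- d) \sum_(q <- e) (u@_p * v@_q) *: pbmul p q.
Proof.
move=> hd he; rewrite /pmul (big_fset_incl _ hd) /=; last first.
  move=> p _ /mcoeff_outdom up; rewrite big1 // => q _.
  by rewrite up mul0r scale0r.
apply: eq_bigr => p _; apply: big_fset_incl => // q _ /mcoeff_outdom vq.
by rewrite vq mulr0 scale0r.
Qed.

Lemma pmulDl (u v w : path_algebra) : pmul (u + v) w = pmul u w + pmul v w.
Proof.
pose d := (msupp u `|` msupp v)%fset.
have hu : (msupp u `<=` d)%fset by apply: fsubsetUl.
have hv : (msupp v `<=` d)%fset by apply: fsubsetUr.
have huv : (msupp (u + v) `<=` d)%fset by apply: msuppD_le.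
rewrite (pmulw huv (fsubset_refl _)) (pmulw hu (fsubset_refl _)).
rewrite (pmulw hv (fsubset_refl _)) -big_split; apply: eq_bigr => p _ /=.
rewrite -big_split; apply: eq_bigr => q _ /=.
by rewrite -scalerDl -mulrDl mcoeffD.
Qed.

Lemma pmulDr (u v w : path_algebra) : pmul u (v + w) = pmul u v + pmul u w.
Proof.
pose d := (msupp v `|` msupp w)%fset.
have hu : (msupp v `<=` d)%fset by apply: fsubsetUl.
have hv : (msupp w `<=` d)%fset by apply: fsubsetUr.
have huv : (msupp (v + w) `<=` d)%fset by apply: msuppD_le.
rewrite (pmulw (fsubset_refl _) huv) (pmulw (fsubset_refl _) hu).
rewrite (pmulw (fsubset_refl _) hv) -big_split; apply: eq_bigr => p _ /=.
rewrite -big_split; apply: eq_bigr => q _ /=.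
by rewrite -scalerDl -mulrDr mcoeffD.
Qed.

Lemma pmulZl c (u v : path_algebra) : pmul (c *: u) v = c *: pmul u v.
Proof.
rewrite (pmulw (msuppZ_le c u) (fsubset_refl _)) scaler_sumr.
apply: eq_bigr => p _; rewrite scaler_sumr; apply: eq_bigr => q _.
by rewrite mcoeffZ scalerA mulrA.
Qed.

Lemma pmulZr c (u v : path_algebra) : pmul u (c *: v) = c *: pmul u v.
Proof.
rewrite (pmulw (fsubset_refl _) (msuppZ_le c v)) scaler_sumr.
apply: eq_bigr => p _; rewrite scaler_sumr; apply: eq_bigr => q _.
by rewrite mcoeffZ scalerA mulrCA.
Qed.

Lemma pmulU p q : pmul (ppath p) (ppath q) = pbmul p q.
Proof.
rewrite (pmulw (msuppU_le (x := 1)) (msuppU_le (x := 1))) !big_seq_fset1.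
by rewrite !mcoeffUU mul1r scale1r.
Qed.

Lemma pmul0l u : pmul 0 u = 0.
Proof. by have := pmulZl 0 0 u; rewrite !scale0r. Qed.
Lemma pmul0r u : pmul u 0 = 0.
Proof. by have := pmulZr 0 u 0; rewrite !scale0r. Qed.

Lemma path_algebra_ind (P : path_algebra -> Prop) :
  P 0 -> (forall u v, P u -> P v -> P (u + v)) ->
  (forall c u, P u -> P (c *: u)) -> (forall p, P (ppath p)) ->
  forall u, P u.
Proof.
move=> P0 PD PZ Pp u; rewrite (monalgE u); elim/big_ind: _ => // p _.
suff -> : << u@_p *g p >> = u@_p *: ppath p by apply: PZ.
by apply/malgP => q; rewrite mcoeffZ !mcoeffU mulrnAr mulr1.
Qed.

Lemma pjoin_some p q r : pjoin p q = Some r <->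
  [/\ pend q = pstart p, pstart r = pstart q & parrows r = parrows q ++ parrows p].
Proof.
rewrite /pjoin; split.
  case: eqP => // e; case: insubP => // r' _ e' [<-].
  by rewrite /pstart /parrows e'.
case=> e rs ra; rewrite e eqxx.
have -> : (pstart q, parrows q ++ parrows p) = val r.
  by rewrite -rs -ra /pstart /parrows -surjective_pairing.
by rewrite valK.
Qed.

Lemma pjoin_ok p q : pend q = pstart p -> exists r, pjoin p q = Some r.
Proof.
move=> e; rewrite /pjoin e eqxx; case: insubP => [r _ _|]; first by exists r.
rewrite /= composable_cat (valP q) /= -/(pend q) e.
by rewrite (valP p).
Qed.

Lemma pjoin_end p q r : pjoin p q = Some r -> pend r = pend p.
Proof.
move=> /pjoin_some [e rs ra].
by rewrite /pend rs ra map_cat last_cat -/(pend q) e.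
Qed.

Lemma qpath_eq p q : pstart p = pstart q -> parrows p = parrows q -> p = q.
Proof.
rewrite /pstart /parrows => e1 e2; apply: val_inj.
by rewrite [LHS]surjective_pairing e1 e2 -surjective_pairing.
Qed.

Lemma pbmulA p q r : pmul (ppath p) (pbmul q r) = pmul (pbmul p q) (ppath r).
Proof.
rewrite /pbmul.
case qr : (pjoin q r) => [a|]; case pq : (pjoin p q) => [b|];
  rewrite ?pmul0r ?pmul0l ?pmulU //.
- have /pjoin_some [e1 as_ aa] := qr; have /pjoin_some [e2 bs ba] := pq.
  have [|c pa] := @pjoin_ok p a; first by rewrite (pjoin_end qr).
  have [|d br] := @pjoin_ok b r; first by rewrite bs.
  rewrite /pbmul pa br; congr ppath.
  have /pjoin_some [_ cs ca] := pa; have /pjoin_some [_ ds da] := br.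
  by apply: qpath_eq; rewrite ?cs ?ds ?as_ ?ca ?da ?aa ?ba // catA.
- rewrite /pbmul; case pa : (pjoin p a) => [c|] //.
  have /pjoin_some [e _ _] := pa.
  have [|b] := @pjoin_ok p q; last by rewrite pq.
  by rewrite -e (pjoin_end qr).
- rewrite /pbmul; case br : (pjoin b r) => [c|] //.
  have /pjoin_some [e _ _] := br; have /pjoin_some [_ bs _] := pq.
  have [|a] := @pjoin_ok q r; last by rewrite qr.
  by rewrite e bs.
Qed.

Lemma pmulA : associative pmul.
Proof.
move=> u v w; elim/path_algebra_ind: u => [|u u' h h'|c u h|p].
- by rewrite !pmul0l.
- by rewrite !pmulDl h h'.
- by rewrite !pmulZl h.
elim/path_algebra_ind: v => [|u u' h h'|c u h|q].
- by rewrite !(pmul0l, pmul0r).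
- by rewrite !(pmulDl, pmulDr) h h'.
- by rewrite !(pmulZl, pmulZr) h.
elim/path_algebra_ind: w => [|u u' h h'|c u h|r].
- by rewrite !(pmul0l, pmul0r).
- by rewrite !(pmulDl, pmulDr) h h'.
- by rewrite !(pmulZl, pmulZr) h.
by rewrite !pmulU pbmulA.
Qed.

Lemma pmul_suml (I : Type) (r : seq I) (G : I -> path_algebra) u :
  pmul (\sum_(i <- r) G i) u = \sum_(i <- r) pmul (G i) u.
Proof. by apply: (big_morph (pmul^~ u)) => [x y|]; rewrite (pmulDl, pmul0l). Qed.
Lemma pmul_sumr (I : Type) (r : seq I) (G : I -> path_algebra) u :
  pmul u (\sum_(i <- r) G i) = \sum_(i <- r) pmul u (G i).
Proof. by apply: (big_morph (pmul u)) => [x y|]; rewrite (pmulDr, pmul0r). Qed.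

Lemma pvalE p : (pstart p, parrows p) = val p.
Proof. by rewrite /pstart /parrows -surjective_pairing. Qed.
Lemma pjoin_trivl v p :
  pjoin (ptriv v) p = if pend p == v then Some p else None.
Proof.
by rewrite /pjoin {2}/parrows /= cats0 pvalE valK.
Qed.
Lemma pjoin_trivr v p :
  pjoin p (ptriv v) = if v == pstart p then Some p else None.
Proof.
rewrite /pjoin (_ : pend (ptriv v) = v) // (_ : pstart (ptriv v) = v) //.
by case: eqP => // ->; rewrite [_ ++ _]/(parrows p) pvalE valK.
Qed.

Lemma pmul1l : left_id pone pmul.
Proof.
move=> u; elim/path_algebra_ind: u => [|u u' h h'|c u h|p].
- by rewrite pmul0r.
- by rewrite pmulDr h h'.
- by rewrite pmulZr h.
rewrite pmul_suml (bigD1 (pend p)) //= pmulU /pbmul pjoin_trivl eqxx.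
rewrite big1 ?addr0 // => v vp; rewrite pmulU /pbmul pjoin_trivl.
by rewrite eq_sym (negPf vp).
Qed.
Lemma pmul1r : right_id pone pmul.
Proof.
move=> u; elim/path_algebra_ind: u => [|u u' h h'|c u h|p].
- by rewrite pmul0l.
- by rewrite pmulDl h h'.
- by rewrite pmulZl h.
rewrite pmul_sumr (bigD1 (pstart p)) //= pmulU /pbmul pjoin_trivr eqxx.
rewrite big1 ?addr0 // => v vp; rewrite pmulU /pbmul pjoin_trivr.
by rewrite (negPf vp).
Qed.

Definition triv_coef (u : path_algebra) : F := u@_(ptriv (base_vertex Q)).

Lemma triv_coef1 : triv_coef pone = 1.
Proof.
rewrite /triv_coef /pone raddf_sum /= (bigD1 (base_vertex Q)) //= mcoeffUU.
rewrite big1 ?addr0 // => v vb; rewrite mcoeffU; case: eqP => // e.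
by case/eqP: vb; move: e => [].
Qed.

Lemma triv_coefM u v : triv_coef (pmul u v) = triv_coef u * triv_coef v.
Proof.
elim/path_algebra_ind: u => [|u u' h h'|c u h|p].
- by rewrite pmul0l /triv_coef mcoeff0 mul0r.
- by rewrite pmulDl /triv_coef !mcoeffD mulrDl -h -h'.
- by rewrite pmulZl /triv_coef !mcoeffZ -mulrA -h.
elim/path_algebra_ind: v => [|u u' h h'|c u h|q].
- by rewrite pmul0r /triv_coef mcoeff0 mulr0.
- by rewrite pmulDr /triv_coef !mcoeffD mulrDr -h -h'.
- by rewrite pmulZr /triv_coef !mcoeffZ mulrCA -h.
rewrite pmulU /pbmul /triv_coef; set b := ptriv _.
have key : (ppath p)@_b * (ppath q)@_b = ((p == b) && (q == b))%:R.
  by rewrite !mcoeffU -natrM mulnb.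
rewrite key; case e : (pjoin p q) => [r|].
  rewrite mcoeffU; congr (_ *+ nat_of_bool _).
  have /pjoin_some [ee rs ra] := e.
  apply/eqP/andP => [rb|[/eqP pb /eqP qb]]; last first.
    by move: e; rewrite pb qb pjoin_trivl eqxx => -[].
  move: ra; rewrite rb => /esym; case eq : (parrows q) => [|//].
  case ep : (parrows p) => [|//] _.
  have sq : pstart q = base_vertex Q by rewrite -rs rb.
  split; apply/eqP; apply: qpath_eq; rewrite ?ep ?eq ?sq //.
  by rewrite -ee /pend eq.
rewrite mcoeff0; case: andP => // -[/eqP pb /eqP qb].
by move: e; rewrite pb qb pjoin_trivl eqxx.
Qed.

Lemma pone_neq0 : pone != 0.
Proof.
apply/eqP => h; have := triv_coef1.
by rewrite h /triv_coef mcoeff0 => /esym/eqP; rewrite oner_eq0.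
Qed.

HB.instance Definition _ := GRing.Zmodule_isNzRing.Build path_algebra
  pmulA pmul1l pmul1r (fun u v w => pmulDl u v w) (fun u v w => pmulDr u v w) pone_neq0.
HB.instance Definition _ := GRing.Lmodule_isLalgebra.Build F path_algebra
  (fun c u v => esym (pmulZl c u v)).
HB.instance Definition _ := GRing.Lalgebra_isAlgebra.Build F path_algebra
  (fun c u v => esym (pmulZr c u v)).

End PathAlgebra.

Section BoundQuiver.
Variables (F : fieldType) (Q : quiver).
Local Notation P := (path_algebra F Q).

Program Definition triv_ideal : ideal P :=
  @Ideal _ (fun u : P => triv_coef u = 0) _ _ _ _.
Next Obligation. by rewrite /triv_coef mcoeff0. Qed.
Next Obligation.
by move=> u v; rewrite /triv_coef mcoeffD => -> ->; rewrite addr0.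
Qed.
Next Obligation. by move=> u v v0; apply: (etrans (triv_coefM u v)); rewrite v0 mulr0. Qed.
Next Obligation. by move=> u v v0; apply: (etrans (triv_coefM v u)); rewrite v0 mul0r. Qed.

Lemma triv_ideal_proper : ~ triv_ideal 1.
Proof.
move=> h; have /eqP := etrans (esym (triv_coef1 F Q)) h.
by rewrite oner_eq0.
Qed.

Lemma triv_coef_arrow (c : arrow Q) : triv_coef (ppath F (parrow c)) = 0.
Proof. by rewrite /triv_coef mcoeffU; case: eqP. Qed.

(* The relations have no constant term; this only serves to see [1 != 0]. *)
Variables (rel : P -> Prop) (rel_triv : forall u, rel u -> triv_coef u = 0).

Definition rel_ideal : ideal P := ideal_gen rel.
Definition bound_algebra of (forall u, rel u -> triv_coef u = 0) : Type :=
  quot_ring rel_ideal.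
Local Notation A := (bound_algebra rel_triv).
HB.instance Definition _ := GRing.PzRing.on A.
HB.instance Definition _ := GRing.Lmodule.copy A (quot_ring rel_ideal).

Lemma bound_one_neq0 : 1 != 0 :> A.
Proof.
apply: quot_ring_neq0 => h; apply: triv_ideal_proper.
exact: (@ideal_gen_min _ _ triv_ideal rel_triv _ h).
Qed.
HB.instance Definition _ := GRing.PzSemiRing_isNonZero.Build A bound_one_neq0.
HB.instance Definition _ := GRing.Lmodule_isLalgebra.Build F A
  (@quot_scalerAl F P rel_ideal).
HB.instance Definition _ := GRing.Lalgebra_isAlgebra.Build F A
  (@quot_scalerAr F P rel_ideal).

Definition bpi (u : P) : A := qpi rel_ideal u.

Definition arrow_ideal : ideal A :=
  ideal_gen (fun z : A => exists c, z = bpi (ppath F (parrow c))).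

Definition bcoef (x : A) : F := triv_coef (qrepr (x : quot_ring rel_ideal)).
Lemma bcoef_pi u : bcoef (bpi u) = triv_coef u.
Proof.
have h : rel_ideal (qrepr (bpi u : quot_ring rel_ideal) - u).
  exact: qrepr_pi.
have /= := @ideal_gen_min _ _ triv_ideal rel_triv _ h.
by rewrite /triv_coef mcoeffB => /eqP; rewrite subr_eq0 => /eqP.
Qed.
Lemma bpiK (x : A) : bpi (qrepr (x : quot_ring rel_ideal)) = x.
Proof. exact: qreprK. Qed.
Lemma bpiD u v : bpi (u + v) = bpi u + bpi v.
Proof. exact: qpiD. Qed.
Lemma bpiM u v : bpi (u * v) = bpi u * bpi v.
Proof. exact: qpiM. Qed.

Lemma arrow_ideal_proper : ~ arrow_ideal 1.
Proof.
have D x y : bcoef (x + y) = bcoef x + bcoef y.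
  by rewrite -[x]bpiK -[y]bpiK -bpiD !bcoef_pi /triv_coef mcoeffD.
have M x y : bcoef (x * y) = bcoef x * bcoef y.
  by rewrite -[x]bpiK -[y]bpiK -bpiM !bcoef_pi triv_coefM.
have Z : bcoef 0 = 0.
  have -> : (0 : A) = bpi 0 by rewrite /bpi qpi0.
  by rewrite bcoef_pi /triv_coef mcoeff0.
have O : bcoef 1 = 1 by rewrite (bcoef_pi 1); exact: triv_coef1.
pose J : ideal A := @Ideal _ (fun x : A => bcoef x = 0) Z
  (fun x y hx hy => etrans (D x y) (etrans (f_equal2 +%R hx hy) (addr0 0)))
  (fun a x hx => etrans (M a x) (etrans (f_equal ( *%R _) hx) (mulr0 _)))
  (fun a x hx => etrans (M x a) (etrans (f_equal ( *%R^~ _) hx) (mul0r _))).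
move=> h; have /= : J 1.
  apply: (@ideal_gen_min _ _ J _ _ h) => _ [c ->] /=.
  by rewrite bcoef_pi triv_coef_arrow.
by rewrite O => /eqP; rewrite oner_eq0.
Qed.

Definition length_part (n : nat) (x : A) : Prop :=
  exists2 u : P, (forall p, p \in msupp u -> plength p = n) & x = bpi u.

End BoundQuiver.

Section Graded.

Definition direct_sum (I : choiceType) (M : zmodType) (gr : I -> M -> Prop) :=
  [/\ forall i, gr i 0 /\ (forall x y, gr i x -> gr i y -> gr i (x - y)),
      forall x, exists (s : seq I) (f : I -> M),
        (forall i, gr i (f i)) /\ x = \sum_(i <- s) f i
    & forall (s : seq I) (f : I -> M), uniq s -> (forall i, gr i (f i)) ->
        \sum_(i <- s) f i = 0 -> forall i, i \in s -> f i = 0].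

Variable A : nzRingType.

Definition graded_ring (gr : nat -> A -> Prop) :=
  [/\ direct_sum gr, gr 0%N 1
    & forall i j a b, gr i a -> gr j b -> gr (i + j)%N (a * b)].

Definition graded_module (gr : nat -> A -> Prop) (M : lmodType A)
    (gm : int -> M -> Prop) :=
  direct_sum gm /\
  forall (i : nat) (j : int) a m, gr i a -> gm j m -> gm (i%:Z + j) (a *: m).

Definition generated_in_degree (M : lmodType A) (gm : int -> M -> Prop)
    (j : int) :=
  forall m, exists (n : nat) (a : 'I_n -> A) (g : 'I_n -> M),
    (forall i, gm j (g i)) /\ m = \sum_i a i *: g i.

Definition projective_module (P : lmodType A) :=
  forall (M N : lmodType A) (g : {linear M -> N}) (f : {linear P -> N}),
    (forall y, exists x, g x = y) ->
    exists h : {linear P -> M}, forall p, g (h p) = f p.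

(* [A0] is a subring; [semisimple_subring] says that every submodule of [A0],
   seen as a left module over itself, is a direct summand. *)
Definition left_ideal_of (A0 : A -> Prop) (L : A -> Prop) :=
  [/\ forall x, L x -> A0 x, L 0, forall x y, L x -> L y -> L (x - y)
    & forall a x, A0 a -> L x -> L (a * x)].

Definition semisimple_subring (A0 : A -> Prop) :=
  forall L, left_ideal_of A0 L -> exists L',
    [/\ left_ideal_of A0 L', forall x, L x -> L' x -> x = 0
      & forall x, A0 x -> exists y z, [/\ L y, L' z & x = y + z]].

Variable gr : nat -> A -> Prop.

Definition positive_ideal : ideal A :=
  ideal_gen (fun x => exists2 n, (0 < n)%N & gr n x).

(* [gr 0] as the left module [A / A_{>0}], concentrated in degree 0. *)
Definition degree0_module : lmodType A := quot_module positive_ideal.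

(* Koszul rings in the sense of Beilinson, Ginzburg and Soergel: [A] is
   positively graded, [A_0] is semisimple and the graded left module [A_0] has
   a graded projective resolution ... -> P 1 -> P 0 -> A_0 -> 0 in which
   [P i] is generated by its component of degree [i]. *)
Definition koszul :=
  [/\ graded_ring gr,
      semisimple_subring (gr 0%N)
    & exists (P : nat -> lmodType A) (gP : forall i, int -> P i -> Prop)
        (d : forall i, {linear P i.+1 -> P i})
        (aug : {linear P 0%N -> degree0_module}),
      [/\ forall i, [/\ graded_module gr (gP i), projective_module (P i)
            & generated_in_degree (gP i) i%:Z],
          (forall i j p, gP i.+1 j p -> gP i j (d i p)) /\
          (forall j p, j != 0 -> gP 0%N j p -> aug p = 0),
          forall z, exists p, aug p = z,
          forall p, aug p = 0 <-> exists q, p = d 0%N q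
        & forall i p, d i p = 0 <-> exists q, p = d i.+1 q]].

End Graded.

Record fps (V : Type) := Fps { fcoef : nat -> V }.

Lemma fps_eq V (x y : fps V) : (forall n, fcoef x n = fcoef y n) -> x = y.
Proof. by case: x y => [x] [y] /= h; congr Fps; apply: funext. Qed.

HB.instance Definition _ (V : Type) := gen_eqMixin (fps V).
HB.instance Definition _ (V : Type) := gen_choiceMixin (fps V).

Section FpsZmod.
Variable V : zmodType.
Implicit Types x y z : fps V.
Let zero : fps V := Fps (fun=> 0).
Let opp x : fps V := Fps (fun n => - fcoef x n).
Let add x y : fps V := Fps (fun n => fcoef x n + fcoef y n).
Let addA : associative add.
Proof. by move=> x y z; apply: fps_eq => n; apply: addrA. Qed.
Let addC : commutative add.
Proof. by move=> x y; apply: fps_eq => n; apply: addrC. Qed.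
Let add0 : left_id zero add.
Proof. by move=> x; apply: fps_eq => n; apply: add0r. Qed.
Let addN : left_inverse zero opp add.
Proof. by move=> x; apply: fps_eq => n; apply: addNr. Qed.
HB.instance Definition _ := GRing.isZmodule.Build (fps V) addA addC add0 addN.

Lemma fcoefD x y n : fcoef (x + y) n = fcoef x n + fcoef y n. Proof. by []. Qed.
Lemma fcoef0 n : fcoef (0 : fps V) n = 0. Proof. by []. Qed.
End FpsZmod.

(* The continuous bilinear extension of a biadditive map to power series. *)
Definition conv (U V : Type) (W : zmodType) (g : U -> V -> W)
    (x : fps U) (y : fps V) : fps W :=
  Fps (fun n => \sum_(i < n.+1) g (fcoef x i) (fcoef y (n - i)%N)).

Section Conv.

Definition biadditive (U V W : zmodType) (g : U -> V -> W) :=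
  (forall y, {morph g^~ y : a b / a + b}) /\ (forall x, {morph g x : a b / a + b}).

Lemma biadd0l (U V W : zmodType) (g : U -> V -> W) y :
  biadditive g -> g 0 y = 0.
Proof. by case=> h _; apply: (addrI (g 0 y)); rewrite -h !addr0. Qed.
Lemma biadd0r (U V W : zmodType) (g : U -> V -> W) x :
  biadditive g -> g x 0 = 0.
Proof. by case=> _ h; apply: (addrI (g x 0)); rewrite -h !addr0. Qed.

Lemma convDl (U V W : zmodType) (g : U -> V -> W) : biadditive g ->
  forall y, {morph (conv g)^~ y : a b / a + b}.
Proof.
move=> [h _] y a b; apply: fps_eq => n /=.
by rewrite -big_split; apply: eq_bigr => i _; apply: h.
Qed.
Lemma convDr (U V W : zmodType) (g : U -> V -> W) : biadditive g ->
  forall x, {morph conv g x : a b / a + b}.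
Proof.
move=> [_ h] x a b; apply: fps_eq => n /=.
by rewrite -big_split; apply: eq_bigr => i _; apply: h.
Qed.

Lemma conv_biadd (U V W : zmodType) (g : U -> V -> W) :
  biadditive g -> biadditive (conv g).
Proof. by move=> h; split; [apply: convDl|apply: convDr]. Qed.

Lemma convC (U V W : zmodType) (g : U -> V -> W) x y :
  conv g x y = conv (fun b a => g a b) y x.
Proof.
apply: fps_eq => n /=; rewrite (reindex_inj rev_ord_inj) /=.
apply: eq_bigr => i _; rewrite subSS; congr g; congr fcoef.
by rewrite subKn // -ltnS.
Qed.

Lemma triangle (W : zmodType) (G : nat -> nat -> nat -> W) n :
  \sum_(m < n.+1) \sum_(i < m.+1) G i (m - i)%N (n - m)%N =
  \sum_(i < n.+1) \sum_(j < (n - i).+1) G i j (n - i - j)%N.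
Proof.
pose H m i := G i (m - i)%N (n - m)%N.
transitivity (\sum_(0 <= m < n.+1) \sum_(0 <= i < n.+1 | (i <= m)%N) H m i).
  rewrite big_mkord; apply: eq_bigr => m _.
  rewrite -(big_mkord xpredT (H m)).
  by rewrite (@big_nat_widen _ _ _ 0 m.+1 n.+1).
under eq_bigr => m _ do rewrite big_mkcond.
rewrite exchange_big /= big_mkord; apply: eq_bigr => i _.
rewrite -big_mkcond -[LHS](@big_nat_widenl _ _ _ i 0 n.+1 xpredT) //.
rewrite -{1}[nat_of_ord i]add0n big_addn big_mkord -subSn ?leq_ord //.
by apply: eq_bigr => j _; rewrite /H addnK addnC subnDA.
Qed.

Lemma conv_assoc (U V W X Y Z : zmodType) (g1 : W -> Z -> X) (g2 : U -> V -> W)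
    (g3 : U -> Y -> X) (g4 : V -> Z -> Y) :
  biadditive g1 -> biadditive g3 ->
  (forall x y z, g1 (g2 x y) z = g3 x (g4 y z)) ->
  forall x y z, conv g1 (conv g2 x y) z = conv g3 x (conv g4 y z).
Proof.
move=> h1 h3 h x y z; apply: fps_eq => n /=.
pose G i j l := g1 (g2 (fcoef x i) (fcoef y j)) (fcoef z l).
transitivity (\sum_(m < n.+1) \sum_(i < m.+1) G i (m - i)%N (n - m)%N).
  apply: eq_bigr => m _; rewrite /= (big_morph (g1^~ _) (h1.1 _) (biadd0l _ h1)).
  by [].
rewrite triangle; apply: eq_bigr => i _ /=.
rewrite (big_morph (g3 _) (h3.2 _) (biadd0r _ h3)).
by apply: eq_bigr => j _; apply: h.
Qed.

Definition fpsC (V : zmodType) (c : V) : fps V :=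
  Fps (fun n => if n is 0%N then c else 0).

Lemma conv_constl (U V W : zmodType) (g : U -> V -> W) c y n : biadditive g ->
  fcoef (conv g (fpsC c) y) n = g c (fcoef y n).
Proof.
move=> h /=; rewrite big_ord_recl subn0 big1 ?addr0 // => i _.
exact: biadd0l.
Qed.

End Conv.

Section FpsRing.
Variable F : comNzRingType.
Let mul : fps F -> fps F -> fps F := conv *%R.
Let mulb : biadditive ( *%R : F -> F -> F).
Proof. by split=> [y a b|x a b]; rewrite ?mulrDl ?mulrDr. Qed.
Let mulA : associative mul.
Proof.
by move=> x y z; apply: esym; apply: conv_assoc => // a b c; rewrite mulrA.
Qed.
Let mulC : commutative mul.
Proof.
move=> x y; rewrite /mul convC; apply: fps_eq => n /=.
by apply: eq_bigr => i _; rewrite mulrC.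
Qed.
Let mul1 : left_id (fpsC 1) mul.
Proof. by move=> x; apply: fps_eq => n; rewrite conv_constl // mul1r. Qed.
Let mulDl : left_distributive mul +%R.
Proof. by move=> x y z; apply: convDl. Qed.
Let one_neq0 : fpsC 1 != 0 :> fps F.
Proof.
by apply/eqP => /(congr1 (fun x => fcoef x 0%N)) /eqP; rewrite /= oner_eq0.
Qed.
HB.instance Definition _ := GRing.Zmodule_isComNzRing.Build (fps F)
  mulA mulC mul1 mulDl one_neq0.

Definition fpsT : fps F := Fps (fun n => if n == 1%N then 1 else 0).

Section FpsModule.
Variable V : lmodType F.
Let scale : fps F -> fps V -> fps V := conv *:%R.
Let scaleb : biadditive ( *:%R : F -> V -> V).
Proof. by split=> [y a b|x a b]; rewrite ?scalerDl ?scalerDr. Qed.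
Let scaleA a b v : scale a (scale b v) = scale (a * b) v.
Proof. by apply: esym; apply: conv_assoc => // x y z; rewrite scalerA. Qed.
Let scale1 : left_id 1 scale.
Proof. by move=> x; apply: fps_eq => n; rewrite conv_constl // scale1r. Qed.
Let scaleDr : right_distributive scale +%R.
Proof. by move=> a x y; apply: convDr. Qed.
Let scaleDl v : {morph scale^~ v : a b / a + b}.
Proof. by move=> a b; apply: convDl. Qed.
HB.instance Definition _ := GRing.Zmodule_isLmodule.Build (fps F) (fps V)
  scaleA scale1 scaleDr scaleDl.
End FpsModule.
End FpsRing.

Lemma scale_biadd (F : comNzRingType) (V : lmodType F) :
  biadditive ( *:%R : F -> V -> V).
Proof. by split=> [y a b|x a b]; rewrite ?scalerDl ?scalerDr. Qed.

Section ScaleConv.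
Variables (F : comNzRingType) (V : lmodType F) (g : V -> V -> V).
Hypothesis gb : biadditive g.
Lemma scale_convl (f : fps F) (x y : fps V) :
  (forall c a b, g (c *: a) b = c *: g a b) ->
  f *: conv g x y = conv g (f *: x) y.
Proof.
by move=> h; apply: esym; apply: conv_assoc => //; apply: scale_biadd.
Qed.
End ScaleConv.

Lemma scale_convr (F : comNzRingType) (V : lmodType F) (g : V -> V -> V)
    (f : fps F) (x y : fps V) : biadditive g ->
  (forall c a b, g a (c *: b) = c *: g a b) ->
  f *: conv g x y = conv g x (f *: y).
Proof.
move=> [h1 h2] h; rewrite (convC g) (convC g) scale_convl //.
Qed.

Section Star.
Variables (F : fieldType) (A : algType F) (mu : {bilinear A -> A -> A}).

(* The [F[[t]]]-bilinear continuous extension of [x * y + mu x y * t]. *)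
Definition star (x y : fps A) : fps A :=
  conv *%R x y + fpsT F *: conv mu x y.

Let mulb : biadditive ( *%R : A -> A -> A).
Proof. by split=> [y a b|x a b]; rewrite ?mulrDl ?mulrDr. Qed.
Let mub : biadditive mu.
Proof. by split=> [y a b|x a b]; rewrite ?linearDl ?linearDr. Qed.

Lemma starDl : left_distributive star +%R.
Proof.
move=> x y z; rewrite /star (convDl mulb) (convDl mub) scalerDr.
exact: addrACA.
Qed.
Lemma starDr : right_distributive star +%R.
Proof.
move=> x y z; rewrite /star (convDr mulb) (convDr mub) scalerDr.
exact: addrACA.
Qed.
Lemma starZl (f : fps F) x y : f *: star x y = star (f *: x) y.
Proof.
rewrite /star scalerDr (scale_convl mulb) => [|c a b]; last by rewrite scalerAl.
congr (_ + _); rewrite scalerA mulrC -scalerA (scale_convl mub) // => c a b.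
exact: linearZl_LR.
Qed.
Lemma starZr (f : fps F) x y : f *: star x y = star x (f *: y).
Proof.
rewrite /star scalerDr scale_convr // => [|c a b]; last by rewrite scalerAr.
congr (_ + _); rewrite scalerA mulrC -scalerA scale_convr // => c a b.
exact: linearZr_LR.
Qed.

Lemma fps_one_neq0 : fpsC 1 != 0 :> fps A.
Proof.
by apply/eqP => /(congr1 (fun x => fcoef x 0%N)) /eqP; rewrite /= oner_eq0.
Qed.

Definition star_unital_assoc : Prop :=
  [/\ associative star, left_id (fpsC 1) star & right_id (fpsC 1) star].

Definition star_algebra of star_unital_assoc : Type := fps A.
Variable h : star_unital_assoc.
Local Notation S := (star_algebra h).
HB.instance Definition _ := GRing.Lmodule.copy S (fps A).
Let sA : associative (star : S -> S -> S). Proof. by case: h. Qed.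
Let s1 : left_id (fpsC 1 : S) star. Proof. by case: h. Qed.
Let s1' : right_id (fpsC 1 : S) star. Proof. by case: h. Qed.
HB.instance Definition _ := GRing.Zmodule_isNzRing.Build S
  sA s1 s1' starDl starDr fps_one_neq0.
HB.instance Definition _ := GRing.Lmodule_isLalgebra.Build (fps F) S starZl.
HB.instance Definition _ := GRing.Lalgebra_isAlgebra.Build (fps F) S starZr.
End Star.

(* The [F[[t]]]-algebra structure on a ring [B] given by a ring morphism from
   [F[[t]]] to the centre of [B]. *)
Section CentralAlgebra.
Variables (F : comNzRingType) (B : nzRingType) (s : {rmorphism fps F -> B}).
Definition central_morphism : Prop := forall f x, s f * x = x * s f.
Definition central_algebra of central_morphism : Type := B.
Variable h : central_morphism.
Local Notation S := (central_algebra h).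
HB.instance Definition _ := GRing.NzRing.copy S B.
Let scale (f : fps F) (x : S) : S := s f * (x : B).
Let scaleA a b x : scale a (scale b x) = scale (a * b) x.
Proof. by rewrite /scale rmorphM mulrA. Qed.
Let scale1 : left_id 1 scale.
Proof. by move=> x; rewrite /scale rmorph1 mul1r. Qed.
Let scaleDr : right_distributive scale +%R.
Proof. by move=> a x y; rewrite /scale -mulrDr. Qed.
Let scaleDl x : {morph scale^~ x : a b / a + b}.
Proof. by move=> a b; rewrite /scale rmorphD mulrDl. Qed.
HB.instance Definition _ := GRing.Zmodule_isLmodule.Build (fps F) S
  scaleA scale1 scaleDr scaleDl.
Let scaleAl (f : fps F) (x y : S) : f *: (x * y) = (f *: x) * y.
Proof. exact: mulrA. Qed.
HB.instance Definition _ := GRing.Lmodule_isLalgebra.Build (fps F) S scaleAl.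
Let scaleAr (f : fps F) (x y : S) : f *: (x * y) = x * (f *: y).
Proof. by rewrite /GRing.scale /= /scale mulrA h -mulrA. Qed.
HB.instance Definition _ := GRing.Lalgebra_isAlgebra.Build (fps F) S scaleAr.
End CentralAlgebra.

Section Deformations.
Variables (F : fieldType) (A : algType F).

(* A [F[[t]]]-module isomorphism is automatically a homeomorphism for the
   t-adic topologies. *)
Definition topologically_free (M : lmodType (fps F)) : Prop :=
  exists (V : lmodType F) (f : {linear fps V -> M}), bijective f.

Definition t_ideal (B : algType (fps F)) : ideal B :=
  ideal_gen (fun x => x = (fpsT F)%:A).
Definition mod_t (B : algType (fps F)) : Type := quot_ring (t_ideal B).
HB.instance Definition _ (B : algType (fps F)) := GRing.PzRing.on (mod_t B).
HB.instance Definition _ (B : algType (fps F)) :=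
  GRing.Lmodule.copy (mod_t B) (quot_ring (t_ideal B)).

(* The last clause says that [phi] is [F]-linear, [F] acting on [B / tB]
   through the constant power series. *)
Definition is_deformation (B : algType (fps F))
    (phi : {rmorphism mod_t B -> A}) : Prop :=
  [/\ topologically_free B, bijective phi
    & forall (c : F) (x : mod_t B), phi (fpsC c *: x) = c *: phi x].

Definition isomorphic_deformations (B1 B2 : algType (fps F))
    (phi1 : {rmorphism mod_t B1 -> A}) (phi2 : {rmorphism mod_t B2 -> A}) :=
  exists g : {lrmorphism B1 -> B2},
    bijective g /\
    forall x, phi2 (qpi (t_ideal B2) (g x)) = phi1 (qpi (t_ideal B1) x).
End Deformations.

(* Vertices [1, ..., k] are represented by ['I_k] and [a_i], [b_i],
   [1 <= i <= k - 1], by two copies of ['I_k.-1]; ordinals are shifted by one.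
   The functions [vtx_], [a_], [b_], [x_], [y_] and the induced [A_e], [A_a],
   [A_b] below take the 1-based indices, and are 0 out of range. *)

Section Quivers.
Variables (k : nat) (hk : (2 <= k)%N).

Definition lower (i : 'I_k.-1) : 'I_k := widen_ord (leq_pred k) i.
Lemma upper_subproof (i : 'I_k.-1) : (i.+1 < k)%N.
Proof. by rewrite -[X in (_ < X)%N](prednK (ltnW hk)) ltnS. Qed.
Definition upper (i : 'I_k.-1) : 'I_k := Ordinal (upper_subproof i).

Definition first_vertex : 'I_k := Ordinal (ltnW hk).

Definition A_quiver : quiver :=
  @Quiver 'I_k ('I_k.-1 + 'I_k.-1)%type
    (fun c => match c with inl i => lower i | inr i => upper i end)
    (fun c => match c with inl i => upper i | inr i => lower i end)
    first_vertex.

(* Each vertex [j] is the source of exactly one arrow [x_j] and one [y_j].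
   [x_j] exchanges [1 <-> 2], [3 <-> 4], etc. and [y_j] exchanges [2 <-> 3],
   [4 <-> 5], etc., vertices without a partner carrying a loop.  Here [j] is
   the 0-based index; [insubd j j.+1] is [j] itself when [j] is the last
   vertex, and [j.-1] is [j] itself when [j] is the first one. *)
Definition succ_or_loop (j : 'I_k) : 'I_k := insubd j j.+1.
Definition pred_or_loop (j : 'I_k) : 'I_k := insubd j j.-1.
Definition x_target (j : 'I_k) : 'I_k :=
  if odd j.+1 then succ_or_loop j else pred_or_loop j.
Definition y_target (j : 'I_k) : 'I_k :=
  if odd j.+1 then pred_or_loop j else succ_or_loop j.

Definition B_quiver : quiver :=
  @Quiver 'I_k ('I_k + 'I_k)%type
    (fun c => match c with inl j => j | inr j => j end)
    (fun c => match c with inl j => x_target j | inr j => y_target j end)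
    first_vertex.

Variable F : fieldType.
Local Notation PA := (path_algebra F A_quiver).
Local Notation PB := (path_algebra F B_quiver).

Definition vtx_ (j : nat) : PA :=
  \sum_(i : 'I_k | i.+1 == j) ppath F (@ptriv A_quiver i).
Definition a_ (s : nat) : PA :=
  \sum_(i : 'I_k.-1 | i.+1 == s) ppath F (@parrow A_quiver (inl i)).
Definition b_ (s : nat) : PA :=
  \sum_(i : 'I_k.-1 | i.+1 == s) ppath F (@parrow A_quiver (inr i)).

Definition A_rel (u : PA) : Prop :=
  if k == 2%N then u = a_ 1 * b_ 1 * a_ 1 \/ u = b_ 1 * a_ 1 * b_ 1
  else exists i : nat,
    [\/ [/\ (1 <= i)%N, (i.+1 <= k.-1)%N & u = a_ i.+1 * a_ i],
        [/\ (1 <= i)%N, (i.+1 <= k.-1)%N & u = b_ i * b_ i.+1]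
      | [/\ (2 <= i)%N, (i <= k.-1)%N
          & u = b_ i * a_ i - a_ i.-1 * b_ i.-1]].

Definition x_ (s : nat) : PB :=
  \sum_(j : 'I_k | j.+1 == s) ppath F (@parrow B_quiver (inl j)).
Definition y_ (s : nat) : PB :=
  \sum_(j : 'I_k | j.+1 == s) ppath F (@parrow B_quiver (inr j)).

(* The product of non-composable paths is already 0 in the path algebra. *)
Definition B_rel (u : PB) : Prop :=
  exists i j : nat,
    [/\ (1 <= i <= k)%N, (1 <= j <= k)%N & u = x_ i * y_ j \/ u = y_ j * x_ i].

Lemma sum_arrows_triv (Q : quiver) (I : finType) (P : pred I)
  (c : I -> arrow Q) :
  triv_ideal F Q (\sum_(i | P i) ppath F (parrow (c i))).
Proof.
by rewrite /= /triv_coef raddf_sum big1 // => i _; apply: triv_coef_arrow.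
Qed.

Lemma A_rel_triv u : A_rel u -> triv_coef u = 0.
Proof.
rewrite /A_rel => h; change (triv_ideal F A_quiver u).
have ha s : triv_ideal F A_quiver (a_ s) by apply: sum_arrows_triv.
have hb s : triv_ideal F A_quiver (b_ s) by apply: sum_arrows_triv.
have Ml v w := @idealMl _ (triv_ideal F A_quiver) v w.
case: ifP h => _.
  by case=> ->; [apply: (Ml _ _ (ha 1%N))|apply: (Ml _ _ (hb 1%N))].
case=> i [] [_ _ ->].
- exact: (Ml _ _ (ha i)).
- exact: (Ml _ _ (hb i.+1)).
rewrite -[X in _ + X]mulN1r.
exact: (idealD (Ml _ _ (ha i)) (Ml _ _ (Ml _ _ (hb i.-1)))).
Qed.

Lemma B_rel_triv u : B_rel u -> triv_coef u = 0.
Proof.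
move=> h; change (triv_ideal F B_quiver u).
have hx s : triv_ideal F B_quiver (x_ s) by apply: sum_arrows_triv.
have hy s : triv_ideal F B_quiver (y_ s) by apply: sum_arrows_triv.
have Ml v w := @idealMl _ (triv_ideal F B_quiver) v w.
case: h => i [j [_ _ []]] ->; first exact: (Ml _ _ (hy j)).
exact: (Ml _ _ (hx i)).
Qed.

Definition A_alg : algType F := bound_algebra A_rel_triv.
Definition Bhat_alg : algType F := bound_algebra B_rel_triv.

Definition B_alg : algType F :=
  completion (@arrow_ideal_proper _ _ _ B_rel_triv).

Definition Bhat_degree (n : nat) (x : Bhat_alg) : Prop :=
  @length_part _ _ _ B_rel_triv n x.

Definition A_e (j : nat) : A_alg := bpi A_rel_triv (vtx_ j).
Definition A_a (s : nat) : A_alg := bpi A_rel_triv (a_ s).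
Definition A_b (s : nat) : A_alg := bpi A_rel_triv (b_ s).

Inductive A_basis :=
  | Be of nat | Ba of nat | Bb of nat | Bab of nat | Bba1.

Definition A_basis_ok (p : A_basis) : bool :=
  match p with
  | Be j => (1 <= j <= k)%N
  | Ba i | Bb i | Bab i => (1 <= i <= k.-1)%N
  | Bba1 => true
  end.

Definition A_basis_val (p : A_basis) : A_alg :=
  match p with
  | Be j => A_e j
  | Ba i => A_a i
  | Bb i => A_b i
  | Bab i => A_a i * A_b i
  | Bba1 => A_b 1 * A_a 1
  end.

Definition mu_table (p q : A_basis) : A_alg :=
  match p, q with
  | Ba s, Bb r => if r == s then (-1) ^+ s.+1 *: A_e s.+1 else 0
  | Bb 1, Ba 1 => A_e 1
  | Bab s, Bab r => if r == s then (-1) ^+ s *: (A_a s * A_b s) else 0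
  | Bba1, Bba1 => - (A_b 1 * A_a 1)
  | Ba s, Bab r => if s == r.+1 then (-1) ^+ s.-1 *: A_a s else 0
  | Bab r, Bb s => if s == r.+1 then (-1) ^+ s.-1 *: A_b s else 0
  | _, _ => 0
  end.

Definition mu_spec (mu : {bilinear A_alg -> A_alg -> A_alg}) : Prop :=
  forall p q, A_basis_ok p -> A_basis_ok q ->
    mu (A_basis_val p) (A_basis_val q) = mu_table p q.

End Quivers.

(* Main.v *)
Require Import Defs.
From HB Require Import structures.
From mathcomp Require Import all_boot all_order all_algebra.
From mathcomp Require Import complex finmap monalg ring.
From mathcomp Require Import boolp classical_sets reals.

Set Implicit Arguments.
Unset Strict Implicit.
Unset Printing Implicit Defensive.
Import GRing.Theory.
Local Open Scope ring_scope.

(** A path of $\hat B^k$ that contains both an $x$ and a $y$ has a relation as a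
    factor.  So the trivial paths and the paths written with one letter span
    $\hat B^k$, and they form a basis, since the coefficients of a path algebra
    at such paths vanish on the ideal of relations ([path_monomial],
    [coef_ext]).  From every vertex there is one such path for each letter, here
    called a colour, and each positive length.  Sending the source of an arrow
    of given colour to its target is an involution [partner] of the vertices,
    and the product of $\hat B^k$ is a convolution twisted by it.

    Koszulity.  The quadratic dual of $\hat B^k$ has the alternating words in
    $x$ and $y$ as a basis, two for each source in every positive degree.  The
    Koszul complex is therefore $\hat B^k$ in homological degree $0$ and two
    copies of $\hat B^k$ in every positive degree, the differentials being
    right multiplications by the sum $X$ of all $x_i$ and the sum $Y$ of all
    $y_i$, taken alternately on each copy.  It is exact because an element is
    killed by $X$ exactly when it has no coordinate at a power of $x$, the
    trivial paths included, and then it is a multiple of $Y$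
    ([mul_letter_eq0], [no_colour_div]); the same holds with $X$ and $Y$
    exchanged.

    The deformation.  Let $T$ be the sum over all vertices of the shortest
    loops of a single letter, those in $x$ with sign $+$ and those in $y$ with
    sign $-$ ([parameter]); such a loop is $x_{i+1}x_i$, $y_{i+1}y_i$ and the
    like, or one of the two loops of the quiver.  This element is central.
    Modulo $T$ the two loops at a vertex become equal, which at an inner vertex
    is the relation $b_ia_i=a_{i-1}b_{i-1}$ of $A^k$, and all paths that are
    longer than such a loop die, because $xy=0=yx$.  A linear section [lifting]
    of the resulting map $\hat B^k\to A^k$ sends vertices to vertices, arrows to
    letters, and the socle element at each vertex to one of the two loops there
    ([lift_colour]); the choice that corresponds to $\mu$ is not the same at the
    vertex $1$ as at the other vertices.  The rule

      $\ell(a)\ell(b)=\ell(ab)+T\,\ell(\mu(a,b))$, with $\ell$ this section,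

    is [lift_mul], and it determines $\mu$.  In the completion every element is
    $\sum_n T^n\ell(a_n)$ for a unique sequence $a_n$ in $A^k$: on the colour that
    does not carry the lifted socle element one reads off the vertex
    coordinates of the $a_n$, then on the other colour the socle coordinates,
    and the arrows are read off the words of odd length ([recoverK],
    [transport0]).  Hence $\sum_n t^na_n\mapsto\sum_n T^n\ell(a_n)$ is a bijection
    that turns $\star$ into the product of $B^k$; in particular $\star$ is
    associative, and $B^k$ is a deformation isomorphic to $(A^k[[t]],\star)$. *)

Lemma ideal_sum (A : nzRingType) (J : ideal A) (T : Type) (r : seq T)
  (Q : pred T) (f : T -> A) :
  (forall i, Q i -> J (f i)) -> J (\sum_(i <- r | Q i) f i).
Proof. by move=> h; elim/big_ind: _ => //; [exact: ideal0|exact: idealD]. Qed.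

Lemma idealB (A : nzRingType) (J : ideal A) x y : J x -> J y -> J (x - y).
Proof. by move=> hx hy; rewrite -mulN1r; apply: idealD => //; apply: idealMl. Qed.

Lemma idealZ (F : fieldType) (A : algType F) (J : ideal A) (a : F) x :
  J x -> J (a *: x).
Proof. by move=> h; rewrite -[x]mul1r scalerAl; apply: idealMl. Qed.

(** Locked, so that comparing two such elements compares the paths and not the
    finitely supported functions that represent them. *)
HB.lock Definition path_elt (F : fieldType) (Q : quiver) (p : qpath Q) :
  path_algebra F Q := ppath F p.

(** * Coefficients in a path algebra *)

Section PathCoefficients.
Variables (F : fieldType) (Q : quiver).
Local Notation P := (path_algebra F Q).
Implicit Types (v : vertex Q) (s : seq (arrow Q)) (u w : P).

(** Indexed by a vertex and a list of arrows, so that the factors of a path need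
    no proof of composability; non composable data give the coefficient 0. *)
Definition path_coef v s (u : P) : F :=
  if insub (v, s) is Some p then mcoeff p u else 0.

Lemma path_eltE (p : qpath Q) : path_elt F p = ppath F p.
Proof. by rewrite unlock. Qed.

Lemma path_coef_is_linear v s : linear_for *%R (path_coef v s).
Proof.
move=> c u w; rewrite /path_coef; case: insubP => [p _ _|_].
  by rewrite mcoeffD mcoeffZ.
by rewrite mulr0 addr0.
Qed.
HB.instance Definition _ v s :=
  GRing.isLinear.Build F P F *%R (path_coef v s) (path_coef_is_linear v s).

Definition path_end v s : vertex Q := last v [seq tgt c | c <- s].

Lemma path_coef_elt v s (p : qpath Q) :
  path_coef v s (path_elt F p) = (val p == (v, s))%:R.
Proof.
rewrite unlock /path_coef; case: insubP => [q _ e|/=].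
  by rewrite /ppath mcoeffU -e val_eqE.
by case: eqP => // e; have := path_ok p; rewrite [path_val p]e /= => ->.
Qed.

Lemma path_coef_valE (p : qpath Q) u : path_coef (pstart p) (parrows p) u = mcoeff p u.
Proof. by rewrite /path_coef pvalE valK. Qed.

Lemma path_coef_pbmul v s (p q : qpath Q) :
  path_coef v s (pbmul F p q) =
  \sum_(m < (size s).+1)
    (val p == (path_end v (take m s), drop m s))%:R *
    (val q == (v, take m s))%:R.
Proof.
have [sq|sq] := leqP (size (parrows q)) (size s); last first.
  rewrite big1 ?/pbmul => [|m _]; last first.
    case: (val q =P _) => [e|]; last by rewrite mulr0.
    by move: sq; rewrite /parrows e /= size_take_min ltnNge geq_minr.
  case e : (pjoin p q) => [r|]; last by rewrite linear0.
  have /pjoin_some [_ rs ra] := e.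
  rewrite -path_eltE path_coef_elt -pvalE ra; case: eqP => // -[_ h].
  by move: sq; rewrite -h size_cat ltnNge leq_addr.
have sq' : (size (parrows q) < (size s).+1)%N by [].
rewrite (bigD1 (Ordinal sq')) //= [X in _ + X]big1 ?addr0 => [|m /eqP mq].
  2:{ case: (val q =P _) => [e|]; last by rewrite mulr0.
      case: mq; apply: val_inj; rewrite /= /parrows e size_take_min.
      by apply/esym/minn_idPl; rewrite -ltnS. }
rewrite -natrM mulnb /pbmul.
case e : (pjoin p q) => [r|].
  have /pjoin_some [ee rs ra] := e.
  rewrite -path_eltE path_coef_elt -!pvalE ra rs; congr (nat_of_bool _)%:R.
  apply/eqP/andP => [[<- <-]|[/eqP [e1 e2] /eqP [e3 e4]]].
    rewrite take_size_cat // drop_size_cat // -ee.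
    by rewrite /path_end /pend.
  by rewrite e2 e3 {1}e4 cat_take_drop.
rewrite linear0 -!pvalE; case: andP => // -[/eqP [ep _] /eqP [eq1 eq2]].
have [|r] := @pjoin_ok Q p q; last by rewrite e.
by rewrite /pend ep eq1 {1}eq2.
Qed.

(** A path has as many factorisations as its length plus one, which makes the
    product of the path algebra a convolution of coefficients. *)
Lemma path_coefM v s u w : path_coef v s (u * w) =
  \sum_(m < (size s).+1)
    path_coef (path_end v (take m s)) (drop m s) u * path_coef v (take m s) w.
Proof.
elim/path_algebra_ind: u => [|u u' h h'|c u h|p].
- by rewrite mul0r linear0 big1 // => m _; rewrite linear0 mul0r.
- rewrite mulrDl linearD /=; apply: etrans (f_equal2 +%R h h') _.
  rewrite -big_split; apply: eq_bigr => m _.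
  by rewrite /= linearD mulrDl.
- rewrite -scalerAl linearZ /= h mulr_sumr; apply: eq_bigr => m _.
  by rewrite linearZ /= mulrA.
elim/path_algebra_ind: w => [|u u' h h'|c u h|q].
- by rewrite mulr0 linear0 big1 // => m _; rewrite linear0 mulr0.
- rewrite mulrDr linearD /=; apply: etrans (f_equal2 +%R h h') _.
  rewrite -big_split; apply: eq_bigr => m _.
  by rewrite /= linearD mulrDr.
- rewrite -scalerAr linearZ /= h mulr_sumr; apply: eq_bigr => m _.
  by rewrite linearZ /= mulrCA.
rewrite (pmulU F p q : ppath F p * ppath F q = _) path_coef_pbmul.
by apply: eq_bigr => m _; rewrite -!path_eltE !path_coef_elt.
Qed.

Lemma path_elt_head c v s (h : composable v (c :: s)) (h' : composable (tgt c) s) :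
  path_elt F (QPath (path_val := (v, c :: s)) h) =
  path_elt F (QPath (path_val := (tgt c, s)) h') * path_elt F (parrow c).
Proof.
rewrite !path_eltE (pmulU F _ _ : _ * _ = _) /pbmul; case e : pjoin => [r|].
  have /pjoin_some [_ rs ra] := e; congr ppath; apply: qpath_eq.
    by rewrite rs; case/andP: (h) => /eqP.
  by rewrite ra.
have [] // := @pjoin_ok Q (QPath (path_val := (tgt c, s)) h') (parrow c).
by move=> r; rewrite e.
Qed.

Lemma path_algebra_one : 1 = \sum_v path_elt F (ptriv v) :> P.
Proof. by under [RHS]eq_bigr => v _ do rewrite path_eltE. Qed.

Lemma path_algebra_sum u : u = \sum_(p <- msupp u) mcoeff p u *: path_elt F p.
Proof.
rewrite {1}(monalgE u); apply: eq_bigr => p _.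
rewrite path_eltE; apply/malgP => q; rewrite mcoeffZ /ppath.
by rewrite [X in _ * X]mcoeffU mulr_natr; apply: mcoeffU.
Qed.

End PathCoefficients.

Section BoundFunctionals.
Variables (F : fieldType) (Q : quiver) (rel : path_algebra F Q -> Prop).
Variable rel_triv : forall u, rel u -> triv_coef u = 0.
Local Notation P := (path_algebra F Q).
Local Notation A := (bound_algebra rel_triv).

Definition blift (x : A) : P := qrepr (x : quot_ring (rel_ideal rel)).

Lemma bliftK (x : A) : bpi rel_triv (blift x) = x.
Proof. exact: bpiK. Qed.

Lemma bpi_is_linear : linear (bpi rel_triv).
Proof. by move=> c u v; rewrite bpiD; congr (_ + _); exact: qpiZ. Qed.
HB.instance Definition _ :=
  GRing.isLinear.Build F P A *:%R (bpi rel_triv) bpi_is_linear.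

Lemma bpi_one : bpi rel_triv 1 = 1. Proof. by []. Qed.

Lemma bpi_rel u : rel u -> bpi rel_triv u = 0.
Proof.
move=> h; rewrite -[RHS](linear0 (bpi rel_triv)).
by apply: qpi_eq; rewrite subr0 => J; apply.
Qed.

Lemma functional_blift (f : {scalar P}) (J : ideal P) u :
  (forall v, J v -> f v = 0) -> (forall v, rel v -> J v) ->
  f (blift (bpi rel_triv u)) = f u.
Proof.
move=> fJ rJ; apply/eqP; rewrite -subr_eq0 -linearB; apply/eqP/fJ.
apply: (@ideal_gen_min _ rel J rJ).
exact: (@qrepr_pi _ (rel_ideal rel) u).
Qed.

End BoundFunctionals.

(** * A normal form in $\hat B^k$ *)

Arguments src : simpl never.
Arguments tgt : simpl never.

Section Colours.
Variables (k : nat) (hk : (2 <= k)%N).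

(** The colour [true] stands for the letter $x$, the colour [false] for $y$.
    At each vertex the two colours point in opposite directions, and which of
    them goes up depends on the parity of the vertex. *)
Definition partner (c : bool) (j : 'I_k) : 'I_k :=
  if c then x_target j else y_target j.

Lemma partnerE c j : partner c j =
  (if c (+) odd j then if (j.+1 < k)%N then j.+1 else j else j.-1) :> nat.
Proof.
rewrite /partner /x_target /y_target /succ_or_loop /pred_or_loop /=.
have -> : (if c then if ~~ odd j then insubd j j.+1 else insubd j j.-1
  else if ~~ odd j then insubd j j.-1 else insubd j j.+1) =
  (if c (+) odd j then insubd j j.+1 else insubd j j.-1).
  by case: c; case: (odd j).
case: ifP => _; rewrite val_insubd //.
by rewrite (leq_ltn_trans (leq_pred j) (ltn_ord j)).
Qed.

Lemma partnerK c : involutive (partner c).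
Proof.
move=> j; apply: ord_inj; rewrite partnerE; move: (partnerE c j).
case: ifP => up; first case: ifP => h.
- by move=> ->; rewrite /= addbN up.
- by move=> ->; rewrite up h.
case: j up => -[|j] /= jk up -> /=; first by rewrite up.
by move: up; rewrite addbN => /negbFE ->; rewrite jk.
Qed.

Lemma iter_partner_partner c m j :
  iter m (partner c) (partner c j) = partner c (iter m (partner c) j).
Proof. by rewrite -iterSr. Qed.

Local Notation Q := (B_quiver hk).

Definition arr (c : bool) (j : 'I_k) : arrow Q := if c then inl j else inr j.

Lemma src_arr c j : src (arr c j) = j. Proof. by case: c. Qed.
Lemma tgt_arr c j : tgt (arr c j) = partner c j. Proof. by case: c. Qed.

Lemma arrP (a : arrow Q) : exists c j, a = arr c j.
Proof. by case: a => j; [exists true, j|exists false, j]. Qed.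

Lemma arr_inj c j d i : arr c j = arr d i -> c = d /\ j = i.
Proof. by case: c; case: d => // -[->]. Qed.

Fixpoint word (c : bool) (n : nat) (j : 'I_k) : seq (arrow Q) :=
  if n is m.+1 then arr c j :: word c m (partner c j) else [::].

Lemma size_word c n j : size (word c n j) = n.
Proof. by elim: n j => //= n IH j; rewrite IH. Qed.

Lemma take_word c m n j : (m <= n)%N -> take m (word c n j) = word c m j.
Proof. by elim: m n j => [|m IH] [|n] j //= h; rewrite IH. Qed.

Lemma drop_word c m n j :
  drop m (word c n j) = word c (n - m) (iter m (partner c) j).
Proof.
elim: m n j => [|m IH] [|n] j //=.
by rewrite IH subSS iter_partner_partner.
Qed.

Lemma end_word c n (j : 'I_k) : @path_end Q j (word c n j) = iter n (partner c) j.
Proof.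
rewrite /path_end; elim: n j => //= n IH j.
by rewrite tgt_arr IH iter_partner_partner.
Qed.

Lemma word_composable c n (j : 'I_k) : @composable Q j (word c n j).
Proof. by elim: n j => //= n IH j; rewrite src_arr eqxx tgt_arr IH. Qed.

Definition mono_path c n (j : 'I_k) : qpath Q :=
  QPath (path_val := (j : vertex Q, word c n j)) (word_composable c n j).

Lemma word_eq c n d m (j i : 'I_k) :
  ((j, word c n j) == (i, word d m i)) =
  [&& j == i, n == m & (n == 0%N) || (c == d)].
Proof.
apply/eqP/and3P => [[-> e]|[/eqP -> /eqP ->]]; last first.
  by case/orP => [/eqP ->|/eqP ->].
split=> //; first by rewrite -(size_word c n i) e size_word.
by case: n e => //= n; case: m => //= m [/arr_inj [->]].
Qed.

End Colours.

Arguments partner : simpl never.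

Section Monomials.
Variables (k : nat) (hk : (2 <= k)%N) (F : fieldType).
Local Notation Q := (B_quiver hk).
Local Notation P := (path_algebra F Q).
Local Notation B := (Bhat_alg hk F).
Local Notation pi := (bpi (@B_rel_triv k hk F)).

Definition pcoef c n (j : 'I_k) (u : P) : F :=
  path_coef (j : vertex Q) (word hk c n j) u.

Lemma pcoef_is_linear c n j : linear_for *%R (pcoef c n j).
Proof. by move=> a u v; rewrite /pcoef linearP. Qed.
HB.instance Definition _ c n j :=
  GRing.isLinear.Build F P F *%R (pcoef c n j) (pcoef_is_linear c n j).

Lemma pcoefM c n j u w : pcoef c n j (u * w) =
  \sum_(m < n.+1) pcoef c (n - m) (iter m (partner c) j) u * pcoef c m j w.
Proof.
rewrite [LHS]path_coefM size_word; apply: eq_bigr => m _.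
rewrite take_word ?drop_word ?end_word //.
by rewrite -ltnS.
Qed.

Lemma pcoef_elt c n j (p : qpath Q) :
  pcoef c n j (path_elt F p) = (val p == (j, word hk c n j))%:R.
Proof. exact: path_coef_elt. Qed.

Lemma pcoef_mono c n j d m i :
  pcoef c n j (path_elt F (mono_path hk d m i)) =
  [&& i == j, m == n & (m == 0%N) || (d == c)]%:R.
Proof. by rewrite pcoef_elt word_eq. Qed.

Lemma pcoef1 c n j : pcoef c n j 1 = (n == 0%N)%:R.
Proof.
rewrite path_algebra_one linear_sum /=.
have e (i : 'I_k) : pcoef c n j (path_elt F (ptriv (i : vertex Q))) =
    ((i == j) && (n == 0%N))%:R.
  by rewrite pcoef_elt -[val _]/(i, word hk c 0 i) word_eq andbT (eq_sym 0%N).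
rewrite (bigD1 (j : vertex Q)) //= e eqxx big1 ?addr0 // => i ij.
by rewrite e (negPf ij).
Qed.

Lemma x_E (j : 'I_k) : x_ hk F j.+1 = path_elt F (mono_path hk true 1 j).
Proof.
rewrite /x_ (big_pred1 j) => [|i]; last by rewrite eqSS.
by rewrite -path_eltE; congr path_elt; apply: val_inj.
Qed.

Lemma y_E (j : 'I_k) : y_ hk F j.+1 = path_elt F (mono_path hk false 1 j).
Proof.
rewrite /y_ (big_pred1 j) => [|i]; last by rewrite eqSS.
by rewrite -path_eltE; congr path_elt; apply: val_inj.
Qed.

(** The kernel of the coordinates of $\hat B^k$: the span of the paths that use
    both letters, an ideal because factors of a one-letter path are such paths. *)
Definition words_vanish (u : P) := forall c n j, pcoef c n j u = 0.
Lemma words_vanish0 : words_vanish 0.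
Proof. by move=> c n j; rewrite linear0. Qed.
Lemma words_vanishD u v : words_vanish u -> words_vanish v -> words_vanish (u + v).
Proof. by move=> hu hv c n j; rewrite linearD /= hu hv addr0. Qed.
Lemma words_vanishMl u v : words_vanish v -> words_vanish (u * v).
Proof.
by move=> hv c n j; rewrite pcoefM big1 // => m _; rewrite hv mulr0.
Qed.
Lemma words_vanishMr u v : words_vanish v -> words_vanish (v * u).
Proof.
by move=> hv c n j; rewrite pcoefM big1 // => m _; rewrite hv mul0r.
Qed.
Definition mixed_ideal : ideal P :=
  Ideal words_vanish0 words_vanishD words_vanishMl words_vanishMr.

Lemma B_rel_mixed u : B_rel u -> mixed_ideal u.
Proof.
have key c d i j c' n l : c != d ->
    pcoef c' n l (path_elt F (mono_path hk c 1 i) * path_elt F (mono_path hk d 1 j)) = 0.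
  move=> cd; rewrite pcoefM big1 // => m _; rewrite !pcoef_mono.
  move: cd; case: c c' d => -[] [] //= _; rewrite !andbF ?mulr0 ?mul0r //.
case=> -[|i] [[|j] [/andP [// _ ik] /andP [// _ jk]]].
rewrite (x_E (Ordinal ik)) (y_E (Ordinal jk)).
by case=> -> c n l; apply: key.
Qed.

Lemma pi_mono_mul c d i j : c != d ->
  pi (path_elt F (mono_path hk c 1 i)) * pi (path_elt F (mono_path hk d 1 j)) = 0.
Proof.
move=> cd; rewrite -bpiM; apply: bpi_rel.
exists (if c then i else j).+1, (if c then j else i).+1.
split; try by rewrite ltn_ord.
by rewrite x_E y_E; case: c d cd => -[] // _; [left|right].
Qed.

(** A path that mixes the two letters passes from one to the other somewhere,
    so it has a relation as a factor. *)
Lemma path_monomial (p : qpath Q) :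
  pi (path_elt F p) = 0 \/ exists c n j, p = mono_path hk c n j.
Proof.
case: p => -[v s] /= h; elim: s v h => [|a s IH] v h.
  by right; exists true, 0%N, v; apply: val_inj.
have [c [j e]] := arrP a; subst a.
have h' := h; move: h' => /andP [/eqP]; rewrite src_arr => e h'; subst v.
rewrite (path_elt_head F h h') bpiM.
have -> : parrow (arr hk c j) = mono_path hk c 1 j.
  by apply: val_inj; rewrite /= src_arr.
case: (IH _ h') => [->|[d [n [i e]]]]; first by left; rewrite mul0r.
have es : s = word hk d n (partner c j).
  by have := congr1 val e; rewrite /= tgt_arr => -[-> ->].
have ei : i = partner c j by have := congr1 val e; rewrite /= tgt_arr => -[->].
rewrite e ei; case: n es {IH e} => [|n] es.
  by right; exists c, 1%N, j; apply: val_inj; rewrite /= es.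
have [cd|cd] := eqVneq d c.
  by right; exists c, n.+2, j; apply: val_inj; rewrite /= es cd.
have hd : @composable Q (tgt (arr hk d (partner c j)))
    (word hk d n (partner d (partner c j))).
  by rewrite tgt_arr word_composable.
left; rewrite (path_elt_head F (word_composable hk d n.+1 _) hd) bpiM -mulrA.
have -> : parrow (arr hk d (partner c j)) = mono_path hk d 1 (partner c j).
  by apply: val_inj; rewrite /= src_arr.
by rewrite pi_mono_mul // mulr0.
Qed.

Lemma mixed_rel u : mixed_ideal u -> pi u = 0.
Proof.
move=> h; rewrite (path_algebra_sum u) linear_sum big1 // => p _.
rewrite linearZ /=; case: (path_monomial p) => [->|]; first exact: scaler0.
case=> c [n [j e]]; move: (h c n j); rewrite /pcoef /=.
by have := path_coef_valE p u; rewrite e => -> ->; rewrite scale0r.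
Qed.

End Monomials.

(** The coefficients at the monochromatic paths are the coordinates of
    $\hat B^k$. *)
HB.lock Definition coef (k : nat) (hk : (2 <= k)%N) (F : fieldType) (c : bool)
  (n : nat) (j : 'I_k) (b : Bhat_alg hk F) : F := pcoef c n j (blift b).

HB.lock Definition mono (k : nat) (hk : (2 <= k)%N) (F : fieldType) (c : bool)
  (n : nat) (j : 'I_k) : Bhat_alg hk F :=
  bpi (@B_rel_triv k hk F) (path_elt F (mono_path hk c n j)).

Section Coordinates.
Variables (k : nat) (hk : (2 <= k)%N) (F : fieldType).
Local Notation Q := (B_quiver hk).
Local Notation P := (path_algebra F Q).
Local Notation B := (Bhat_alg hk F).
Local Notation pi := (bpi (@B_rel_triv k hk F)).
Local Notation coef := (@coef k hk F).
Local Notation mono := (@mono k hk F).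

Lemma coef_pi c n j u : coef c n j (pi u) = pcoef c n j u.
Proof.
rewrite coef.unlock.
apply: (@functional_blift F Q (B_rel (F := F)) (@B_rel_triv k hk F)
  (pcoef c n j) (@mixed_ideal k hk F)) => v; [by apply|exact: B_rel_mixed].
Qed.

Lemma coef_is_linear c n j : linear_for *%R (coef c n j).
Proof.
move=> a u v; rewrite -[u]bliftK -[v]bliftK -linearP !coef_pi.
by rewrite linearP.
Qed.
HB.instance Definition _ c n j :=
  GRing.isLinear.Build F B F *%R (coef c n j) (coef_is_linear c n j).

Lemma coefM c n j a b : coef c n j (a * b) =
  \sum_(m < n.+1) coef c (n - m) (iter m (partner c) j) a * coef c m j b.
Proof.
rewrite -[a]bliftK -[b]bliftK -bpiM coef_pi pcoefM.
by apply: eq_bigr => m _; rewrite !coef_pi.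
Qed.

Lemma coef1 c n j : coef c n j 1 = (n == 0%N)%:R.
Proof. by rewrite -(bpi_one (@B_rel_triv k hk F)) coef_pi pcoef1. Qed.

Lemma coef_deg0 c d j b : coef c 0 j b = coef d 0 j b.
Proof. by rewrite coef.unlock. Qed.

Lemma coef_ext a b : (forall c n j, coef c n j a = coef c n j b) -> a = b.
Proof.
move=> h; apply/eqP; rewrite -subr_eq0; apply/eqP.
rewrite -[a - b]bliftK; apply: mixed_rel => c n j.
by rewrite -coef_pi bliftK linearB /= h subrr.
Qed.

Lemma coef_bounded b : exists N, forall c n j, (N <= n)%N -> coef c n j b = 0.
Proof.
rewrite -[b]bliftK.
elim/path_algebra_ind: (blift b) => [|u v [N hN] [M hM]|a u [N hN]|p].
- by exists 0%N => c n j _; rewrite linear0 linear0.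
- exists (maxn N M) => c n j; rewrite geq_max => /andP [h h'].
  by rewrite linearD linearD /= hN // hM // addr0.
- by exists N => c n j h; rewrite linearZ linearZ /= hN // mulr0.
rewrite -path_eltE; case: (path_monomial F p) => [->|[c [n [j ->]]]].
  by exists 0%N => c n j _; rewrite linear0.
exists n.+1 => d m i nm; rewrite coef_pi pcoef_mono.
by case: (n =P m) nm => [->|_ _]; rewrite ?ltnn ?andbF.
Qed.

Lemma coef_mono c n j d m i :
  coef c n j (mono d m i) = [&& i == j, m == n & (m == 0%N) || (d == c)]%:R.
Proof. by rewrite mono.unlock coef_pi pcoef_mono. Qed.

(** In degree 0 both colours stand for the same paths, which are counted once. *)
Definition of_coefs (N : nat) (f : bool -> nat -> 'I_k -> F) : B :=
  \sum_(n < N) if n == 0%N :> nat then \sum_j f true 0%N j *: mono true 0 j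
     else \sum_c \sum_j f c n j *: mono c n j.

Lemma coef_of_coefs N f : f true 0%N =1 f false 0%N -> forall c n j,
  coef c n j (of_coefs N f) = if (n < N)%N then f c n j else 0.
Proof.
move=> f0 c n j; rewrite linear_sum /=.
have key (m : nat) : coef c n j (if m == 0%N then \sum_j f true 0%N j *: mono true 0 j
     else \sum_c \sum_j f c m j *: mono c m j) = if m == n then f c n j else 0.
  have pick d : coef c n j (\sum_i f d m i *: mono d m i) =
      if (m == n) && ((m == 0%N) || (d == c)) then f d m j else 0.
    rewrite linear_sum (bigD1 j) //= big1 ?addr0 => [|i ij].
      by rewrite linearZ /= coef_mono eqxx /=; case: ifP; rewrite ?mulr1 ?mulr0.
    by rewrite linearZ /= coef_mono (negPf ij) mulr0.
  case: eqP => [m0|/eqP m0].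
    move: (pick true); rewrite m0 andbT => ->.
    by case: eqP => // <-; case: c {pick}.
  rewrite linear_sum big_bool /=; apply: etrans (f_equal2 +%R (pick true) (pick false)) _.
  rewrite (negPf m0) /=.
  by case: eqP => [->|]; case: c {pick} => /=; rewrite ?addr0 ?add0r.
transitivity (\sum_(m < N) if m == n :> nat then f c n j else 0).
  by apply: eq_bigr => m _; apply: key.
case: ltnP => nN.
  rewrite (bigD1 (Ordinal nN)) //= eqxx big1 ?addr0 // => i /eqP ni.
  by case: eqP => // e; case: ni; apply: val_inj.
rewrite big1 // => i _; case: eqP => // e.
by move: nN; rewrite -e leqNgt ltn_ord.
Qed.

Lemma mono_arrow c n j :
  mono c n.+1 j = mono c n (partner c j) * pi (path_elt F (parrow (arr hk c j))).
Proof.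
have h : @composable Q (tgt (arr hk c j)) (word hk c n (partner c j)).
  by rewrite tgt_arr word_composable.
rewrite mono.unlock -bpiM; congr bpi; rewrite [LHS](path_elt_head F _ h).
by congr (path_elt F _ * _); apply: val_inj; rewrite /= tgt_arr.
Qed.

Lemma of_coefs_id b N : (forall c n j, (N <= n)%N -> coef c n j b = 0) ->
  of_coefs N (fun c n j => coef c n j b) = b.
Proof.
move=> hN; apply: coef_ext => c n j; rewrite coef_of_coefs.
  by case: ltnP => // h; rewrite hN.
by move=> i; apply: coef_deg0.
Qed.

(** A path of positive length ends in an arrow, and conversely the trivial paths
    of a product come only from trivial paths. *)
Lemma arrow_idealE b : arrow_ideal (@B_rel_triv k hk F) b <->
  forall c j, coef c 0 j b = 0.
Proof.
split=> [|h].
  have Z0 c j : coef c 0 j 0 = 0 by rewrite linear0.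
  have ZD x y : (forall c j, coef c 0 j x = 0) -> (forall c j, coef c 0 j y = 0) ->
      forall c j, coef c 0 j (x + y) = 0.
    by move=> hx hy c j; rewrite linearD /= hx hy addr0.
  have Zl a x : (forall c j, coef c 0 j x = 0) -> forall c j, coef c 0 j (a * x) = 0.
    by move=> hx c j; rewrite coefM big_ord1 hx mulr0.
  have Zr a x : (forall c j, coef c 0 j x = 0) -> forall c j, coef c 0 j (x * a) = 0.
    by move=> hx c j; rewrite coefM big_ord1 hx mul0r.
  pose J := @Ideal B (fun b => forall c j, coef c 0 j b = 0) Z0 ZD Zl Zr.
  apply: (@ideal_gen_min _ _ J).
  move=> _ [a ->] c j /=; rewrite coef_pi -path_eltE pcoef_elt.
  by case: eqP.
have [N hN] := coef_bounded b; rewrite -(of_coefs_id hN).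
have Jm c n j : arrow_ideal (@B_rel_triv k hk F) (mono c n.+1 j).
  rewrite mono_arrow; apply: idealMl => J; apply.
  by exists (arr hk c j); rewrite path_eltE.
rewrite /of_coefs; apply: ideal_sum => n _; case: ifP => [_|/negbT n0].
  by apply: ideal_sum => j _; rewrite h scale0r; apply: ideal0.
apply: ideal_sum => c _; apply: ideal_sum => j _; apply: idealZ.
by move: n0; case: (nat_of_ord n).
Qed.

Lemma path_elt_length c n j (p : qpath Q) :
  plength p != n -> pcoef c n j (path_elt F p) = 0.
Proof.
move=> pn; rewrite pcoef_elt; case: eqP => // e; move: pn.
by rewrite /plength /parrows e /= size_word eqxx.
Qed.

Lemma Bhat_degreeE n b : @Bhat_degree k hk F n b <->
  forall c m j, m != n -> coef c m j b = 0.
Proof.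
split=> [[u hu ->] c m j mn|h].
  rewrite coef_pi (path_algebra_sum u) linear_sum /= big_seq big1 // => p pu.
  rewrite linearZ /= path_elt_length ?mulr0 //.
  by rewrite (hu p pu) eq_sym.
pose u := blift b.
exists (\sum_(p <- msupp u | plength p == n) mcoeff p u *: path_elt F p).
  move=> p; rewrite -mcoeff_neq0 raddf_sum /= => hp; apply/eqP.
  apply: contra_neqT hp => pn; rewrite big1 // => q /eqP qn.
  rewrite mcoeffZ -[X in _ * X]path_coef_valE path_coef_elt pvalE val_eqE.
  by case: eqP => [e|]; rewrite ?mulr0 //; case/eqP: pn; rewrite -e.
apply: coef_ext => c m j; rewrite coef_pi.
have [-> |mn] := eqVneq m n; last first.
  rewrite h // linear_sum big1 // => p /eqP pn.
  by rewrite linearZ /= path_elt_length ?mulr0 // pn eq_sym.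
rewrite -[b in LHS]bliftK coef_pi -/u {1}(path_algebra_sum u).
rewrite [in LHS](bigID (fun p => plength p == n)) /= linearD /= [X in _ + X]linear_sum.
rewrite [X in _ + X]big1 ?addr0 // => p pn.
by rewrite linearZ /= path_elt_length ?mulr0.
Qed.

End Coordinates.

(** With the descriptions of the grading and of the arrow ideal, all that is used
    of $\hat B^k$ from here on: coordinates in the basis of monochromatic words,
    for which the product is a convolution twisted by the involution that moves
    the source along each colour. *)
Record coordinates (k : nat) (F : fieldType) (B : algType F) := {
  crd : bool -> nat -> 'I_k -> B -> F;
  crd_is_linear : forall c n j, linear_for *%R (crd c n j);
  crd_deg0 : forall c d j b, crd c 0 j b = crd d 0 j b;
  crd1 : forall c n j, crd c n j 1 = (n == 0%N)%:R;
  crdM : forall c n j a b, crd c n j (a * b) =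
    \sum_(m < n.+1) crd c (n - m) (iter m (partner c) j) a * crd c m j b;
  crd_ext : forall a b, (forall c n j, crd c n j a = crd c n j b) -> a = b;
  crd_bounded : forall b, exists N, forall c n j, (N <= n)%N -> crd c n j b = 0;
  build : nat -> (bool -> nat -> 'I_k -> F) -> B;
  crd_build : forall N f, f true 0%N =1 f false 0%N -> forall c n j,
    crd c n j (build N f) = if (n < N)%N then f c n j else 0 }.

HB.instance Definition _ k F B (K : @coordinates k F B) c n j :=
  GRing.isLinear.Build F B F *%R (crd K c n j) (crd_is_linear K c n j).

Definition Bhat_coordinates (k : nat) (hk : (2 <= k)%N) (F : fieldType) :
    coordinates k (Bhat_alg hk F) :=
  {| crd_is_linear := @coef_is_linear k hk F;
     crd_deg0 := @coef_deg0 k hk F;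
     crd1 := @coef1 k hk F;
     crdM := @coefM k hk F;
     crd_ext := @coef_ext k hk F;
     crd_bounded := @coef_bounded k hk F;
     crd_build := @coef_of_coefs k hk F |}.

(** * Koszulity *)

(** A vanishing sum of homogeneous elements has vanishing terms because the
    projections recover the terms from the sum. *)
Lemma direct_sum_proj (I : choiceType) (M : zmodType) (gr : I -> M -> Prop)
    (p : I -> M -> M) :
  (forall i, gr i 0 /\ forall x y, gr i x -> gr i y -> gr i (x - y)) ->
  (forall i x, gr i (p i x)) -> (forall i, {morph p i : x y / x + y}) ->
  (forall i j x, gr i x -> p j x = if j == i then x else 0) ->
  (forall x, exists s : seq I, x = \sum_(i <- s) p i x) ->
  direct_sum gr.
Proof.
move=> gr_sub grp pD p_gr p_sum; split=> // [x|s f us grf sf i si].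
  by have [s e] := p_sum x; exists s, (p^~ x).
have p0 : p i 0 = 0 by rewrite (p_gr i) ?if_same //; case: (gr_sub i).
have := congr1 (p i) sf; rewrite p0 (big_morph (p i) (pD i) p0).
rewrite (bigD1_seq i) //= (p_gr i) // eqxx big1 ?addr0 // => j ji.
by rewrite (p_gr j) // eq_sym (negPf ji).
Qed.

Section Koszul.
Variables (k : nat) (F : fieldType) (B : algType F) (K : coordinates k B).
Local Notation crd := (crd K).
Variable gr : nat -> B -> Prop.
Hypothesis grE : forall n b, gr n b <-> forall c m j, m != n -> crd c m j b = 0.

(** The elements $X$ and $Y$. *)
Definition letter (c : bool) : B :=
  build K 2 (fun d n _ => ((n == 1%N) && (d == c))%:R).

Lemma crd_letter c d n j : crd d n j (letter c) = ((n == 1%N) && (d == c))%:R.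
Proof. by rewrite crd_build //; case: n => [|[|n]]. Qed.

Lemma crd_mul_letter c d n j b : crd d n j (b * letter c) =
  if (0 < n)%N && (d == c) then crd d n.-1 (partner d j) b else 0.
Proof.
rewrite crdM; case: n => [|n].
  by rewrite big_ord1 crd_letter mulr0.
rewrite (bigD1 (@Ordinal n.+2 1 isT)) //= big1 ?addr0 => [|i i1]; last first.
  rewrite crd_letter; case: eqP => [e|_]; last by rewrite mulr0.
  by case/eqP: i1; apply: val_inj.
by rewrite crd_letter subn1 /=; case: (d == c); rewrite (mulr1, mulr0).
Qed.

Definition no_colour (c : bool) (b : B) := forall n j, crd c n j b = 0.

(** Right multiplication by a letter shifts the coordinates of its colour by one
    step, without loss, and kills those of the other colour. *)
Lemma mul_letter_eq0 c b : b * letter c = 0 <-> no_colour c b.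
Proof.
split=> [h n j|h].
  have := congr1 (crd c n.+1 (partner c j)) h.
  by rewrite crd_mul_letter /= eqxx partnerK linear0.
apply: (crd_ext (c0 := K)) => d n j; rewrite crd_mul_letter linear0.
by case: andP => // -[_ /eqP ->].
Qed.

(** Without coordinates of colour [c], in particular at the vertices, all the
    paths of the element begin with an arrow of the other colour, which can be
    split off on the right. *)
Lemma no_colour_div c b : no_colour c b <-> exists q, b = q * letter (~~ c).
Proof.
split=> [h|[q ->] n j]; last by rewrite crd_mul_letter; case: c; rewrite andbF.
have [N hN] := crd_bounded K b.
exists (build K N (fun d n j => if (n == 0%N) || (d != c)
  then crd (~~ c) n.+1 (partner (~~ c) j) b else 0)).
apply: (crd_ext (c0 := K)) => d n j; rewrite crd_mul_letter.
have [->|dc] := eqVneq d c; first by rewrite h; case: c {h}; rewrite andbF.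
have -> : (d == ~~ c) by case: c d dc {h} => -[].
case: n => [|n] /=; first by rewrite (crd_deg0 K d c) h.
rewrite crd_build //= dc orbT.
have -> : ~~ c = d by case: c d dc {h} => -[].
by rewrite partnerK; case: ltnP => // nN; rewrite hN // leqW.
Qed.

Lemma colour_split b : (forall c j, crd c 0 j b = 0) ->
  exists f g, b = f * letter true + g * letter false.
Proof.
move=> h; have [N hN] := crd_bounded K b.
pose part c := build K N (fun d n j => if d == c then crd d n j b else 0).
have partE c d n j : crd d n j (part c) = if d == c then crd d n j b else 0.
  rewrite crd_build => [|i]; last by rewrite !h !if_same.
  by case: ltnP => // nN; rewrite hN // if_same.
have [f ef] : exists q, part true = q * letter (~~ false).
  by apply/no_colour_div => n j; rewrite partE.
have [g eg] : exists q, part false = q * letter (~~ true).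
  by apply/no_colour_div => n j; rewrite partE.
exists f, g; rewrite -[true]/(~~ false) -ef -[X in letter X]/(~~ true) -eg.
apply: (crd_ext (c0 := K)) => d n j; rewrite linearD /= !partE.
by case: d; rewrite ?addr0 ?add0r.
Qed.

(** The multiples of $X$ and of $Y$ have no path in common. *)
Lemma letter_sum_eq0 f g : f * letter true + g * letter false = 0 <->
  no_colour true f /\ no_colour false g.
Proof.
split=> [h|[hf hg]]; last first.
  by rewrite (mul_letter_eq0 true f).2 // (mul_letter_eq0 false g).2 // addr0.
have key d n j : crd d n j (f * letter true) + crd d n j (g * letter false) = 0.
  by rewrite -[LHS]linearD h linear0.
split=> n j.
  have := key true n.+1 (partner true j).
  by rewrite !crd_mul_letter /= partnerK addr0.
have := key false n.+1 (partner false j).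
by rewrite !crd_mul_letter /= partnerK add0r.
Qed.

(** ** Gradings *)

(** Integer degrees, because the terms of the resolution are shifted. *)
Definition degree (z : int) (b : B) := forall c m j, m%:Z != z -> crd c m j b = 0.

Lemma gr_degree n b : gr n b <-> degree n%:Z b.
Proof. exact: grE. Qed.

Lemma degree_sub z : degree z 0 /\
  forall x y, degree z x -> degree z y -> degree z (x - y).
Proof.
split=> [c m j _|x y hx hy c m j mz]; first by rewrite linear0.
by rewrite linearB /= hx // hy // subrr.
Qed.

Lemma degree_add z x y : degree z x -> degree z y -> degree z (x + y).
Proof. by move=> hx hy c m j mz; rewrite linearD /= hx // hy // addr0. Qed.

Lemma degree_mul y z a b : degree y a -> degree z b -> degree (y + z) (a * b).
Proof.
move=> ha hb c m j myz; rewrite crdM big1 // => i _.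
have [iz|iz] := eqVneq (nat_of_ord i)%:Z z; last by rewrite hb // mulr0.
rewrite ha ?mul0r //; apply: contra myz => /eqP <-.
by rewrite -iz -PoszD subnK // -ltnS.
Qed.

Lemma degree_one : degree 0 1.
Proof. by move=> c m j m0; rewrite crd1; case: m m0. Qed.

Lemma degree_letter c : degree 1 (letter c).
Proof. by move=> d m j m1; rewrite crd_letter; case: m m1 => [|[|m]]. Qed.

Definition component (z : int) (b : B) : B :=
  if z is Posz n then
    build K n.+1 (fun c m j => if m == n then crd c m j b else 0)
  else 0.

Lemma crd_component z b c m j :
  crd c m j (component z b) = if m%:Z == z then crd c m j b else 0.
Proof.
case: z => n /=; last by rewrite linear0.
rewrite crd_build => [|i]; last by rewrite (crd_deg0 K true false).
by rewrite eqz_nat ltnS; case: eqP => [->|]; rewrite ?leqnn ?if_same.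
Qed.

Arguments component : simpl never.

Lemma component_degree z b : degree z (component z b).
Proof. by move=> c m j mz; rewrite crd_component (negPf mz). Qed.

Lemma componentD z : {morph component z : a b / a + b}.
Proof.
move=> a b; apply: (crd_ext (c0 := K)) => c m j.
rewrite linearD /= !crd_component linearD /=.
by case: ifP; rewrite ?addr0.
Qed.

Lemma component_id y z b : degree y b -> component z b = if z == y then b else 0.
Proof.
move=> hb; apply: (crd_ext (c0 := K)) => c m j; rewrite crd_component.
have [-> |zy] := eqVneq z y.
  by case: eqP => // /eqP h; rewrite hb.
rewrite linear0; case: eqP => // mz; rewrite hb //.
by rewrite mz.
Qed.

Lemma sum_components b : exists N, forall M, (N <= M)%N ->
  b = \sum_(n <- iota 0 M) component n%:Z b.
Proof.
have [N hN] := crd_bounded K b; exists N => M NM.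
apply: (crd_ext (c0 := K)) => c m j; rewrite linear_sum /=.
transitivity (\sum_(n <- iota 0 M) if n == m then crd c m j b else 0); last first.
  by apply: eq_bigr => n _; rewrite crd_component eqz_nat eq_sym.
have [mM|mM] := ltnP m M.
  rewrite (bigD1_seq m) ?iota_uniq ?mem_iota //= eqxx big1 ?addr0 // => n.
  by move=> /negPf ->.
rewrite hN ?(leq_trans NM) // big_seq big1 // => n; rewrite mem_iota add0n /=.
by move=> nM; case: eqP => // e; move: mM; rewrite -e leqNgt nM.
Qed.

Lemma graded_ring_gr : graded_ring gr.
Proof.
split; [| |move=> i j a b /gr_degree ha /gr_degree hb; apply/gr_degree].
- apply: (direct_sum_proj (I := nat) (p := fun n : nat => component n%:Z)).
  + move=> n; split=> [|x y]; first by apply/gr_degree; case: (degree_sub n).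
    move=> /gr_degree hx /gr_degree hy; apply/gr_degree.
    by case: (degree_sub n) => _; apply.
  + by move=> n x; apply/gr_degree/component_degree.
  + by move=> n; apply: componentD.
  + by move=> i j x /gr_degree h; rewrite (component_id _ h) eqz_nat.
  + by move=> x; have [N hN] := sum_components x; exists (iota 0 N); apply: hN.
- by apply/gr_degree/degree_one.
- by rewrite PoszD; apply: degree_mul.
Qed.

(** The part of degree zero is a product of copies of the field, one for each
    vertex, so that a left ideal is the set of elements supported on some set
    of vertices; the complementary set of vertices gives a complement. *)
Lemma semisimple_gr0 : semisimple_subring (gr 0%N).
Proof.
move=> L [L0 Lz LB LM].
pose supp j := exists2 y, L y & crd true 0 j y != 0.
exists (fun x => gr 0%N x /\ forall j, supp j -> crd true 0 j x = 0).
have gr0_ext x y : gr 0%N x -> gr 0%N y ->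
    (forall j, crd true 0 j x = crd true 0 j y) -> x = y.
  move=> /grE hx /grE hy h; apply: (crd_ext (c0 := K)) => c [|n] j.
    by rewrite !(crd_deg0 K c true) h.
  by rewrite hx ?hy.
have gr_part (f : 'I_k -> F) : exists2 x, gr 0%N x & forall j, crd true 0 j x = f j.
  exists (build K 1 (fun _ _ j => f j)); last by move=> j; rewrite crd_build.
  by apply/grE => c m j m0; rewrite crd_build //; case: m m0.
have gr0 : gr 0%N 0 by apply/grE => c m j _; rewrite linear0.
split.
- split=> [x []//| |x y [hx hx'] [hy hy']|a x ha [hx hx']].
  + by split=> // j _; rewrite linear0.
  + split; first by apply/gr_degree; case: (degree_sub 0) => _; apply; apply/gr_degree.
    by move=> j sj; rewrite linearB /= hx' // hy' // subrr.
  + split.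
      by apply/gr_degree; rewrite -[Posz 0]addr0; apply: degree_mul; apply/gr_degree.
    by move=> j sj; rewrite crdM big_ord1 hx' // mulr0.
- move=> x Lx [hx h]; apply: gr0_ext => // j; rewrite linear0.
  have [//|xj] := eqVneq (crd true 0 j x) 0.
  by rewrite h //; exists x.
move=> x hx.
have Lsum (T : Type) (r : seq T) (f : T -> B) :
    (forall i, L (f i)) -> L (\sum_(i <- r) f i).
  move=> hf; elim/big_rec: _ => // i z _ hz.
  have Nz : L (- z) by rewrite -[- z]add0r; apply: LB.
  by rewrite -[z]opprK; apply: LB.
have Lpart j : exists2 y, L y & (forall i, crd true 0 i y =
    if i == j then if `[< supp j >] then crd true 0 j x else 0 else 0).
  case: asboolP => [[y Ly yj]|_]; last first.
    by exists 0 => // i; rewrite linear0 if_same.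
  have [e he eE] := gr_part (fun i =>
    if i == j then crd true 0 j x / crd true 0 j y else 0).
  exists (e * y); first exact: LM.
  move=> i; rewrite crdM big_ord1 /= eE.
  by case: eqP => [->|]; rewrite ?mul0r // divfK.
pose z j := s2val (cid2 (Lpart j)).
have Lz' : L (\sum_j z j) by apply: Lsum => j; rewrite /z; case: cid2.
have zE i : crd true 0 i (\sum_j z j) = if `[< supp i >] then crd true 0 i x else 0.
  rewrite linear_sum /= (bigD1 i) //= big1 ?addr0 => [|j ij].
    by rewrite /z; case: cid2 => /= y _ ->; rewrite eqxx.
  by rewrite /z; case: cid2 => /= y _ ->; rewrite eq_sym (negPf ij).
exists (\sum_j z j), (x - \sum_j z j); split=> //; last by rewrite addrC subrK.
split.
  by apply/gr_degree; case: (degree_sub 0) => _; apply; apply/gr_degree => //; apply: L0.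
by move=> j sj; rewrite linearB /= zE asboolT // subrr.
Qed.

(** ** The Koszul resolution *)

Lemma positive_idealE b : positive_ideal gr b <-> forall c j, crd c 0 j b = 0.
Proof.
split=> [|h].
  have Z0 c j : crd c 0 j 0 = 0 by rewrite linear0.
  have ZD x y : (forall c j, crd c 0 j x = 0) -> (forall c j, crd c 0 j y = 0) ->
      forall c j, crd c 0 j (x + y) = 0.
    by move=> hx hy c j; rewrite linearD /= hx hy addr0.
  have Zl a x : (forall c j, crd c 0 j x = 0) -> forall c j, crd c 0 j (a * x) = 0.
    by move=> hx c j; rewrite crdM big_ord1 hx mulr0.
  have Zr a x : (forall c j, crd c 0 j x = 0) -> forall c j, crd c 0 j (x * a) = 0.
    by move=> hx c j; rewrite crdM big_ord1 hx mul0r.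
  pose J := @Ideal B (fun b => forall c j, crd c 0 j b = 0) Z0 ZD Zl Zr.
  apply: (@ideal_gen_min _ _ J).
  by move=> x [[//|n] _ /grE hx] c j /=; rewrite hx.
have [f [g ->]] := colour_split h.
have letterP c : positive_ideal gr (letter c).
  by move=> J; apply; exists 1%N => //; apply/gr_degree/degree_letter.
by apply: idealD; apply: idealMl; apply: letterP.
Qed.

(** In degree $i\ge1$ there are two alternating words of length $i$ from each
    vertex, one for each first letter; the projectives $Be_j$ that belong to the
    words with the same first letter add up to a free module of rank one. *)
Definition koszul_term (i : nat) : lmodType B :=
  if i is _.+1 then (B^o * B^o)%type else B^o.

Definition koszul_degree (i : nat) : int -> koszul_term i -> Prop :=
  match i return int -> koszul_term i -> Prop with
  | 0%N => fun z p => degree z p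
  | i.+1 => fun z p => degree (z - i.+1%:Z) p.1 /\ degree (z - i.+1%:Z) p.2
  end.

Definition koszul_d0 (p : B^o * B^o) : B^o :=
  (p.1 : B) * letter true + (p.2 : B) * letter false.

Lemma regular_scaleE (a b : B) : a *: (b : B^o) = a * b. Proof. by []. Qed.

Lemma koszul_d0_is_linear : linear koszul_d0.
Proof.
move=> a p q; rewrite /koszul_d0 /= !mulrDl scalerDr !regular_scaleE.
by rewrite !(mulrA a) addrACA.
Qed.
HB.instance Definition _ :=
  GRing.isLinear.Build B _ _ _ koszul_d0 koszul_d0_is_linear.

(** The letters alternate along each copy; the first copy begins with $X$ in
    [koszul_d0], hence the parity. *)
Definition koszul_dS (i : nat) (p : B^o * B^o) : B^o * B^o :=
  ((p.1 : B) * letter (odd i), (p.2 : B) * letter (~~ odd i)).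

Lemma koszul_dS_is_linear i : linear (koszul_dS i).
Proof.
move=> a p q; rewrite /koszul_dS /= !mulrDl; congr pair.
  by rewrite regular_scaleE -(mulrA a).
by rewrite regular_scaleE -(mulrA a).
Qed.
HB.instance Definition _ i :=
  GRing.isLinear.Build B _ _ _ (koszul_dS i) (koszul_dS_is_linear i).

Definition koszul_d (i : nat) : {linear koszul_term i.+1 -> koszul_term i} :=
  match i return {linear koszul_term i.+1 -> koszul_term i} with
  | 0%N => koszul_d0
  | i.+1 => koszul_dS i
  end.

Definition koszul_aug (b : B^o) : degree0_module gr := qpi (positive_ideal gr) b.

Lemma koszul_aug_is_linear : linear koszul_aug.
Proof. by move=> a x y; rewrite /koszul_aug qpiD qpiM. Qed.
HB.instance Definition _ :=
  GRing.isLinear.Build B _ _ _ koszul_aug koszul_aug_is_linear.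

Lemma free1_projective : projective_module (B^o : lmodType B).
Proof.
move=> M N g f g_surj; have [x gx] := g_surj (f 1).
pose h (p : B^o) : M := (p : B) *: x.
have h_lin : linear h by move=> a p q; rewrite /h scalerDl scalerA.
pose hL := GRing.isLinear.Build B _ _ _ h h_lin.
exists (HB.pack_for {linear B^o -> M} h hL) => p.
by rewrite /= /h linearZ /= gx -linearZ /=; congr (f _); apply: mulr1.
Qed.

Lemma free2_projective : projective_module ((B^o * B^o)%type : lmodType B).
Proof.
move=> M N g f g_surj.
have [x gx] := g_surj (f (1, 0)); have [y gy] := g_surj (f (0, 1)).
pose h (p : B^o * B^o) : M := (p.1 : B) *: x + (p.2 : B) *: y.
have h_lin : linear h.
  by move=> a p q; rewrite /h /= !scalerDl scalerDr !scalerA addrACA.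
pose hL := GRing.isLinear.Build B _ _ _ h h_lin.
exists (HB.pack_for {linear (B^o * B^o)%type -> M} h hL) => p.
rewrite /= /h linearD !linearZ /= gx gy -!linearZ -linearD /=; congr (f _).
case: p => u v; congr pair => /=.
  by rewrite /GRing.scale /= mulr1 mulr0 addr0.
by rewrite /GRing.scale /= mulr1 mulr0 add0r.
Qed.

Lemma koszul_degree_graded i : graded_module gr (@koszul_degree i).
Proof.
split; last first.
  move=> n z a m /gr_degree ha; case: i m => [|i] m /=; first exact: degree_mul.
  by move=> [h1 h2]; rewrite -addrA; split; apply: degree_mul.
case: i => [|i].
  apply: (direct_sum_proj (p := component)).
  - exact: degree_sub.
  - exact: component_degree.
  - exact: componentD.
  - by move=> y z x h; apply: component_id.
  - move=> x; have [N hN] := sum_components x; exists (map Posz (iota 0 N)).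
    by rewrite big_map; apply: hN.
apply: (direct_sum_proj (p := fun z p =>
    (component (z - i.+1%:Z) p.1, component (z - i.+1%:Z) p.2))).
- move=> z; have [h0 hB] := degree_sub (z - i.+1%:Z).
  by split=> [|x y [hx1 hx2] [hy1 hy2]]; split=> //=; apply: hB.
- by move=> z x; split; apply: component_degree.
- by move=> z x y /=; rewrite !componentD.
- move=> y z x [h1 h2]; rewrite (component_id _ h1) (component_id _ h2).
  by rewrite (inj_eq (addIr _)); case: ifP => // _; case: x {h1 h2}.
- move=> [x y]; have [N hN] := sum_components x; have [M hM] := sum_components y.
  exists [seq n%:Z + i.+1%:Z | n <- iota 0 (maxn N M)]; rewrite big_map.
  have fstD : {morph (fst : B^o * B^o -> B^o) : a b / a + b} by [].
  have sndD : {morph (snd : B^o * B^o -> B^o) : a b / a + b} by [].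
  rewrite [RHS]surjective_pairing (big_morph _ fstD (erefl _)).
  rewrite (big_morph _ sndD (erefl _)) /=.
  congr pair.
    by rewrite {1}(hN _ (leq_maxl N M)); apply: eq_bigr => n _; rewrite addrK.
  by rewrite {1}(hM _ (leq_maxr N M)); apply: eq_bigr => n _; rewrite addrK.
Qed.

(** Exactness at each term is [no_colour_div] combined with [mul_letter_eq0]. *)
Lemma koszul_gr : koszul gr.
Proof.
split; [exact: graded_ring_gr|exact: semisimple_gr0|].
exists koszul_term, koszul_degree, koszul_d, koszul_aug; split.
- move=> i; split; first exact: koszul_degree_graded.
    by case: i => [|i]; [exact: free1_projective|exact: free2_projective].
  case: i => [|i] m.
    exists 1%N, (fun=> m : B), (fun=> 1); split; first by move=> _; apply: degree_one.
    by rewrite big_ord1 /GRing.scale /= mulr1.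
  exists 2%N, (fun n => if n == ord0 then m.1 else m.2).
  exists (fun n => if n == ord0 then (1, 0) else (0, 1)); split.
    have d0 : degree 0 0 by case: (degree_sub 0).
    have d1 := degree_one.
    by move=> n /=; rewrite subrr; case: ifP.
  rewrite big_ord_recl big_ord1 /=; case: m => u v; congr pair => /=.
    by rewrite /GRing.scale /= mulr1 mulr0 addr0.
  by rewrite /GRing.scale /= mulr1 mulr0 add0r.
- split=> [[|i] z p [h1 h2]|z p z0 hp] /=.
  + rewrite -[z](subrK 1%:Z); apply: degree_add; apply: degree_mul;
      by [exact: h1|exact: h2|exact: degree_letter].
  + have -> : z - i.+1%:Z = z - i.+2%:Z + 1.
      by rewrite -[in RHS]addn1 PoszD opprD addrA subrK.
    by split; apply: degree_mul => //; apply: degree_letter.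
  + rewrite /koszul_aug -(qpi0 (positive_ideal gr)); apply: qpi_eq; rewrite subr0.
    by apply/positive_idealE => c j; rewrite hp // eq_sym.
- by move=> z; exists (qrepr z); apply: qreprK.
- move=> p; split=> [h|[q ->]].
    have /positive_idealE/colour_split [f [g e]] : positive_ideal gr p.
      by have /qpiP/asboolP := etrans h (esym (qpi0 _)); rewrite subr0.
    by exists (f, g).
  rewrite /= /koszul_aug -(qpi0 (positive_ideal gr)); apply: qpi_eq; rewrite subr0.
  by apply/positive_idealE => c j; rewrite linearD /= !crd_mul_letter addr0.
case=> [|i] [f g] /=.
- rewrite /koszul_d0 letter_sum_eq0; split.
    move=> [/no_colour_div [f' ef] /no_colour_div [g' eg]].
    by exists (f', g'); apply: (f_equal2 pair ef eg).
  case=> -[f' g'] e; have ef : f = f' * letter false := congr1 fst e.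
  have eg : g = g' * letter true := congr1 snd e.
  by rewrite ef eg; split; apply/no_colour_div; [exists f'|exists g'].
- split=> [e|].
    have /mul_letter_eq0/no_colour_div [f' ef] : f * letter (odd i) = 0
      := congr1 fst e.
    have /mul_letter_eq0/no_colour_div [g' eg] : g * letter (~~ odd i) = 0
      := congr1 snd e.
    by exists (f', g'); apply: (f_equal2 pair ef eg).
  case=> -[f' g'] e; have ef : f = f' * letter (~~ odd i) := congr1 fst e.
  have eg : g = g' * letter (~~ ~~ odd i) := congr1 snd e.
  rewrite ef eg; congr pair; apply/mul_letter_eq0/no_colour_div; first by exists f'.
  by exists g'.
Qed.

End Koszul.

(** * Coordinates in $A^k$ *)

Section AVertices.
Variables (k : nat) (hk : (2 <= k)%N).

(** The arrows of $A^k$ are coloured like those of $\hat B^k$ with the same source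
    and target; the two loops of $\hat B^k$ have no counterpart in $A^k$. *)
Definition linked (c : bool) (j : 'I_k) : bool := partner c j != j.

Lemma linkedE c j : linked c j = if c (+) odd j then (j.+1 < k)%N else (0 < j)%N.
Proof.
rewrite /linked -val_eqE /= partnerE; case: ifP => _.
  by case: ifP => _; rewrite ?eqxx // neq_ltn ltnSn orbT.
by case: (nat_of_ord j) => // n; rewrite neq_ltn ltnSn.
Qed.

Lemma linked_partner c j : linked c (partner c j) = linked c j.
Proof. by rewrite /linked partnerK eq_sym. Qed.

Local Notation Q := (A_quiver hk).

Lemma edge_exists : (0 < k.-1)%N.
Proof. by rewrite -subn1 subn_gt0. Qed.

(** Meaningful only when [linked c j] holds. *)
Definition edge (c : bool) (j : 'I_k) : arrow Q :=
  let i0 := Ordinal edge_exists in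
  if c (+) odd j then inl (insubd i0 (j : nat)) else inr (insubd i0 j.-1).

Lemma edge_up c (i : 'I_k.-1) (j : 'I_k) : j = i :> nat -> c (+) odd j ->
  edge c j = inl i.
Proof.
move=> ji up; rewrite /edge up; congr inl; apply: val_inj.
by rewrite val_insubd ji ltn_ord.
Qed.

Lemma edge_down c (i : 'I_k.-1) (j : 'I_k) : j = i.+1 :> nat ->
  ~~ (c (+) odd j) -> edge c j = inr i.
Proof.
move=> ji up; rewrite /edge (negPf up); congr inr; apply: val_inj.
by rewrite val_insubd ji /= ltn_ord.
Qed.

Lemma linkedP c j : linked c j -> exists i : 'I_k.-1,
  if c (+) odd j then j = i :> nat /\ edge c j = inl i
  else j = i.+1 :> nat /\ edge c j = inr i.
Proof.
rewrite linkedE; case: ifP => up h.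
  have ik : (j < k.-1)%N by rewrite ltn_predRL.
  by exists (Ordinal ik); split=> //; apply: edge_up.
have ik : (j.-1 < k.-1)%N.
  by rewrite -ltnS !prednK ?ltn_ord //; apply: leq_trans hk.
have ji : nat_of_ord j = (Ordinal ik).+1 by rewrite /= prednK.
by exists (Ordinal ik); split=> //; apply: edge_down => //; rewrite up.
Qed.

Lemma src_edge c j : linked c j -> src (edge c j) = j.
Proof.
by move=> l; case: (linkedP l) => i; case: ifP => _ [ji ->]; apply: val_inj.
Qed.

Lemma tgt_edge c j : linked c j -> tgt (edge c j) = partner c j.
Proof.
move=> l; case: (linkedP l) => i; move: l; rewrite linkedE.
case: ifP => up l [ji ->]; apply: val_inj; rewrite /= partnerE up.
  by rewrite l ji.
by rewrite ji.
Qed.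

Lemma edgeP (a : arrow Q) : exists c j, linked c j /\ a = edge c j.
Proof.
case: a => i.
  have lk : (i < k)%N by apply: leq_trans (ltn_ord i) (leq_pred k).
  have up : ~~ odd i (+) odd (Ordinal lk) by rewrite addNb addbb.
  exists (~~ odd i), (Ordinal lk); rewrite linkedE up; split.
    by rewrite -ltn_predRL /= ltn_ord.
  by rewrite (@edge_up _ i).
have lk : (i.+1 < k)%N by rewrite -ltn_predRL ltn_ord.
have up : ~~ odd i (+) odd (Ordinal lk) = false by rewrite /= addbb.
exists (~~ odd i), (Ordinal lk); rewrite linkedE up; split=> //.
by rewrite (@edge_down _ i) ?up.
Qed.

End AVertices.

(** The coordinates of $A^k$ are the coefficients of the trivial paths and of the
    arrows, and, since the two paths that leave an inner vertex and return to it
    become equal in $A^k$, the sum of their coefficients. *)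
Section AFunctionals.
Variables (k : nat) (hk : (2 <= k)%N) (F : fieldType).
Local Notation Q := (A_quiver hk).
Local Notation P := (path_algebra F Q).

Definition acoef (j : 'I_k) (s : seq (arrow Q)) (u : P) : F :=
  path_coef (j : vertex Q) s u.

Lemma acoef_is_linear j s : linear_for *%R (acoef j s).
Proof. by move=> a u v; rewrite /acoef linearP. Qed.
HB.instance Definition _ j s :=
  GRing.isLinear.Build F P F *%R (acoef j s) (acoef_is_linear j s).

Lemma acoef0M j u v : acoef j [::] (u * v) = acoef j [::] u * acoef j [::] v.
Proof. by rewrite /acoef path_coefM big_ord1. Qed.

Definition arrow_coef c j (u : P) : F :=
  if linked c j then acoef j [:: edge hk c j] u else 0.

Lemma arrow_coef_is_linear c j : linear_for *%R (arrow_coef c j).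
Proof.
move=> a u v; rewrite /arrow_coef; case: ifP => _; first exact: linearP.
by rewrite mulr0 addr0.
Qed.
HB.instance Definition _ c j :=
  GRing.isLinear.Build F P F *%R (arrow_coef c j) (arrow_coef_is_linear c j).

Lemma arrow_coefM c j u v : arrow_coef c j (u * v) =
  acoef (partner c j) [::] u * arrow_coef c j v + arrow_coef c j u * acoef j [::] v.
Proof.
rewrite /arrow_coef; case: ifP => l; last by rewrite mulr0 mul0r addr0.
rewrite /acoef path_coefM /= big_ord_recl big_ord1 /= addrC.
by rewrite /path_end /= tgt_edge.
Qed.

Definition return_coef c j (u : P) : F :=
  if linked c j then acoef j [:: edge hk c j; edge hk c (partner c j)] u else 0.

Lemma return_coef_is_linear c j : linear_for *%R (return_coef c j).
Proof.
move=> a u v; rewrite /return_coef; case: ifP => _; first exact: linearP.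
by rewrite mulr0 addr0.
Qed.
HB.instance Definition _ c j :=
  GRing.isLinear.Build F P F *%R (return_coef c j) (return_coef_is_linear c j).

Lemma return_coefM c j u v : return_coef c j (u * v) =
  acoef j [::] u * return_coef c j v
  + arrow_coef c (partner c j) u * arrow_coef c j v
  + return_coef c j u * acoef j [::] v.
Proof.
rewrite /return_coef /arrow_coef linked_partner.
case: ifP => l; last by rewrite !(mulr0, mul0r) !addr0.
rewrite /acoef path_coefM /= !big_ord_recl big_ord0 /= addr0.
rewrite /path_end /= !tgt_edge ?linked_partner // partnerK.
by rewrite addrC; congr (_ + _); rewrite addrC.
Qed.

Definition socle_coef j (u : P) : F := return_coef true j u + return_coef false j u.

Lemma socle_coef_is_linear j : linear_for *%R (socle_coef j).
Proof.
by move=> a u v; rewrite /socle_coef !linearP /= mulrDr addrACA.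
Qed.
HB.instance Definition _ j :=
  GRing.isLinear.Build F P F *%R (socle_coef j) (socle_coef_is_linear j).

Lemma socle_coefM j u v : socle_coef j (u * v) =
  acoef j [::] u * socle_coef j v + socle_coef j u * acoef j [::] v
  + \sum_c arrow_coef c (partner c j) u * arrow_coef c j v.
Proof.
rewrite /socle_coef !return_coefM big_bool /= mulrDr mulrDl.
by rewrite [X in X + _]addrAC [X in _ + X]addrAC addrACA; congr (_ + _); rewrite addrACA.
Qed.

Definition A_null (u : P) :=
  [/\ forall j, acoef j [::] u = 0, forall c j, arrow_coef c j u = 0
    & forall j, socle_coef j u = 0].

Lemma A_null0 : A_null 0.
Proof. by split=> *; rewrite linear0. Qed.
Lemma A_nullD u v : A_null u -> A_null v -> A_null (u + v).
Proof.
by move=> [h1 h2 h3] [g1 g2 g3]; split=> *;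
  rewrite linearD /= ?h1 ?h2 ?h3 ?g1 ?g2 ?g3 addr0.
Qed.
Lemma A_nullMl u v : A_null v -> A_null (u * v).
Proof.
move=> [h1 h2 h3]; split=> *.
- by rewrite acoef0M h1 mulr0.
- by rewrite arrow_coefM h1 h2 !mulr0 addr0.
- rewrite socle_coefM h1 h3 !mulr0 addr0 add0r big1 // => c _.
  by rewrite h2 mulr0.
Qed.
Lemma A_nullMr u v : A_null v -> A_null (v * u).
Proof.
move=> [h1 h2 h3]; split=> *.
- by rewrite acoef0M h1 mul0r.
- by rewrite arrow_coefM h1 h2 !mul0r addr0.
- rewrite socle_coefM h1 h3 !mul0r addr0 add0r big1 // => c _.
  by rewrite h2 mul0r.
Qed.
Definition null_ideal : ideal P := Ideal A_null0 A_nullD A_nullMl A_nullMr.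

End AFunctionals.

Section AGenerators.
Variables (k : nat) (hk : (2 <= k)%N) (F : fieldType).
Local Notation Q := (A_quiver hk).
Local Notation P := (path_algebra F Q).
Local Notation ac := (@acoef k hk F).
Local Notation wc := (@arrow_coef k hk F).
Local Notation sc := (@socle_coef k hk F).
Local Notation a := (a_ hk F).
Local Notation b := (b_ hk F).

Lemma acoef_elt (j : 'I_k) s (p : qpath Q) :
  ac j s (path_elt F p) = (val p == (j, s))%:R.
Proof. exact: path_coef_elt. Qed.

Lemma arrow_coef_elt c j (al : arrow Q) :
  wc c j (path_elt F (parrow al)) = (linked c j && (al == edge hk c j))%:R.
Proof.
rewrite /arrow_coef; case: ifP => // l; rewrite acoef_elt /=.
congr (nat_of_bool _)%:R; apply/eqP/eqP => [[]//|->].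
by rewrite src_edge.
Qed.

Lemma return_coef_short c j (p : qpath Q) :
  size (parrows p) != 2%N -> @return_coef k hk F c j (path_elt F p) = 0.
Proof.
move=> p2; rewrite /return_coef; case: ifP => // l; rewrite acoef_elt.
by case: eqP => // e; move: p2; rewrite /parrows e.
Qed.

Lemma socle_coef_short j (p : qpath Q) :
  size (parrows p) != 2%N -> sc j (path_elt F p) = 0.
Proof. by move=> p2; rewrite /socle_coef !return_coef_short ?addr0. Qed.

Lemma vtx_E (j : 'I_k) : vtx_ hk F j.+1 = path_elt F (ptriv (j : vertex Q)).
Proof. by rewrite /vtx_ (big_pred1 j) ?path_eltE // => i; rewrite eqSS. Qed.

Lemma a_sum s : a s = \sum_(i : 'I_k.-1 | i.+1 == s) path_elt F (@parrow Q (inl i)).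
Proof. by apply: eq_bigr => i _; rewrite path_eltE. Qed.

Lemma b_sum s : b s = \sum_(i : 'I_k.-1 | i.+1 == s) path_elt F (@parrow Q (inr i)).
Proof. by apply: eq_bigr => i _; rewrite path_eltE. Qed.

Lemma a_out s : (s == 0%N) || (k <= s)%N -> a s = 0.
Proof.
move=> h; rewrite a_sum big_pred0 // => i; apply: contraTF h => /eqP <- /=.
by rewrite -ltnNge -ltn_predRL.
Qed.

Lemma b_out s : (s == 0%N) || (k <= s)%N -> b s = 0.
Proof.
move=> h; rewrite b_sum big_pred0 // => i; apply: contraTF h => /eqP <- /=.
by rewrite -ltnNge -ltn_predRL.
Qed.

Lemma acoef_a j s : ac j [::] (a s) = 0.
Proof. by rewrite a_sum linear_sum big1 // => i _; rewrite /= acoef_elt; case: eqP. Qed.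

Lemma acoef_b j s : ac j [::] (b s) = 0.
Proof. by rewrite b_sum linear_sum big1 // => i _; rewrite /= acoef_elt; case: eqP. Qed.

Lemma sum_indicator (I : finType) (A : pred I) (i : I) :
  \sum_(j | A j) (j == i)%:R = (A i)%:R :> F.
Proof.
have [Ai|Ai] := boolP (A i).
  by rewrite (bigD1 i) //= eqxx big1 ?addr0 // => j /andP [_ /negPf ->].
by rewrite big1 // => j Aj; case: eqP => // e; move: Ai; rewrite -e Aj.
Qed.

Lemma arrow_coef_a c j s : wc c j (a s) =
  [&& linked c j, c (+) odd j & j.+1 == s]%:R.
Proof.
rewrite a_sum linear_sum /=; under eq_bigr => i _ do rewrite arrow_coef_elt.
have [l|l] := boolP (linked c j); last by rewrite big1.
case: (linkedP hk l) => i0; case: ifP => up [ji ->] /=.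
  by rewrite sum_indicator ji.
by rewrite big1.
Qed.

Lemma arrow_coef_b c j s : wc c j (b s) =
  [&& linked c j, ~~ (c (+) odd j) & j == s :> nat]%:R.
Proof.
rewrite b_sum linear_sum /=; under eq_bigr => i _ do rewrite arrow_coef_elt.
have [l|l] := boolP (linked c j); last by rewrite big1.
case: (linkedP hk l) => i0; case: ifP => up [ji ->] /=.
  by rewrite big1.
by rewrite sum_indicator ji.
Qed.

Lemma socle_coef_a j s : sc j (a s) = 0.
Proof. by rewrite a_sum linear_sum big1 // => i _; rewrite /= socle_coef_short. Qed.

Lemma socle_coef_b j s : sc j (b s) = 0.
Proof. by rewrite b_sum linear_sum big1 // => i _; rewrite /= socle_coef_short. Qed.

Section RadicalProducts.
Variables (u v : P).
Hypotheses (u0 : forall j, ac j [::] u = 0) (v0 : forall j, ac j [::] v = 0).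
Lemma acoef_rad j : ac j [::] (u * v) = 0.
Proof. by rewrite acoef0M u0 mul0r. Qed.
Lemma arrow_coef_rad c j : wc c j (u * v) = 0.
Proof. by rewrite arrow_coefM u0 v0 mul0r mulr0 addr0. Qed.
Lemma socle_coef_rad j :
  sc j (u * v) = \sum_c wc c (partner c j) u * wc c j v.
Proof. by rewrite socle_coefM u0 v0 mul0r mulr0 !add0r. Qed.
End RadicalProducts.

Lemma parity_partner c (j : 'I_k) :
  linked c j -> c (+) odd (partner c j) = ~~ (c (+) odd j).
Proof.
rewrite linkedE partnerE; case: ifP => [up ->|up]; first by rewrite addbN up.
by case: (nat_of_ord j) up => // n up _; move: up; rewrite addbN => /negbFE ->.
Qed.

Lemma socle_coef_aa j s r : sc j (a s * a r) = 0.
Proof.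
rewrite socle_coef_rad; try by move=> i; apply: acoef_a.
rewrite big1 // => c _; rewrite !arrow_coef_a linked_partner.
by case: (boolP (linked c j)) => l; rewrite ?mul0r // parity_partner //;
  case: (_ (+) _); rewrite ?mul0r ?mulr0.
Qed.

Lemma socle_coef_bb j s r : sc j (b s * b r) = 0.
Proof.
rewrite socle_coef_rad; try by move=> i; apply: acoef_b.
rewrite big1 // => c _; rewrite !arrow_coef_b linked_partner.
by case: (boolP (linked c j)) => l; rewrite ?mul0r // parity_partner //;
  case: (_ (+) _); rewrite ?mul0r ?mulr0.
Qed.

Lemma socle_coef_ba (j : 'I_k) s : (s < k)%N -> sc j (b s * a s) = (j.+1 == s)%:R.
Proof.
move=> sk; rewrite socle_coef_rad;
  [|by move=> i; apply: acoef_b|by move=> i; apply: acoef_a].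
rewrite (bigD1 (~~ odd j)) //= big1 ?addr0 => [|c cj].
  rewrite [X in X * _]arrow_coef_b [X in _ * X]arrow_coef_a linked_partner.
  have up : ~~ odd j (+) odd j by rewrite addNb addbb.
  rewrite up; have [js|] := eqVneq j.+1 s; last by rewrite !andbF mulr0.
  have l : linked (~~ odd j) j by rewrite linkedE up js.
  rewrite l parity_partner // up partnerE up js sk.
  by rewrite eqxx mulr1.
rewrite [X in _ * X]arrow_coef_a; suff -> : c (+) odd j = false by rewrite andbF mulr0.
by case: c cj; case: odd.
Qed.

Lemma socle_coef_ab (j : 'I_k) s : (0 < s)%N -> sc j (a s * b s) = (j == s :> nat)%:R.
Proof.
move=> s0; rewrite socle_coef_rad;
  [|by move=> i; apply: acoef_a|by move=> i; apply: acoef_b].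
rewrite (bigD1 (odd j)) //= big1 ?addr0 => [|c cj].
  rewrite [X in X * _]arrow_coef_a [X in _ * X]arrow_coef_b linked_partner.
  have up : odd j (+) odd j = false by rewrite addbb.
  rewrite up; have [js|] := eqVneq (nat_of_ord j) s; last by rewrite !andbF mulr0.
  have l : linked (odd j) j by rewrite linkedE up js.
  rewrite l parity_partner // up partnerE up js prednK //.
  by rewrite eqxx mulr1.
rewrite [X in _ * X]arrow_coef_b; suff -> : c (+) odd j = true by rewrite andbF mulr0.
by case: c cj; case: odd.
Qed.

(** Two arrows in the same direction never form a returning path, each of the
    two terms of a commutation relation is the returning path at the same
    vertex, and a product of three arrows is too long for all coordinates. *)
Lemma A_rel_null u : A_rel u -> null_ideal hk F u.
Proof.
have a0 j s : ac j [::] (a s) = 0 by apply: acoef_a.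
have b0 j s : ac j [::] (b s) = 0 by apply: acoef_b.
have triple x y z : (forall j, ac j [::] x = 0) -> (forall j, ac j [::] y = 0) ->
    (forall j, ac j [::] z = 0) -> A_null (hk := hk) (x * y * z).
  move=> x0 y0 z0; have xy0 j : ac j [::] (x * y) = 0 by exact: (acoef_rad _ x0).
  split=> [j|c j|j]; [exact: (acoef_rad _ xy0)|exact: (arrow_coef_rad xy0 z0)|].
  rewrite (socle_coef_rad xy0 z0) big1 // => c _.
  by rewrite (arrow_coef_rad x0 y0) mul0r.
rewrite /A_rel; case: ifP => _.
  case=> ->; first exact: (triple _ _ _ (a0^~ _) (b0^~ _) (a0^~ _)).
  exact: (triple _ _ _ (b0^~ _) (a0^~ _) (b0^~ _)).
case=> i [] [i1 i2 ->].
- split=> [j|c j|j]; [exact: (acoef_rad _ (a0^~ _))| |exact: socle_coef_aa].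
  exact: (arrow_coef_rad (a0^~ _) (a0^~ _)).
- split=> [j|c j|j]; [exact: (acoef_rad _ (b0^~ _))| |exact: socle_coef_bb].
  exact: (arrow_coef_rad (b0^~ _) (b0^~ _)).
split=> [j|c j|j]; rewrite linearB /=.
- exact: etrans (f_equal2 (fun x y => x - y) (acoef_rad _ (b0^~ _) j)
    (acoef_rad _ (a0^~ _) j)) (subrr 0).
- exact: etrans (f_equal2 (fun x y => x - y)
    (arrow_coef_rad (b0^~ _) (a0^~ _) c j)
    (arrow_coef_rad (a0^~ _) (b0^~ _) c j)) (subrr 0).
have k1 : (0 < k.-1)%N by apply: leq_trans i2; apply: leq_trans i1.
have ik : (i < k)%N by rewrite -(prednK (ltnW hk)) ltnS.
have i0 : (0 < i.-1)%N by rewrite -ltnS prednK // ltnW.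
apply: etrans (f_equal2 (fun x y => x - y) (socle_coef_ba j ik)
  (socle_coef_ab j i0)) _.
have -> : (nat_of_ord j == i.-1) = (j.+1 == i) by rewrite -eqSS prednK // ltnW.
exact: subrr.
Qed.

End AGenerators.

(** ** The relations of $A^k$ in terms of colours *)

Section ARelations.
Variables (k : nat) (hk : (2 <= k)%N) (F : fieldType).
Local Notation Q := (A_quiver hk).
Local Notation P := (path_algebra F Q).
Local Notation A := (A_alg hk F).
Local Notation pi := (bpi (@A_rel_triv k hk F)).
Local Notation a := (A_a hk F).
Local Notation b := (A_b hk F).

Lemma A_out s : (s == 0%N) || (k <= s)%N -> a s = 0 /\ b s = 0.
Proof.
move=> h; split; first exact: etrans (congr1 pi (a_out hk F h)) (linear0 _).
exact: etrans (congr1 pi (b_out hk F h)) (linear0 _).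
Qed.

Lemma A_aa i : a i.+1 * a i = 0.
Proof.
case: i => [|i]; first by rewrite (A_out (s := 0) isT).1 mulr0.
have [h|h] := leqP k i.+2; first by rewrite (A_out (s := i.+2) h).1 mul0r.
apply: etrans (esym (bpiM _ _ _)) _; apply: bpi_rel; rewrite /A_rel.
rewrite gtn_eqF; last exact: leq_trans h.
by exists i.+1; constructor 1; split=> //; rewrite ltn_predRL.
Qed.

Lemma A_bb i : b i * b i.+1 = 0.
Proof.
case: i => [|i]; first by rewrite (A_out (s := 0) isT).2 mul0r.
have [h|h] := leqP k i.+2; first by rewrite (A_out (s := i.+2) h).2 mulr0.
apply: etrans (esym (bpiM _ _ _)) _; apply: bpi_rel; rewrite /A_rel.
rewrite gtn_eqF; last exact: leq_trans h.
by exists i.+1; constructor 2; split=> //; rewrite ltn_predRL.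
Qed.

Lemma A_ba i : (0 < i)%N -> (i.+1 < k)%N -> b i.+1 * a i.+1 = a i * b i.
Proof.
move=> i0 ik; apply/eqP; rewrite -subr_eq0; apply/eqP.
have e := @bpi_rel F Q (@A_rel k hk F) (@A_rel_triv k hk F)
  (b_ hk F i.+1 * a_ hk F i.+1 - a_ hk F i * b_ hk F i).
apply: etrans (etrans (esym (linearB pi _ _)) (e _)).
  by apply: (f_equal2 (fun x y => x - y)); apply: (esym (bpiM _ _ _)).
rewrite /A_rel gtn_eqF; last exact: leq_ltn_trans ik.
by exists i.+1; constructor 3; split=> //; rewrite ltn_predRL.
Qed.

Lemma A_aba2 : k = 2%N -> a 1 * b 1 * a 1 = 0 /\ b 1 * a 1 * b 1 = 0.
Proof.
move=> k2.
have e u : A_rel (hk := hk) u -> pi u = 0 by apply: bpi_rel.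
have m u v w : pi u * pi v * pi w = pi (u * v * w).
  by rewrite (bpiM _ (u * v) w) (bpiM _ u v).
by split; apply: etrans (m _ _ _) (e _ _); rewrite /A_rel (introT eqP k2); [left|right].
Qed.

End ARelations.

Section RelationsInARing.
Variables (k : nat) (hk : (2 <= k)%N) (A : nzRingType) (a b : nat -> A).
Hypotheses (out : forall s, (s == 0%N) || (k <= s)%N -> a s = 0 /\ b s = 0)
  (aa : forall i, a i.+1 * a i = 0) (bb : forall i, b i * b i.+1 = 0)
  (ba : forall i, (0 < i)%N -> (i.+1 < k)%N -> b i.+1 * a i.+1 = a i * b i)
  (aba2 : k = 2%N -> a 1 * b 1 * a 1 = 0 /\ b 1 * a 1 * b 1 = 0).

(** For $k>2$ the commutation relation turns $aba$ and $bab$ into words with two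
    arrows in the same direction; for $k=2$ they are relations. *)
Lemma aba0 i : a i * b i * a i = 0.
Proof.
have [h|ik] := leqP k i; first by rewrite (out (s := i) _).1 ?h ?orbT // mulr0.
case: i ik => [|[|i]] ik; first by rewrite (out (s := 0) isT).1 mulr0.
  have [k2|k2] := leqP k 2; last by rewrite -ba // -mulrA aa mulr0.
  by have [] := aba2 (@anti_leq k 2 _); rewrite ?k2 ?hk.
by rewrite -mulrA ba // mulrA aa mul0r.
Qed.

Lemma bab0 i : b i * a i * b i = 0.
Proof.
have [h|ik] := leqP k i; first by rewrite (out (s := i) _).2 ?h ?orbT // mulr0.
case: i ik => [|[|i]] ik; first by rewrite (out (s := 0) isT).2 mulr0.
  have [k2|k2] := leqP k 2; last by rewrite -mulrA -ba // mulrA bb mul0r.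
  by have [] := aba2 (@anti_leq k 2 _); rewrite ?k2 ?hk.
by rewrite ba // -mulrA bb mulr0.
Qed.

Definition coloured_arrow (c : bool) (j : 'I_k) : A :=
  if c (+) odd j then a j.+1 else b j.

Definition socle_elt (j : 'I_k) : A :=
  if j == 0%N :> nat then b 1 * a 1 else a j * b j.

Lemma coloured_arrow_unlinked c j : ~~ linked c j -> coloured_arrow c j = 0.
Proof.
rewrite linkedE /coloured_arrow; case: ifP => _.
  by rewrite -leqNgt => h; rewrite (out (s := j.+1) h).1.
by rewrite -leqNgt leqn0 => h; rewrite (out (s := j) _).2 // h.
Qed.

(** Two consecutive arrows of different colours go in the same direction. *)
Lemma coloured_arrow_mul c d j : linked c j ->
  coloured_arrow d (partner c j) * coloured_arrow c j =
  if d == c then socle_elt j else 0.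
Proof.
rewrite linkedE => l; rewrite /coloured_arrow /socle_elt partnerE.
case: (boolP (c (+) odd j)) l => up l; rewrite ?l /=.
  rewrite addbN; have [->|dc] := eqVneq d c.
    rewrite up /=; have [->|j0] := eqVneq (nat_of_ord j) 0%N; first by [].
    by rewrite ba // lt0n.
  suff -> : d (+) odd j = false by rewrite aa.
  by case: c d up dc => -[]; case: odd.
case: (nat_of_ord j) up l => // n; rewrite [odd n.+1]/(~~ odd n) addbN negbK => up _ /=.
have [->|dc] := eqVneq d c; first by rewrite up.
suff -> : d (+) odd n = false by rewrite bb.
by case: c d up dc => -[]; case: odd.
Qed.

Lemma socle_arrow_mul c j : linked c j ->
  socle_elt (partner c j) * coloured_arrow c j = 0.
Proof.
rewrite linkedE => l; rewrite /coloured_arrow /socle_elt partnerE.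
case: (boolP (c (+) odd j)) l => up l; rewrite ?l /=; first exact: aba0.
case: (nat_of_ord j) l => // -[|n] _ /=; first exact: bab0.
by rewrite -mulrA bb mulr0.
Qed.

End RelationsInARing.

(** ** A basis of $A^k$ *)

(** A family with dual functionals, some members of which may be 0: this is the
    case of the arrows of colour [c] at a vertex without such an arrow. *)
Section DualBasis.
Variables (F : fieldType) (A : lmodType F) (I : finType).
Variables (f : I -> A -> F) (x : I -> A) (p : pred I).
Hypotheses (f_linear : forall i, linear_for *%R (f i))
  (f_dual : forall i j, f i (x j) = (p j && (i == j))%:R)
  (x_out : forall i, ~~ p i -> x i = 0).

HB.instance Definition _ i := GRing.isLinear.Build F A F *%R (f i) (f_linear i).

Definition expansion (phi : I -> F) : A := \sum_i phi i *: x i.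

Lemma coord_expansion phi i : f i (expansion phi) = if p i then phi i else 0.
Proof.
rewrite linear_sum /= (bigD1 i) //= big1 ?addr0 => [|j ji].
  by rewrite linearZ /= f_dual eqxx andbT; case: (p i); rewrite (mulr1, mulr0).
by rewrite linearZ /= f_dual eq_sym (negPf ji) andbF mulr0.
Qed.

Definition expands (a : A) := expansion (f^~ a) = a.

Lemma expands0 : expands 0.
Proof. by rewrite /expands /expansion big1 // => i _; rewrite linear0 scale0r. Qed.

Lemma expandsD a b : expands a -> expands b -> expands (a + b).
Proof.
move=> ha hb; rewrite /expands -[in RHS]ha -[in RHS]hb /expansion -big_split /=.
by apply: eq_bigr => i _; rewrite linearD scalerDl.
Qed.

Lemma expandsZ c a : expands a -> expands (c *: a).
Proof.
move=> ha; rewrite /expands -[in RHS]ha /expansion scaler_sumr /=.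
by apply: eq_bigr => i _; rewrite linearZ scalerA.
Qed.

Lemma expands_basis j : expands (x j).
Proof.
rewrite /expands /expansion (bigD1 j) //= big1 ?addr0 => [|i ij].
  rewrite f_dual eqxx andbT; case: (boolP (p j)) => pj; first exact: scale1r.
  by rewrite x_out // scaler0.
by rewrite f_dual (negPf ij) andbF scale0r.
Qed.

Lemma expands_inj a b : expands a -> expands b -> (forall i, f i a = f i b) -> a = b.
Proof.
move=> ha hb h; rewrite -ha -hb; apply: eq_bigr => i _.
by rewrite h.
Qed.

End DualBasis.

HB.lock Definition vertex_crd (k : nat) (hk : (2 <= k)%N) (F : fieldType)
  (j : 'I_k) (x : A_alg hk F) : F := acoef j [::] (blift x).

HB.lock Definition arrow_crd (k : nat) (hk : (2 <= k)%N) (F : fieldType)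
  (c : bool) (j : 'I_k) (x : A_alg hk F) : F := arrow_coef c j (blift x).

HB.lock Definition socle_crd (k : nat) (hk : (2 <= k)%N) (F : fieldType)
  (j : 'I_k) (x : A_alg hk F) : F := socle_coef j (blift x).

Section ABasis.
Variables (k : nat) (hk : (2 <= k)%N) (F : fieldType).
Local Notation Q := (A_quiver hk).
Local Notation P := (path_algebra F Q).
Local Notation A := (A_alg hk F).
Local Notation pi := (bpi (@A_rel_triv k hk F)).
Local Notation ce := (@vertex_crd k hk F).
Local Notation cw := (@arrow_crd k hk F).
Local Notation cs := (@socle_crd k hk F).

Lemma vertex_crd_pi j u : ce j (pi u) = acoef j [::] u.
Proof.
rewrite vertex_crd.unlock.
apply: (@functional_blift F Q (A_rel (F := F)) (@A_rel_triv k hk F)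
  (acoef j [::]) (null_ideal hk F)) => v; [|exact: A_rel_null].
by move=> [h _ _]; apply: h.
Qed.

Lemma arrow_crd_pi c j u : cw c j (pi u) = arrow_coef c j u.
Proof.
rewrite arrow_crd.unlock.
apply: (@functional_blift F Q (A_rel (F := F)) (@A_rel_triv k hk F)
  (arrow_coef c j) (null_ideal hk F)) => v; [|exact: A_rel_null].
by move=> [_ h _]; apply: h.
Qed.

Lemma socle_crd_pi j u : cs j (pi u) = socle_coef j u.
Proof.
rewrite socle_crd.unlock.
apply: (@functional_blift F Q (A_rel (F := F)) (@A_rel_triv k hk F)
  (socle_coef j) (null_ideal hk F)) => v; [|exact: A_rel_null].
by move=> [_ _ h]; apply: h.
Qed.

Lemma vertex_crd_is_linear j : linear_for *%R (ce j).
Proof.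
move=> c u v; rewrite -[u]bliftK -[v]bliftK -linearP !vertex_crd_pi.
exact: linearP.
Qed.
HB.instance Definition _ j :=
  GRing.isLinear.Build F A F *%R (ce j) (vertex_crd_is_linear j).

Lemma arrow_crd_is_linear d j : linear_for *%R (cw d j).
Proof.
move=> c u v; rewrite -[u]bliftK -[v]bliftK -linearP !arrow_crd_pi.
exact: linearP.
Qed.
HB.instance Definition _ c j :=
  GRing.isLinear.Build F A F *%R (cw c j) (arrow_crd_is_linear c j).

Lemma socle_crd_is_linear j : linear_for *%R (cs j).
Proof.
move=> c u v; rewrite -[u]bliftK -[v]bliftK -linearP !socle_crd_pi.
exact: linearP.
Qed.
HB.instance Definition _ j :=
  GRing.isLinear.Build F A F *%R (cs j) (socle_crd_is_linear j).

Lemma vertex_crdM j x y : ce j (x * y) = ce j x * ce j y.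
Proof. by rewrite -[x]bliftK -[y]bliftK -bpiM !vertex_crd_pi acoef0M. Qed.

Lemma arrow_crdM c j x y :
  cw c j (x * y) = ce (partner c j) x * cw c j y + cw c j x * ce j y.
Proof.
by rewrite -[x]bliftK -[y]bliftK -bpiM !vertex_crd_pi !arrow_crd_pi arrow_coefM.
Qed.

Lemma socle_crdM j x y : cs j (x * y) = ce j x * cs j y + cs j x * ce j y
  + \sum_c cw c (partner c j) x * cw c j y.
Proof.
rewrite -[x]bliftK -[y]bliftK -bpiM !vertex_crd_pi !socle_crd_pi socle_coefM.
by congr (_ + _); apply: eq_bigr => c _; rewrite !arrow_crd_pi.
Qed.

Lemma arrow_crd_unlinked c j x : ~~ linked c j -> cw c j x = 0.
Proof.
by rewrite -[x]bliftK arrow_crd_pi /arrow_coef => /negPf ->.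
Qed.

Lemma vertex_crd_e j i : ce j (A_e hk F i) = (j.+1 == i)%:R.
Proof.
rewrite [LHS]vertex_crd_pi /vtx_ linear_sum /=.
under eq_bigr => l _ do rewrite -path_eltE acoef_elt.
rewrite -(sum_indicator F (fun l : 'I_k => l.+1 == i) j); apply: eq_bigr => l _.
by congr (nat_of_bool _)%:R; apply/eqP/eqP => [[]|->].
Qed.

Lemma arrow_crd_e c j i : cw c j (A_e hk F i) = 0.
Proof.
rewrite [LHS]arrow_crd_pi /vtx_ linear_sum big1 // => l _ /=.
by rewrite -path_eltE /arrow_coef acoef_elt; case: ifP => // _; case: eqP.
Qed.

Lemma socle_crd_e j i : cs j (A_e hk F i) = 0.
Proof.
rewrite [LHS]socle_crd_pi /vtx_ linear_sum big1 // => l _ /=.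
by rewrite -path_eltE socle_coef_short.
Qed.

Lemma vertex_crd_a j s : ce j (A_a hk F s) = 0.
Proof. exact: etrans (vertex_crd_pi _ _) (acoef_a _ _ _ _). Qed.
Lemma vertex_crd_b j s : ce j (A_b hk F s) = 0.
Proof. exact: etrans (vertex_crd_pi _ _) (acoef_b _ _ _ _). Qed.
Lemma arrow_crd_a c j s :
  cw c j (A_a hk F s) = [&& linked c j, c (+) odd j & j.+1 == s]%:R.
Proof. exact: etrans (arrow_crd_pi _ _ _) (arrow_coef_a _ _ _ _ _). Qed.
Lemma arrow_crd_b c j s :
  cw c j (A_b hk F s) = [&& linked c j, ~~ (c (+) odd j) & j == s :> nat]%:R.
Proof. exact: etrans (arrow_crd_pi _ _ _) (arrow_coef_b _ _ _ _ _). Qed.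
Lemma socle_crd_a j s : cs j (A_a hk F s) = 0.
Proof. exact: etrans (socle_crd_pi _ _) (socle_coef_a _ _ _ _). Qed.
Lemma socle_crd_b j s : cs j (A_b hk F s) = 0.
Proof. exact: etrans (socle_crd_pi _ _) (socle_coef_b _ _ _ _). Qed.

End ABasis.

(** All that is used of $A^k$ in the construction of the deformation. *)
Record acoordinates (k : nat) (F : fieldType) (A : algType F) := {
  ce : 'I_k -> A -> F;
  cw : bool -> 'I_k -> A -> F;
  cs : 'I_k -> A -> F;
  ce_is_linear : forall j, linear_for *%R (ce j);
  cw_is_linear : forall c j, linear_for *%R (cw c j);
  cs_is_linear : forall j, linear_for *%R (cs j);
  ceM : forall j x y, ce j (x * y) = ce j x * ce j y;
  cwM : forall c j x y,
    cw c j (x * y) = ce (partner c j) x * cw c j y + cw c j x * ce j y;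
  csM : forall j x y, cs j (x * y) = ce j x * cs j y + cs j x * ce j y
    + \sum_c cw c (partner c j) x * cw c j y;
  ce1 : forall j, ce j 1 = 1;
  cw1 : forall c j, cw c j 1 = 0;
  cs1 : forall j, cs j 1 = 0;
  cw_unlinked : forall c j x, ~~ linked c j -> cw c j x = 0;
  acrd_ext : forall x y, (forall j, ce j x = ce j y) ->
    (forall c j, cw c j x = cw c j y) -> (forall j, cs j x = cs j y) -> x = y;
  abuild : ('I_k -> F) -> (bool -> 'I_k -> F) -> ('I_k -> F) -> A;
  ce_abuild : forall e w s j, ce j (abuild e w s) = e j;
  cw_abuild : forall e w s c j,
    cw c j (abuild e w s) = if linked c j then w c j else 0;
  cs_abuild : forall e w s j, cs j (abuild e w s) = s j }.

HB.lock Definition A_arrow (k : nat) (hk : (2 <= k)%N) (F : fieldType)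
  (c : bool) (j : 'I_k) : A_alg hk F := coloured_arrow (A_a hk F) (A_b hk F) c j.

HB.lock Definition A_socle (k : nat) (hk : (2 <= k)%N) (F : fieldType)
  (j : 'I_k) : A_alg hk F := socle_elt (A_a hk F) (A_b hk F) j.

Section ACoordinates.
Variables (k : nat) (hk : (2 <= k)%N) (F : fieldType).
Local Notation Q := (A_quiver hk).
Local Notation P := (path_algebra F Q).
Local Notation A := (A_alg hk F).
Local Notation pi := (bpi (@A_rel_triv k hk F)).
Local Notation ce := (@vertex_crd k hk F).
Local Notation cw := (@arrow_crd k hk F).
Local Notation cs := (@socle_crd k hk F).
Local Notation I := ('I_k + (bool * 'I_k) + 'I_k)%type.
Local Notation A_arrow := (A_arrow hk F).
Local Notation A_socle := (A_socle hk F).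


Definition A_elt (i : I) : A :=
  match i with
  | inl (inl j) => A_e hk F j.+1
  | inl (inr (c, j)) => A_arrow c j
  | inr j => A_socle j
  end.

Definition A_crd (i : I) : A -> F :=
  match i with
  | inl (inl j) => ce j
  | inl (inr (c, j)) => cw c j
  | inr j => cs j
  end.

Definition A_index (i : I) : bool :=
  if i is inl (inr (c, j)) then linked c j else true.

Lemma ce_arrow j c i : ce j (A_arrow c i) = 0.
Proof.
rewrite A_arrow.unlock /coloured_arrow; case: ifP => _.
  exact: vertex_crd_a.
exact: vertex_crd_b.
Qed.

Lemma cw_arrow c j d i :
  cw c j (A_arrow d i) = [&& linked d i, c == d & j == i]%:R.
Proof.
rewrite A_arrow.unlock /coloured_arrow; case: ifP => up.
  rewrite arrow_crd_a eqSS val_eqE.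
  have [->|ji] := eqVneq j i; last by rewrite !andbF.
  rewrite !andbT; have [->|cd] := eqVneq c d; first by rewrite up !andbT.
  suff -> : c (+) odd i = false by rewrite !andbF.
  by case: c d cd up => -[]; case: odd.
rewrite arrow_crd_b val_eqE.
have [->|ji] := eqVneq j i; last by rewrite !andbF.
rewrite !andbT; have [->|cd] := eqVneq c d; first by rewrite up !andbT.
suff -> : c (+) odd i by rewrite !andbF.
by case: c d cd up => -[]; case: odd.
Qed.

Lemma cs_arrow j c i : cs j (A_arrow c i) = 0.
Proof.
rewrite A_arrow.unlock /coloured_arrow; case: ifP => _.
  exact: socle_crd_a.
exact: socle_crd_b.
Qed.

Lemma ce_mul0 j x y : ce j x = 0 -> ce j (x * y) = 0.
Proof. by move=> x0; rewrite vertex_crdM x0 mul0r. Qed.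

Lemma cw_mul0 c j x y : (forall i, ce i x = 0) -> ce j y = 0 ->
  cw c j (x * y) = 0.
Proof. by move=> x0 y0; rewrite arrow_crdM x0 y0 mul0r mulr0 addr0. Qed.

Lemma ce_socle j i : ce j (A_socle i) = 0.
Proof.
rewrite A_socle.unlock /socle_elt; case: ifP => _; apply: ce_mul0.
  exact: vertex_crd_b.
exact: vertex_crd_a.
Qed.

Lemma cw_socle c j i : cw c j (A_socle i) = 0.
Proof.
rewrite A_socle.unlock /socle_elt; case: ifP => _; apply: cw_mul0 => [l|].
- exact: vertex_crd_b.
- exact: vertex_crd_a.
- exact: vertex_crd_a.
- exact: vertex_crd_b.
Qed.

Lemma cs_ba (j : 'I_k) s : (s < k)%N ->
  cs j (A_b hk F s * A_a hk F s) = (j.+1 == s)%:R.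
Proof.
move=> sk; have e : A_b hk F s * A_a hk F s = pi (b_ hk F s * a_ hk F s).
  exact: (esym (bpiM (@A_rel_triv k hk F) (b_ hk F s) (a_ hk F s))).
rewrite e socle_crd_pi; exact: (@socle_coef_ba k hk F j s sk).
Qed.

Lemma cs_ab (j : 'I_k) s : (0 < s)%N ->
  cs j (A_a hk F s * A_b hk F s) = (j == s :> nat)%:R.
Proof.
move=> s0; have e : A_a hk F s * A_b hk F s = pi (a_ hk F s * b_ hk F s).
  exact: (esym (bpiM (@A_rel_triv k hk F) (a_ hk F s) (b_ hk F s))).
rewrite e socle_crd_pi; exact: (@socle_coef_ab k hk F j s s0).
Qed.

Lemma cs_socle j i : cs j (A_socle i) = (j == i)%:R.
Proof.
rewrite A_socle.unlock /socle_elt; case: ifP => [/eqP i0|/negbT i0].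
  by apply: etrans (cs_ba _ hk) _; rewrite eqSS -[in RHS]val_eqE /= i0.
rewrite -lt0n in i0; exact: (cs_ab j i0).
Qed.

Lemma A_crd_is_linear i : linear_for *%R (A_crd i).
Proof.
by case: i => [[j|[c j]]|j] u v w /=; rewrite linearP.
Qed.

Lemma A_dual i j : A_crd i (A_elt j) = (A_index j && (i == j))%:R.
Proof.
case: i => [[i|[c i]]|i]; case: j => [[j|[d j]]|j] /=.
- by rewrite vertex_crd_e eqSS val_eqE.
- by rewrite ce_arrow andbF.
- by rewrite ce_socle.
- by rewrite arrow_crd_e.
- by rewrite cw_arrow.
- by rewrite cw_socle.
- by rewrite socle_crd_e.
- by rewrite cs_arrow andbF.
- by rewrite cs_socle.
Qed.

Lemma A_elt_out i : ~~ A_index i -> A_elt i = 0.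
Proof.
case: i => [[//|[c j]]|//] /=; rewrite A_arrow.unlock.
exact: (coloured_arrow_unlinked (@A_out k hk F)).
Qed.

Definition A_src (i : I) : 'I_k :=
  match i with inl (inl j) => j | inl (inr (_, j)) => j | inr j => j end.

Lemma pi_ptriv (j : 'I_k) : pi (path_elt F (ptriv (j : vertex Q))) = A_e hk F j.+1.
Proof. by rewrite -vtx_E. Qed.

Lemma pi_edge c j : linked c j ->
  pi (path_elt F (parrow (edge hk c j))) = A_arrow c j.
Proof.
move=> l; rewrite A_arrow.unlock /coloured_arrow; case: (linkedP hk l) => i.
case: ifP => _ [ji ->]; congr bpi.
  by rewrite a_sum (big_pred1 i) // => i'; rewrite ji eqSS.
by rewrite b_sum (big_pred1 i) // => i'; rewrite ji eqSS.
Qed.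

(** By induction on the length: an arrow followed by a vertex, an arrow or a
    socle element is an arrow, a socle element or 0. *)
Lemma A_path (p : qpath Q) : pi (path_elt F p) = 0 \/
  exists2 i, A_src i = pstart p & pi (path_elt F p) = A_elt i.
Proof.
case: p => -[v s] /= h; elim: s v h => [|al s IH] v h.
  right; exists (inl (inl v)) => //; rewrite /= -pi_ptriv.
  by congr (pi (path_elt F _)); apply: val_inj.
have [c [j [l e]]] := edgeP al; subst al.
have := h; rewrite /= src_edge // => /andP [/eqP jv h']; subst v.
rewrite (path_elt_head F h h') bpiM pi_edge //.
case: (IH _ h') => [->|[i si ->]]; first by left; rewrite mul0r.
rewrite /pstart /= tgt_edge // in si.
case: i si => [[i|[d i]]|i] /= ->.
- right; exists (inl (inr (c, j))) => //=; rewrite -pi_edge // -pi_ptriv -bpiM.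
  have h1 : @composable Q (tgt (edge hk c j)) [::] by [].
  have h2 : @composable Q j [:: edge hk c j] by rewrite /= src_edge // eqxx.
  have -> : ptriv (partner c j : vertex Q) =
      QPath (path_val := (tgt (edge hk c j), [::])) h1.
    by apply: val_inj; rewrite /= tgt_edge.
  rewrite -(path_elt_head F h2 h1); congr (pi (path_elt F _)).
  by apply: val_inj; rewrite /= src_edge.
- have := coloured_arrow_mul (@A_aa k hk F) (@A_bb k hk F) (@A_ba k hk F) d l.
  rewrite A_arrow.unlock => ->; case: ifP => _; last by left.
  by right; exists (inr j); rewrite //= A_socle.unlock.
- left; rewrite A_arrow.unlock A_socle.unlock.
  exact: (socle_arrow_mul hk (@A_out k hk F) (@A_aa k hk F) (@A_bb k hk F)
    (@A_ba k hk F) (@A_aba2 k hk F) l).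
Qed.

Lemma A_expands (x : A) : expands A_crd A_elt x.
Proof.
rewrite -[x]bliftK; set u := blift x; rewrite (path_algebra_sum u) linear_sum.
apply: (big_ind (expands A_crd A_elt)).
- exact: (expands0 A_elt A_crd_is_linear).
- by move=> ? ?; apply: (expandsD A_crd_is_linear).
move=> p _; rewrite linearZ /=; apply: (expandsZ A_crd_is_linear).
case: (A_path p) => [->|[i _ ->]].
  exact: (expands0 A_elt A_crd_is_linear).
exact: (expands_basis A_dual A_elt_out).
Qed.

Lemma A_crd_ext x y : (forall j, ce j x = ce j y) ->
  (forall c j, cw c j x = cw c j y) -> (forall j, cs j x = cs j y) -> x = y.
Proof.
move=> h1 h2 h3; apply: (expands_inj (A_expands x) (A_expands y)) => i.
by case: i => [[j|[c j]]|j] /=; [exact: h1|exact: h2|exact: h3].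
Qed.

Definition A_build (e : 'I_k -> F) (w : bool -> 'I_k -> F) (s : 'I_k -> F) : A :=
  expansion A_elt (fun i => match i with
    | inl (inl j) => e j | inl (inr (c, j)) => w c j | inr j => s j end).

Lemma A_coord_build e w s i : A_crd i (A_build e w s) =
  if A_index i then match i with
    | inl (inl j) => e j | inl (inr (c, j)) => w c j | inr j => s j end else 0.
Proof. exact: (coord_expansion A_crd_is_linear A_dual). Qed.

Lemma acoef_one j : acoef (hk := hk) j [::] (1 : P) = 1.
Proof.
rewrite path_algebra_one linear_sum /= (bigD1 (j : vertex Q)) //= big1 ?addr0.
  by rewrite acoef_elt eqxx.
by move=> i /negPf ij; rewrite acoef_elt; case: eqP => // -[e]; rewrite e eqxx in ij.
Qed.

Lemma vertex_crd1 j : ce j 1 = 1.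
Proof. exact: etrans (vertex_crd_pi _ _) (acoef_one _). Qed.

Lemma arrow_crd1 c j : cw c j 1 = 0.
Proof.
have := arrow_crdM c j (1 : A) (1 : A); rewrite mulr1 !vertex_crd1 mul1r mulr1.
by move=> e; apply: (addrI (cw c j 1)); rewrite -e addr0.
Qed.

Lemma socle_crd1 j : cs j 1 = 0.
Proof.
have := socle_crdM j (1 : A) (1 : A); rewrite mulr1 !vertex_crd1 mul1r mulr1.
rewrite big1 ?addr0 => [|c _]; last by rewrite !arrow_crd1 mul0r.
by move=> e; apply: (addrI (cs j 1)); rewrite -e addr0.
Qed.

Definition A_coordinates : acoordinates k A.
Proof.
refine (@Build_acoordinates k F A ce cw cs _ _ _ _ _ _ vertex_crd1 arrow_crd1
  socle_crd1 _ A_crd_ext A_build _ _ _).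
- exact: vertex_crd_is_linear.
- exact: arrow_crd_is_linear.
- exact: socle_crd_is_linear.
- exact: vertex_crdM.
- exact: arrow_crdM.
- exact: socle_crdM.
- exact: arrow_crd_unlinked.
- by move=> e w s j; apply: etrans (A_coord_build e w s (inl (inl j))) _.
- by move=> e w s c j; apply: etrans (A_coord_build e w s (inl (inr (c, j)))) _.
- by move=> e w s j; apply: etrans (A_coord_build e w s (inr j)) _.
Defined.

End ACoordinates.

(** * The deformation *)

HB.instance Definition _ k F A (K : @acoordinates k F A) j :=
  GRing.isLinear.Build F A F *%R (ce K j) (ce_is_linear K j).
HB.instance Definition _ k F A (K : @acoordinates k F A) c j :=
  GRing.isLinear.Build F A F *%R (cw K c j) (cw_is_linear K c j).
HB.instance Definition _ k F A (K : @acoordinates k F A) j :=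
  GRing.isLinear.Build F A F *%R (cs K j) (cs_is_linear K j).

Section Deformation.
Variables (k : nat) (F : fieldType) (A B : algType F).
Variables (KA : acoordinates k A) (KB : coordinates k B).
Local Notation ce := (ce KA).
Local Notation cw := (cw KA).
Local Notation cs := (cs KA).
Local Notation crd := (crd KB).

Definition colour_sign (c : bool) : F := if c then 1 else -1.

Lemma colour_signK c : colour_sign c * colour_sign c = 1.
Proof. by case: c; rewrite /= ?mulr1 ?mulrNN ?mulr1. Qed.

Lemma colour_sign_neq c : colour_sign (~~ c) = - colour_sign c.
Proof. by case: c; rewrite /= ?opprK. Qed.

(** The colour of the loop of $\hat B^k$ at [j] that lifts the socle element of
    $A^k$ at [j].  It is the colour of the arrow going up, or of the loop at the
    last vertex; except at the first vertex, where it is the colour of the loop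
    $y_1$. *)
Definition lift_colour (j : 'I_k) : bool := (0 < j)%N && ~~ odd j.

(** Read off from the products of the lifts.  If the two factors go out and back
    along the colour that does not carry the socle element, the resulting loop
    is the socle element plus or minus $T$ at the vertex; and a lifted socle
    element acts on the arrows and loops of its own colour as $T$ up to sign. *)
Definition mu_fun (a b : A) : A := abuild KA
  (fun j => let c := ~~ lift_colour j in
     colour_sign c * (cw c (partner c j) a * cw c j b))
  (fun c j => colour_sign c *
     ((lift_colour j == c)%:R * (cw c j a * cs j b)
      + (lift_colour (partner c j) == c)%:R * (cs (partner c j) a * cw c j b)))
  (fun j => colour_sign (lift_colour j) * (cs j a * cs j b)).

Lemma ce_mu j a b : ce j (mu_fun a b) =
  colour_sign (~~ lift_colour j) *
    (cw (~~ lift_colour j) (partner (~~ lift_colour j) j) a * cw (~~ lift_colour j) j b).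
Proof. by rewrite ce_abuild. Qed.

Lemma cw_mu c j a b : cw c j (mu_fun a b) = colour_sign c *
   ((lift_colour j == c)%:R * (cw c j a * cs j b)
    + (lift_colour (partner c j) == c)%:R * (cs (partner c j) a * cw c j b)).
Proof.
rewrite cw_abuild; case: ifPn => // l.
by rewrite !(cw_unlinked _ _ l) mul0r !mulr0 addr0 mulr0.
Qed.

Lemma cs_mu j a b :
  cs j (mu_fun a b) = colour_sign (lift_colour j) * (cs j a * cs j b).
Proof. by rewrite cs_abuild. Qed.

Lemma mu_is_bilinear : bilinear_for *:%R *:%R mu_fun.
Proof.
split=> [b c x y|a c x y]; apply: (acrd_ext (a := KA)) => *;
  rewrite linearD linearZ /= ?ce_mu ?cw_mu ?cs_mu !linearP /=; ring.
Qed.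
HB.instance Definition _ := bilinear_isBilinear.Build F A A A _ _ mu_fun mu_is_bilinear.

Definition loop_length (c : bool) (j : 'I_k) : nat := if linked c j then 2%N else 1%N.

(** The signs of the two colours are opposite, so that the two loops at a vertex
    become equal modulo this element. *)
Definition parameter : B :=
  build KB 3 (fun c n j => if n == loop_length c j then colour_sign c else 0).

Lemma crd_parameter c n j :
  crd c n j parameter = if n == loop_length c j then colour_sign c else 0.
Proof.
rewrite crd_build => [|i]; last first.
  by rewrite /loop_length; case: (linked true i); case: (linked false i).
by rewrite /loop_length; case: n => [|[|[|n]]] //; case: (linked c j).
Qed.

Lemma loop_length_partner c j : loop_length c (partner c j) = loop_length c j.
Proof. by rewrite /loop_length linked_partner. Qed.

Lemma loop_length_iter c m j : loop_length c (iter m (partner c) j) = loop_length c j.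
Proof. by elim: m => //= m IH; rewrite loop_length_partner. Qed.

Lemma unlinked_partner c (j : 'I_k) : ~~ linked c j -> partner c j = j.
Proof. by move=> l; apply/eqP; apply: contraR l. Qed.

Lemma iter_loop_length c j : iter (loop_length c j) (partner c) j = j.
Proof.
rewrite /loop_length; case: ifPn => l /=; first exact: partnerK.
exact: unlinked_partner.
Qed.

(** The parameter prolongs every path of positive length by a loop of the colour
    of the path, and a trivial path by the loops of both colours. *)
Lemma crd_parameter_mul c n j b : crd c n j (parameter * b) =
  if (loop_length c j <= n)%N
  then colour_sign c * crd c (n - loop_length c j) j b else 0.
Proof.
rewrite crdM; case: leqP => h; last first.
  rewrite big1 // => m _; rewrite crd_parameter loop_length_iter.
  by rewrite ltn_eqF ?mul0r // (leq_ltn_trans (leq_subr _ _)).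
have hm : (n - loop_length c j < n.+1)%N by rewrite ltnS leq_subr.
rewrite (bigD1 (Ordinal hm)) //= big1 ?addr0 => [|m /eqP mh].
  by rewrite crd_parameter loop_length_iter subKn // eqxx.
rewrite crd_parameter loop_length_iter; case: eqP => [e|]; last by rewrite mul0r.
by case: mh; apply: val_inj; rewrite /= -e subKn // -ltnS.
Qed.

Lemma parameter_central b : parameter * b = b * parameter.
Proof.
apply: (crd_ext (c0 := KB)) => c n j; rewrite crd_parameter_mul crdM.
case: leqP => h; last first.
  rewrite big1 // => m _; rewrite crd_parameter.
  by rewrite ltn_eqF ?mulr0 // (leq_ltn_trans _ h) // -ltnS.
have hm : (loop_length c j < n.+1)%N by [].
rewrite (bigD1 (Ordinal hm)) //= big1 ?addr0 => [|m /eqP mh].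
  by rewrite crd_parameter eqxx iter_loop_length mulrC.
rewrite crd_parameter; case: eqP => [e|]; last by rewrite mulr0.
by case: mh; apply: val_inj.
Qed.

Definition lift_crd (c : bool) (n : nat) (j : 'I_k) (a : A) : F :=
  match n with
  | 0 => ce j a
  | 1 => if linked c j then cw c j a else if lift_colour j == c then cs j a else 0
  | 2 => if linked c j && (lift_colour j == c) then cs j a else 0
  | _ => 0
  end.

Definition lifting (a : A) : B := build KB 3 (fun c n j => lift_crd c n j a).

Lemma crd_lift c n j a : crd c n j (lifting a) = lift_crd c n j a.
Proof. by rewrite crd_build //; case: n => [|[|[|n]]]. Qed.

Lemma lift_is_linear : linear lifting.
Proof.
move=> x a b; apply: (crd_ext (c0 := KB)) => c n j.
rewrite linearP /= !crd_lift; case: n => [|[|[|n]]] /=; first exact: linearP.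
- case: ifP => _; first exact: linearP.
  by case: ifP => _; [exact: linearP|rewrite mulr0 addr0].
- by case: ifP => _; [exact: linearP|rewrite mulr0 addr0].
- by rewrite mulr0 addr0.
Qed.
HB.instance Definition _ := GRing.isLinear.Build F A B *:%R lifting lift_is_linear.

Lemma lift1 : lifting 1 = 1.
Proof.
apply: (crd_ext (c0 := KB)) => c n j; rewrite crd_lift crd1.
by case: n => [|[|[|n]]] //=; rewrite ?ce1 ?cw1 ?cs1 ?if_same.
Qed.

(** A comparison of coordinates at paths of length at most 4: longer ones do not
    occur in a product of two lifts. *)
Lemma lift_mul a b :
  lifting a * lifting b = lifting (a * b) + parameter * lifting (mu_fun a b).
Proof.
apply: (crd_ext (c0 := KB)) => c n j.
rewrite linearD /= crd_parameter_mul !crd_lift crdM.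
under eq_bigr => m _ do rewrite !crd_lift.
rewrite /loop_length; have [l|l] := boolP (linked c j).
  have pp : linked c (partner c j) by rewrite linked_partner.
  case: n => [|[|[|[|[|n]]]]].
  - by rewrite big_ord1; apply: etrans (esym (ceM KA j a b)) (esym (addr0 _)).
  - by rewrite !big_ord_recl big_ord0 /= l addr0 addr0 addrC cwM.
  - rewrite !big_ord_recl big_ord0 /= /lift_crd /bump /= partnerK l pp /=.
    rewrite csM big_bool ce_mu.
    have [<-|tc] := eqVneq (lift_colour j) c.
      by rewrite colour_sign_neq; case: (lift_colour j) => /=; ring.
    have -> : ~~ lift_colour j = c by case: c tc {l pp}; case: lift_colour.
    by rewrite !mulrA colour_signK; ring.
  - rewrite !big_ord_recl big_ord0 /= /lift_crd /bump /= partnerK l pp /= cw_mu.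
    rewrite !mulrA colour_signK.
    by case: eqP => _; case: eqP => _ /=; ring.
  - rewrite !big_ord_recl big_ord0 /= /lift_crd /bump /= partnerK l pp /= cs_mu.
    case: eqP => [->|_] /=; last by ring.
    by rewrite mulrA colour_signK; ring.
  - rewrite !subSS subn0 [X in _ * X]/= mulr0 addr0 big1 // => m _.
    by case: (nat_of_ord m) => [|[|[|i]]]; rewrite ?subSS ?subn0 /= ?mul0r ?mulr0.
have pj := unlinked_partner l; have cw0 := cw_unlinked _ _ l.
have it m : iter m (partner c) j = j by elim: m => //= m ->.
under eq_bigr => m _ do rewrite it.
case: n => [|[|[|n]]].
- by rewrite big_ord1; apply: etrans (esym (ceM KA j a b)) (esym (addr0 _)).
- rewrite !big_ord_recl big_ord0 /= /lift_crd /bump /= (negPf l) /= csM big_bool ce_mu.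
  have [e|tc] := eqVneq (lift_colour j) c.
    rewrite e colour_sign_neq; case: (c) e cw0 => _ cw0 /=; rewrite !cw0; ring.
  have -> : ~~ lift_colour j = c by case: c tc {l pj cw0 it}; case: lift_colour.
  by rewrite !cw0; ring.
- rewrite !big_ord_recl big_ord0 /= /lift_crd /bump /= (negPf l) /= cs_mu.
  case: eqP => [->|_] /=; last by ring.
  by rewrite mulrA colour_signK; ring.
- have l2 r x : lift_crd c r.+2 j x = 0 by case: r => //=; rewrite (negPf l).
  rewrite !subSS subn0 !l2 mulr0 addr0 big1 // => m _.
  by case: (nat_of_ord m) => [|[|i]]; rewrite ?subSS ?subn0 !l2 ?mul0r ?mulr0.
Qed.

End Deformation.

(** * Power series in the parameter *)

Section Completed.
Variables (k : nat) (F : fieldType) (A B : algType F).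
Variables (KA : acoordinates k A) (KB : coordinates k B).
Variables (I : ideal B) (I_proper : ~ I 1).
Hypothesis idealE : forall b, I b <-> forall c j, crd KB c 0 j b = 0.
Local Notation crd := (crd KB).
Local Notation letter := (letter KB).
Local Notation T := (parameter KB).
Local Notation BB := (completion I_proper).

Lemma crd_letter_mul c d n j b : crd d n j (letter c * b) =
  if (0 < n)%N && (d == c) then crd d n.-1 j b else 0.
Proof.
rewrite crdM; case: n => [|n].
  by rewrite big_ord1 crd_letter mul0r.
rewrite big_ord_recr big_ord_recr /= !crd_letter subSnn subnn /= mul0r addr0.
rewrite big1 ?add0r => [|i _]; last first.
  rewrite crd_letter -addn1 -addnBAC ?addn1; last by rewrite ltnW.
  by rewrite eqSS subn_eq0 leqNgt ltn_ord mul0r.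
by case: (d == c); rewrite (mul1r, mul0r).
Qed.

Lemma letter_split b : (forall c j, crd c 0 j b = 0) -> exists q : bool -> B,
  b = letter true * q true + letter false * q false /\
  forall c d m j, crd d m j (q c) =
    if (m == 0%N) || (d == c) then crd c m.+1 j b else 0.
Proof.
move=> h; have [N hN] := crd_bounded KB b.
pose q c := build KB N (fun d m j =>
  if (m == 0%N) || (d == c) then crd c m.+1 j b else 0).
have qE c d m j : crd d m j (q c) =
    if (m == 0%N) || (d == c) then crd c m.+1 j b else 0.
  rewrite crd_build //; case: ltnP => // mN.
  by rewrite hN ?if_same // leqW.
exists q; split=> //; apply: (crd_ext (c0 := KB)) => d m j.
rewrite linearD /= !crd_letter_mul !qE.
case: m => [|m] /=; first by rewrite h addr0.
by case: d; rewrite /= ?orbT ?addr0 ?add0r.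
Qed.

(** A letter of either colour can be split off on the left of an element without
    trivial paths, which lowers the least length of its paths by one. *)
Lemma ideal_expE n b :
  ideal_exp I n b <-> forall c m j, (m < n)%N -> crd c m j b = 0.
Proof.
elim: n b => [|n IH] b; first by split.
split=> [h|h].
  pose low x := forall c m j, (m < n.+1)%N -> crd c m j x = 0.
  have low0 : low 0 by move=> c m j _; rewrite linear0.
  have lowD x y : low x -> low y -> low (x + y).
    by move=> hx hy c m j mn; rewrite linearD /= hx ?hy ?addr0.
  have lowl a x : low x -> low (a * x).
    move=> hx c m j mn; rewrite crdM big1 // => i _.
    by rewrite hx ?mulr0 // (leq_trans (ltn_ord i)).
  have lowr a x : low x -> low (x * a).
    move=> hx c m j mn; rewrite crdM big1 // => i _.
    by rewrite hx ?mul0r // (leq_ltn_trans (leq_subr _ _)).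
  apply: (@ideal_gen_min _ _ (Ideal low0 lowD lowl lowr) _ _ h).
  move=> _ [x [y [/idealE hx /IH hy ->]]] c m j mn /=.
  rewrite crdM big1 // => i _; have [i_n|n_i] := ltnP i n.
    by rewrite hy ?mulr0.
  have im : (m <= i)%N by rewrite (leq_trans _ n_i).
  by rewrite (eqP (im : m - i == 0)%N) hx mul0r.
have [q [-> qE]] : exists q : bool -> B,
    b = letter true * q true + letter false * q false /\
    forall c m j d, (m < n)%N -> crd c m j (q d) = 0.
  have [|q [e qE]] := @letter_split b; first by move=> c j; apply: h.
  exists q; split=> // c m j d mn; rewrite qE h ?if_same //.
have hl c : I (letter c) by apply/idealE => d j; rewrite crd_letter.
have hq c : ideal_exp I n.+1 (letter c * q c).
  by move=> J; apply; exists (letter c), (q c); split=> //; apply/IH=> *; apply: qE.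
exact: idealD.
Qed.

Lemma qpi_crd N a b c n j : qpi (ideal_exp I N) a = qpi (ideal_exp I N) b ->
  (n < N)%N -> crd c n j a = crd c n j b.
Proof.
move=> /qpiP/asboolP/ideal_expE h nN; apply/eqP; rewrite -subr_eq0.
by have := h c n j nN; rewrite linearB => ->.
Qed.

(** The quotient by the power $n+1$ is the first that sees the paths of length
    $n$. *)
Definition coefficient (c : bool) (n : nat) (j : 'I_k) (f : BB) : F :=
  crd c n j (qrepr (f n.+1)).

Lemma coefficientE N a c n j (f : BB) :
  f N = qpi (ideal_exp I N) a -> (n < N)%N -> coefficient c n j f = crd c n j a.
Proof.
move=> fN nN; apply: (@qpi_crd n.+1) => //.
by rewrite qreprK; apply: (compl_coh nN).
Qed.

Lemma coefficient_ext (f g : BB) :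
  (forall c n j, coefficient c n j f = coefficient c n j g) -> f = g.
Proof.
move=> h; apply: compl_eq => N; rewrite -[f N]qreprK -[g N]qreprK.
apply: qpi_eq; apply/ideal_expE => c n j nN; rewrite linearB /=.
rewrite -(coefficientE c j (esym (qreprK (f N))) nN).
by rewrite -(coefficientE c j (esym (qreprK (g N))) nN) h subrr.
Qed.

Lemma crd_parameter_exp i c n j b : crd c n j (T ^+ i * b) =
  if (i * loop_length c j <= n)%N
  then colour_sign F c ^+ i * crd c (n - i * loop_length c j) j b else 0.
Proof.
elim: i n => [|i IH] n; first by rewrite !mul1r subn0.
rewrite exprS -mulrA crd_parameter_mul IH mulSn.
case: leqP => h; last by rewrite leqNgt (leq_trans h) // leq_addr.
rewrite leq_subRL // subnDA; case: ifP => _; last by rewrite mulr0.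
by rewrite exprS mulrA.
Qed.

(** Every loop in the parameter has length at least one, so that power series in
    it converge. *)
Lemma parameter_exp_ideal i n b : (n <= i)%N -> ideal_exp I n (T ^+ i * b).
Proof.
move=> ni; apply/ideal_expE => c m j mn; rewrite crd_parameter_exp leqNgt.
suff -> : (m < i * loop_length c j)%N by [].
apply: leq_trans (leq_trans mn ni) _; apply: leq_pmulr.
by rewrite /loop_length; case: ifP.
Qed.

Definition partial_sum (y : fps B) (n : nat) : B := \sum_(m < n) T ^+ m * fcoef y m.

Lemma partial_sum_tail y m n : (m <= n)%N ->
  ideal_exp I m (partial_sum y m - partial_sum y n).
Proof.
move=> /subnK <-; rewrite addnC; elim: (n - m)%N => [|l IH].
  by rewrite addn0 subrr; apply: ideal0.
rewrite addnS /partial_sum big_ord_recr /= opprD addrA; apply: idealB => //.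
by apply: parameter_exp_ideal; apply: leq_addr.
Qed.

Lemma partial_sum_coherent y :
  coherent (fun n => qpi (ideal_exp I n) (partial_sum y n)).
Proof.
apply: coherentW => m n mn; exists (partial_sum y n) => //.
exact/qpi_eq/partial_sum_tail.
Qed.

(** The value of a power series with coefficients in $\hat B^k$ at the
    parameter. *)
Definition eval (y : fps B) : BB := Completion I_proper (@partial_sum_coherent y).

Lemma evalD x y : eval (x + y) = eval x + eval y.
Proof.
apply: compl_eq => n /=; rewrite -qpiD; congr qpi.
rewrite /partial_sum -big_split; apply: eq_bigr => m _.
by rewrite /= mulrDr.
Qed.

Lemma eval_shift y :
  eval (Fps (fun n => if n is m.+1 then fcoef y m else 0)) =
  eval (Fps (fun n => T * fcoef y n)).
Proof.
set u := Fps _; set v := Fps _.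
have e n : partial_sum u n.+1 - partial_sum v n.+1 = 0 - T ^+ n.+1 * fcoef y n.
  rewrite /partial_sum big_ord_recl /= mulr0 add0r [X in _ - X]big_ord_recr /=.
  rewrite opprD addrA mulrA -exprSr -sumrB big1 // => m _.
  by rewrite /= mulrA -exprSr subrr.
apply: compl_eq => -[|n]; apply: qpi_eq; first by [].
rewrite e; apply: idealB; first exact: ideal0.
exact: parameter_exp_ideal.
Qed.

Lemma parameter_exp_central i b : T ^+ i * b = b * T ^+ i.
Proof.
elim: i => [|i IH]; first by rewrite mul1r mulr1.
by rewrite exprS -mulrA IH mulrA parameter_central mulrA.
Qed.

(** Up to order $N$ the product of two partial sums and the partial sum of the
    product differ by terms $T^{i+j}x_iy_j$ with $i+j>N$. *)
Lemma evalM x y : eval (conv *%R x y) = eval x * eval y.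
Proof.
apply: compl_eq => -[|N]; first by apply: qpi_eq.
pose q := qpi (ideal_exp I N.+1).
have -> : (eval x * eval y) N.+1 = q (partial_sum x N.+1 * partial_sum y N.+1).
  by rewrite /q qpiM.
rewrite -[LHS]/(q (partial_sum (conv *%R x y) N.+1)).
have q_sum (n : nat) (f : 'I_n -> B) : q (\sum_i f i) = \sum_i q (f i).
  by rewrite /q raddf_sum.
pose G (i j l : nat) := q (T ^+ (i + j) * (fcoef x i * fcoef y j)).
have G0 i j l : (N < i + j)%N -> G i j l = 0.
  move=> h; rewrite /G -[RHS](qpi0 (ideal_exp I N.+1)); apply: qpi_eq.
  by rewrite subr0; apply: parameter_exp_ideal.
transitivity (\sum_(m < N.+1) \sum_(i < m.+1) G i (m - i)%N (N - m)%N).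
  rewrite /partial_sum q_sum; apply: eq_bigr => m _ /=.
  rewrite mulr_sumr q_sum; apply: eq_bigr => i _.
  by rewrite /G subnKC // -ltnS.
rewrite triangle /partial_sum mulr_suml q_sum; apply: eq_bigr => i _ /=.
rewrite mulr_sumr q_sum /=.
rewrite (big_ord_widen N.+1 (fun j => G i j (N - i - j)%N)) ?ltnS ?leq_subr //.
rewrite big_mkcond; apply: eq_bigr => j _ /=.
have e : q (T ^+ i * fcoef x i * (T ^+ j * fcoef y j)) = G i j (N - i - j)%N.
  rewrite /G exprD -!mulrA; congr (q (_ * _)).
  by rewrite !mulrA parameter_exp_central.
apply: etrans (esym e); case: ltnP => // h; apply/esym/G0.
by rewrite -ltn_subLR // -ltnS.
Qed.

Lemma eval_const b : eval (fpsC b) = cst_compl I_proper b.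
Proof.
apply: compl_eq => -[|n]; apply: qpi_eq; first by [].
suff -> : partial_sum (fpsC b) n.+1 = b by rewrite subrr; apply: ideal0.
rewrite /partial_sum big_ord_recl /= mul1r big1 ?addr0 // => i _.
exact: mulr0.
Qed.

Lemma coefficient_eval c n j y : coefficient c n j (eval y) =
  \sum_(m < n.+1) crd c n j (T ^+ m * fcoef y m).
Proof.
rewrite (coefficientE (N := n.+1) (a := partial_sum y n.+1)) //.
by rewrite linear_sum.
Qed.


(** ** The isomorphism *)

Local Notation lifting := (lifting KA KB).
Local Notation mu := (mu_fun KA).

Definition fps_map (U V : Type) (f : U -> V) (x : fps U) : fps V :=
  Fps (fun n => f (fcoef x n)).

Definition transport (x : fps A) : BB := eval (fps_map lifting x).

Lemma transportD x y : transport (x + y) = transport x + transport y.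
Proof.
rewrite /transport -evalD; congr eval; apply: fps_eq => n.
by rewrite [LHS]linearD.
Qed.

Lemma fcoef_fpsT (V : lmodType F) (z : fps V) n :
  fcoef (fpsT F *: z) n = if n is m.+1 then fcoef z m else 0.
Proof.
rewrite /= ; case: n => [|n]; first by rewrite big_ord1 /= scale0r.
rewrite big_ord_recl /= scale0r add0r big_ord_recl /= scale1r big1 ?addr0.
  by rewrite subSS subn0.
by move=> i _; rewrite /= scale0r.
Qed.

(** By [lift_mul] the coefficients multiply with an extra term in which the
    parameter stands for a shift by one power of $t$. *)
Lemma transport_star x y : transport (star mu x y) = transport x * transport y.
Proof.
rewrite /transport -evalM /star.
have -> : conv *%R (fps_map lifting x) (fps_map lifting y) =
    fps_map lifting (conv *%R x y) +
    Fps (fun n => T * fcoef (fps_map lifting (conv mu x y)) n).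
  apply: fps_eq => n; rewrite fcoefD /= !linear_sum mulr_sumr -big_split /=.
  by apply: eq_bigr => i _; apply: lift_mul.
rewrite evalD -eval_shift -evalD; congr eval; apply: fps_eq => n.
rewrite fcoefD [LHS]linearD /=; congr (_ + _).
have := fcoef_fpsT (conv mu x y) n; rewrite /= => ->.
by case: n => [|n]; first exact: linear0.
Qed.

Lemma transport1 : transport (fpsC 1) = 1.
Proof.
transitivity (cst_compl I_proper 1); last by [].
rewrite /transport -eval_const; congr eval.
by apply: fps_eq => -[|n] /=; [exact: lift1|exact: linear0].
Qed.

(** The structure of $\mathbb C[[t]]$-algebra of $B^k$: $t$ acts as $T$. *)
Definition scalars (f : fps F) : BB := eval (fps_map (fun c => c%:A) f).

Lemma scalarsB : zmod_morphism scalars.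
Proof.
move=> f g; apply: (addIr (scalars g)); rewrite subrK /scalars -evalD.
congr eval; apply: fps_eq => n; rewrite fcoefD /= -scalerDl.
by congr (_ *: _); rewrite subrK.
Qed.

Lemma scalarsM : monoid_morphism scalars.
Proof.
split=> [|f g].
  transitivity (cst_compl I_proper 1); last by [].
  rewrite /scalars -eval_const; congr eval.
  by apply: fps_eq => -[|n] /=; rewrite ?scale1r ?scale0r.
rewrite /scalars -evalM; congr eval; apply: fps_eq => n /=.
rewrite scaler_suml; apply: eq_bigr => i _.
by rewrite -scalerAl mul1r scalerA.
Qed.

Lemma scalarsC c : scalars (fpsC c) = c%:A.
Proof.
have -> : (c%:A : BB) = cst_compl I_proper c%:A.
  by apply: compl_eq => n /=; rewrite qpiZ.
rewrite -eval_const /scalars; congr eval.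
by apply: fps_eq => -[|n] //=; rewrite scale0r.
Qed.

Lemma transportZ f x : transport (f *: x) = scalars f * transport x.
Proof.
rewrite /transport /scalars -evalM; congr eval; apply: fps_eq => n /=.
rewrite linear_sum; apply: eq_bigr => i _ /=.
by rewrite -scalerAl mul1r linearZ.
Qed.

Lemma scalars_central f b : scalars f * b = b * scalars f.
Proof.
apply: compl_eq => n.
pose q := qpi (ideal_exp I n).
have [z zf zC] : exists2 z, scalars f n = q z & forall a, z * a = a * z.
  exists (partial_sum (fps_map (fun c => c%:A) f) n) => // a.
  rewrite mulr_suml mulr_sumr; apply: eq_bigr => m _ /=.
  rewrite -!scalerAr !mulr1 -scalerAl; congr (_ *: _).
  exact: parameter_exp_central.
rewrite -[LHS]/(scalars f n * b n) -[RHS]/(b n * scalars f n) zf.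
by rewrite -[b n]qreprK -!qpiM zC.
Qed.

(** ** Coordinates of the isomorphism *)

Lemma lift_crd_loop c r j a : lift_crd KA c (r * loop_length c j) j a =
  match r with
  | 0 => ce KA j a
  | 1 => if lift_colour j == c then cs KA j a else 0
  | _ => 0
  end.
Proof.
rewrite /loop_length; case: ifPn => l; case: r => [|[|r]] //=.
- by rewrite l.
- by rewrite (negPf l).
- by rewrite muln1 (negPf l); case: r.
Qed.

Lemma lift_crd_odd c r j a : linked c j ->
  lift_crd KA c (r * 2).+1 j a = if r == 0%N then cw KA c j a else 0.
Proof. by move=> l; case: r => [|r] //=; rewrite l. Qed.

Lemma sum_lift q (E : nat -> F) n len : (0 < len)%N -> (n %/ len)%N = q ->
  \sum_(m < n.+1) (if (m * len <= n)%N then E m else 0) = \sum_(m < q.+1) E m.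
Proof.
move=> len0 <-; rewrite (big_ord_widen n.+1 E) ?ltnS ?leq_div //.
rewrite [RHS]big_mkcond; apply: eq_bigr => m _ /=.
by rewrite ltnS leq_divRL.
Qed.

Lemma coefficient_transport c n j x : coefficient c n j (transport x) =
  \sum_(m < (n %/ loop_length c j).+1)
    colour_sign F c ^+ m * lift_crd KA c (n - m * loop_length c j) j (fcoef x m).
Proof.
have len0 : (0 < loop_length c j)%N by rewrite /loop_length; case: ifP.
rewrite coefficient_eval -(@sum_lift _ (fun m => colour_sign F c ^+ m *
  lift_crd KA c (n - m * loop_length c j) j (fcoef x m)) n _ len0 (erefl _)).
apply: eq_bigr => m _; rewrite crd_parameter_exp; case: ifP => // _.
by rewrite crd_lift.
Qed.

(** At the loops of a colour at [j] the vertex coordinate of the term of order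
    [r] meets the socle coordinate of the term of order one less, and only on
    the colour that carries the lift of the socle element. *)
Lemma coefficient_loop c r j x :
  coefficient c (r * loop_length c j) j (transport x) =
  colour_sign F c ^+ r * ce KA j (fcoef x r) +
  (if r is m.+1 then if lift_colour j == c
     then colour_sign F c ^+ m * cs KA j (fcoef x m) else 0 else 0).
Proof.
have len0 : (0 < loop_length c j)%N by rewrite /loop_length; case: ifP.
rewrite coefficient_transport mulnK //.
under eq_bigr => m _ do rewrite -mulnBl lift_crd_loop.
rewrite big_ord_recr /= subnn addrC; congr (_ + _).
case: r => [|r]; first by rewrite big_ord0.
rewrite big_ord_recr /= subSnn big1 ?add0r.
  by case: ifP => _; rewrite ?mulr0.
move=> m _; have : (0 < r - m)%N by rewrite subn_gt0.
by rewrite subSn ?(ltnW (ltn_ord m)) //; case: (r - m)%N => // i _; rewrite mulr0.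
Qed.

Lemma coefficient_odd c r j x : linked c j ->
  coefficient c (r * 2).+1 j (transport x) =
  colour_sign F c ^+ r * cw KA c j (fcoef x r).
Proof.
move=> l; rewrite coefficient_transport /loop_length l.
have -> : ((r * 2).+1 %/ 2)%N = r by rewrite -addn1 divnMDl // addn0.
rewrite big_ord_recr /= subSnn /= l big1 ?add0r // => m _.
rewrite subSn ?leq_mul2r ?(ltnW (ltn_ord m)) //.
rewrite -mulnBl lift_crd_odd // subn_eq0 leqNgt ltn_ord mulr0.
by [].
Qed.

Lemma word_length_cases c (j : 'I_k) n :
  (exists r, n = r * loop_length c j)%N \/
  linked c j /\ (exists r, n = (r * 2).+1)%N.
Proof.
rewrite /loop_length; case: ifPn => l; last by left; exists n; rewrite muln1.
have [o|o] := boolP (odd n).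
  right; split=> //; exists n./2.
  by rewrite muln2 -[LHS]odd_double_half o.
by left; exists n./2; rewrite muln2 even_halfK.
Qed.

Definition recover_vertex (f : BB) (m : nat) (j : 'I_k) : F :=
  let c := ~~ lift_colour j in
  colour_sign F c ^+ m * coefficient c (m * loop_length c j) j f.

(** The inverse of [transport].  At each vertex the idempotent part of a
    coefficient is read off the colour that does not carry the lifting of the
    socle element. *)
Definition recover (f : BB) : fps A := Fps (fun m => abuild KA
  (recover_vertex f m)
  (fun c j => colour_sign F c ^+ m * coefficient c (m * 2).+1 j f)
  (fun j => let c := lift_colour j in colour_sign F c ^+ m *
    (coefficient c (m.+1 * loop_length c j) j f
     - colour_sign F c ^+ m.+1 * recover_vertex f m.+1 j))).

Lemma sign_expK c m : colour_sign F c ^+ m * colour_sign F c ^+ m = 1.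
Proof. by rewrite -exprMn colour_signK expr1n. Qed.

Lemma coefficient_deg0 c d j f : coefficient c 0 j f = coefficient d 0 j f.
Proof. exact: crd_deg0. Qed.

Lemma recoverK : cancel recover transport.
Proof.
move=> f; apply: coefficient_ext => c n j.
case: (word_length_cases c j n) => [[r ->]|[l [r ->]]]; last first.
  rewrite coefficient_odd //= cw_abuild l mulrA sign_expK mul1r.
  by [].
rewrite coefficient_loop /= ce_abuild.
have [e|ne] := eqVneq (lift_colour j) c.
  case: r => [|r]; last first.
    rewrite cs_abuild /= e mulrA sign_expK mul1r; ring.
  rewrite addr0 /recover_vertex !mul0n !mul1r.
  exact: coefficient_deg0.
rewrite /recover_vertex; have -> : ~~ lift_colour j = c.
  by case: c ne; case: lift_colour.
rewrite mulrA sign_expK mul1r.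
by case: r => [|r]; rewrite addr0.
Qed.

Lemma transport0 x : transport x = 0 -> x = 0.
Proof.
have c0 c n j : coefficient c n j (0 : BB) = 0.
  rewrite (@coefficientE n.+1 0) ?linear0 //; exact: esym (qpi0 _).
move=> x0.
have sz (c : bool) m (a : F) : colour_sign F c ^+ m * a = 0 -> a = 0.
  by move=> h; rewrite -[a]mul1r -(sign_expK c m) -mulrA h mulr0.
have e0 m j : ce KA j (fcoef x m) = 0.
  pose c := ~~ lift_colour j; apply: (@sz c m).
  have := coefficient_loop c m j x; rewrite x0 c0.
  have -> : (lift_colour j == c) = false by rewrite /c; case: lift_colour.
  by case: m => [|m]; rewrite addr0.
apply: fps_eq => m; apply: (acrd_ext (a := KA)) => [j|c j|j]; rewrite linear0 //.
  have [l|] := boolP (linked c j); last exact: cw_unlinked.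
  by apply: (@sz c m); rewrite -(coefficient_odd m x l) x0 c0.
apply: (@sz (lift_colour j) m).
have := coefficient_loop (lift_colour j) m.+1 j x.
by rewrite x0 c0 e0 mulr0 add0r eqxx.
Qed.

End Completed.

(** * The deformation isomorphism *)

Section ReductionModuloT.
Variables (F : fieldType) (A : algType F) (B : algType (fps F)).
Variables (f : {rmorphism B -> A}) (g : A -> B).
Hypotheses (f_ker : forall x, f x = 0 <-> exists y, x = fpsT F *: y)
  (gK : cancel g f) (fZ : forall c x, f (fpsC c *: x) = c *: f x).

(** Since $t$ is central, the ideal it generates is the set of its multiples. *)
Lemma t_idealE x : t_ideal B x <-> f x = 0.
Proof.
split=> [h|/f_ker [y ->] J].
  have K0 : f 0 = 0 by apply: rmorph0.
  have KD a b : f a = 0 -> f b = 0 -> f (a + b) = 0.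
    by move=> ha hb; rewrite rmorphD /= ha hb addr0.
  have Kl a b : f b = 0 -> f (a * b) = 0 by move=> hb; rewrite rmorphM /= hb mulr0.
  have Kr a b : f b = 0 -> f (b * a) = 0 by move=> hb; rewrite rmorphM /= hb mul0r.
  apply: (@ideal_gen_min _ _ (@Ideal B (fun b => f b = 0) K0 KD Kl Kr) _ _ h).
  by move=> _ -> /=; apply/f_ker; exists 1.
by move=> h; rewrite -[y]mul1r scalerAl; apply: Defs.idealMr; apply: h.
Qed.

Definition reduction (q : mod_t B) : A := f (qrepr (q : quot_ring (t_ideal B))).

Lemma reduction_qpi x : reduction (qpi (t_ideal B) x) = f x.
Proof.
apply/eqP; rewrite -subr_eq0 -rmorphB; apply/eqP/t_idealE.
exact: qrepr_pi.
Qed.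

Lemma reduction_zmod : zmod_morphism reduction.
Proof.
move=> p q; have := qreprK p; have := qreprK q; set y := qrepr q; set x := qrepr p.
by move=> <- <-; rewrite -qpiB !reduction_qpi rmorphB.
Qed.

Lemma reduction_monoid : monoid_morphism reduction.
Proof.
split=> [|p q]; first by rewrite -(rmorph1 f) -reduction_qpi.
have := qreprK p; have := qreprK q; set y := qrepr q; set x := qrepr p.
by move=> <- <-; rewrite -qpiM !reduction_qpi rmorphM.
Qed.

HB.instance Definition _ :=
  GRing.isZmodMorphism.Build (mod_t B) A reduction reduction_zmod.
HB.instance Definition _ :=
  GRing.isMonoidMorphism.Build (mod_t B) A reduction reduction_monoid.

Definition reduction_morphism : {rmorphism mod_t B -> A} := reduction.

Lemma reduction_deformation :
  topologically_free B -> is_deformation reduction_morphism.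
Proof.
move=> free; split=> // [|c q].
  exists (fun a => qpi (t_ideal B) (g a)) => [q|a] /=; last first.
    by rewrite reduction_qpi gK.
  rewrite -[q in RHS]qreprK; apply: qpi_eq; apply/t_idealE.
  by rewrite rmorphB /= gK subrr.
have <- := @qreprK _ (t_ideal B) q; set x := qrepr q.
have e : fpsC c *: (qpi (t_ideal B) x : mod_t B) = qpi (t_ideal B) (fpsC c *: x).
  exact: (esym (qpiZ (t_ideal B) (fpsC c) x)).
by rewrite /= e !reduction_qpi fZ.
Qed.

End ReductionModuloT.

Section Assembly.
Variables (k : nat) (F : fieldType) (A B : algType F).
Variables (KA : acoordinates k A) (KB : coordinates k B).
Variables (I : ideal B) (I_proper : ~ I 1).
Hypothesis idealE : forall b, I b <-> forall c j, crd KB c 0 j b = 0.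
Local Notation BB := (completion I_proper).
Local Notation transport := (@transport k F A B KA KB I I_proper idealE).
Local Notation recover := (@recover k F A B KA KB I I_proper).
Local Notation scalars := (@scalars k F B KB I I_proper idealE).

Definition mu : {bilinear A -> A -> A} := mu_fun KA.

Lemma transport_inj : injective transport.
Proof.
move=> x y e; apply/eqP; rewrite -subr_eq0; apply/eqP.
apply: (@transport0 _ _ _ _ KA KB I I_proper idealE).
apply: (addIr (transport y)).
by rewrite -transportD subrK e add0r.
Qed.

Lemma transportK : cancel transport recover.
Proof. by move=> x; apply: transport_inj; apply: recoverK. Qed.

(** The product $\star$ inherits the axioms from the completion, where it is
    embedded. *)
Lemma star_assoc : star_unital_assoc mu.
Proof.
split=> [x y z|x|x]; apply: transport_inj; rewrite !transport_star.
- exact: mulrA.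
- by rewrite transport1 mul1r.
- by rewrite transport1 mulr1.
Qed.

Local Notation S := (star_algebra star_assoc).

Definition const_term (x : S) : A := fcoef (x : fps A) 0%N.

Lemma const_term_zmod : zmod_morphism const_term. Proof. by []. Qed.

Lemma const_term_monoid : monoid_morphism const_term.
Proof.
split=> // x y; rewrite /const_term -[x * y]/(star mu x y) /star fcoefD.
by rewrite fcoef_fpsT addr0 /= big_ord1.
Qed.

HB.instance Definition _ := GRing.isZmodMorphism.Build S A const_term const_term_zmod.
HB.instance Definition _ :=
  GRing.isMonoidMorphism.Build S A const_term const_term_monoid.

Lemma const_term_ker (x : S) : const_term x = 0 <-> exists y : S, x = fpsT F *: y.
Proof.
split=> [x0|[y ->]]; last by rewrite /const_term [LHS]fcoef_fpsT.
exists (Fps (fun n => fcoef (x : fps A) n.+1)); apply: fps_eq => n.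
by rewrite fcoef_fpsT; case: n.
Qed.

Lemma const_termZ c (x : S) : const_term (fpsC c *: x) = c *: const_term x.
Proof. by rewrite /const_term /= big_ord1. Qed.

Lemma const_termK : cancel (fun a => fpsC a : S) const_term. Proof. by []. Qed.

Lemma star_free : topologically_free S.
Proof.
pose f (x : fps A) : S := x.
have f_lin : linear f by [].
exists A, (HB.pack_for {linear fps A -> S} f (GRing.isLinear.Build _ _ _ _ f f_lin)).
by exists id.
Qed.

HB.instance Definition _ :=
  GRing.isZmodMorphism.Build (fps F) BB scalars (scalarsB I_proper idealE).
HB.instance Definition _ :=
  GRing.isMonoidMorphism.Build (fps F) BB scalars (scalarsM I_proper idealE).

Definition scalars_morphism : {rmorphism fps F -> BB} := scalars.

Lemma scalars_morphism_central : central_morphism scalars_morphism.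
Proof. exact: scalars_central. Qed.

Local Notation C := (central_algebra scalars_morphism_central).

Definition iso (b : C) : S := recover b.

Lemma transport_iso b : transport (iso b) = b.
Proof. exact: recoverK. Qed.

Lemma iso_zmod : zmod_morphism iso.
Proof.
move=> a b; apply: transport_inj; apply: (addIr (transport (iso b))).
apply: etrans (_ : transport (iso a) = _).
  by rewrite !transport_iso; apply: subrK.
have := transportD KA I_proper idealE (iso a - iso b) (iso b).
by rewrite subrK.
Qed.

Lemma iso_monoid : monoid_morphism iso.
Proof.
split=> [|a b]; apply: transport_inj; rewrite transport_iso.
  by rewrite [RHS]transport1.
by rewrite [RHS]transport_star !transport_iso.
Qed.

Lemma iso_scalable : scalable iso.
Proof.
move=> f b; apply: transport_inj.
by rewrite transport_iso [RHS]transportZ transport_iso.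
Qed.

HB.instance Definition _ := GRing.isZmodMorphism.Build C S iso iso_zmod.
HB.instance Definition _ := GRing.isMonoidMorphism.Build C S iso iso_monoid.
HB.instance Definition _ := GRing.isScalable.Build (fps F) C S *:%R iso iso_scalable.

Lemma iso_bij : bijective iso.
Proof. by exists transport; [exact: transport_iso|exact: transportK]. Qed.

Lemma central_free : topologically_free C.
Proof.
pose f (x : fps A) : C := transport x.
have f_lin : linear f.
  by move=> c x y; rewrite /f transportD transportZ.
exists A, (HB.pack_for {linear fps A -> C} f (GRing.isLinear.Build _ _ _ _ f f_lin)).
by exists iso; [exact: transportK|exact: transport_iso].
Qed.

Definition const_term_iso : {rmorphism C -> A} := const_term \o iso.

Lemma const_term_iso_ker (x : C) :
  const_term_iso x = 0 <-> exists y : C, x = fpsT F *: y.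
Proof.
apply: iff_trans (const_term_ker (iso x)) _; split=> [[y e]|[y ->]].
  exists (transport y); rewrite -[x]transport_iso e; exact: transportZ.
by exists (iso y); rewrite linearZ.
Qed.

Lemma const_term_isoZ c (x : C) :
  const_term_iso (fpsC c *: x) = c *: const_term_iso x.
Proof. exact: etrans (congr1 const_term (iso_scalable _ _)) (const_termZ _ _). Qed.

Lemma const_term_isoK : cancel (fun a => transport (fpsC a) : C) const_term_iso.
Proof. by move=> a; apply: (congr1 const_term (transportK (fpsC a))). Qed.

Theorem coordinatised_deformation :
  exists hstar : star_unital_assoc mu,
  exists (s : {rmorphism fps F -> BB}) (hs : central_morphism s),
    (forall c : F, s (fpsC c) = c%:A) /\
  exists (phi1 : {rmorphism mod_t (star_algebra hstar) -> A})
         (phi2 : {rmorphism mod_t (central_algebra hs) -> A}),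
  [/\ forall x : fps A, phi1 (qpi (t_ideal (star_algebra hstar)) x) = fcoef x 0%N,
      is_deformation phi1,
      is_deformation phi2
    & isomorphic_deformations phi2 phi1].
Proof.
exists star_assoc, scalars_morphism, scalars_morphism_central; split.
  exact: scalarsC.
exists (reduction_morphism const_term_ker), (reduction_morphism const_term_iso_ker).
split.
- exact: (reduction_qpi const_term_ker).
- exact: (reduction_deformation const_term_ker const_termK const_termZ star_free).
- exact: (reduction_deformation const_term_iso_ker const_term_isoK const_term_isoZ
    central_free).
exists iso; split; first exact: iso_bij.
move=> x; apply: etrans (reduction_qpi const_term_ker _) _.
exact: esym (reduction_qpi const_term_iso_ker _).
Qed.

End Assembly.

(** * The multiplication table of the first order term *)

Section MuTable.
Variables (k : nat) (hk : (2 <= k)%N) (F : fieldType).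
Local Notation A := (A_alg hk F).
Local Notation KA := (A_coordinates hk F).
Local Notation mu := (mu_fun KA).
Local Notation cw := (@arrow_crd k hk F).
Local Notation cs := (@socle_crd k hk F).
Local Notation ce := (@vertex_crd k hk F).
Local Notation arrow := (A_arrow hk F).
Local Notation socle := (A_socle hk F).
Local Notation sign := (colour_sign F).

Lemma vertex_crd_mu j (a b : A) : ce j (mu a b) = sign (~~ lift_colour j) *
    (cw (~~ lift_colour j) (partner (~~ lift_colour j) j) a
     * cw (~~ lift_colour j) j b).
Proof. exact: (ce_mu KA). Qed.

Lemma arrow_crd_mu c j (a b : A) : cw c j (mu a b) = sign c *
   ((lift_colour j == c)%:R * (cw c j a * cs j b)
    + (lift_colour (partner c j) == c)%:R * (cs (partner c j) a * cw c j b)).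
Proof. exact: (cw_mu KA). Qed.

Lemma socle_crd_mu j (a b : A) :
  cs j (mu a b) = sign (lift_colour j) * (cs j a * cs j b).
Proof. exact: (cs_mu KA). Qed.

(** In particular $\mu$ vanishes when one of its arguments is a vertex. *)
Lemma mu_no_rad (a b : A) :
  (forall c j, cw c j a = 0) /\ (forall j, cs j a = 0) \/
  (forall c j, cw c j b = 0) /\ (forall j, cs j b = 0) -> mu a b = 0.
Proof.
move=> h; apply: A_crd_ext => [j|c j|j]; rewrite linear0.
- by rewrite vertex_crd_mu; case: h => -[-> _]; rewrite ?mul0r ?mulr0.
- by rewrite arrow_crd_mu; case: h => -[-> ->]; rewrite ?mul0r ?mulr0 addr0 mulr0.
- by rewrite socle_crd_mu; case: h => -[_ ->]; rewrite ?mul0r ?mulr0.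
Qed.

Lemma mu_arrow_arrow c i d j : linked c i -> linked d j ->
  mu (arrow c i) (arrow d j) =
  if [&& c == d, d == ~~ lift_colour j & partner d j == i]
  then sign d *: A_e hk F j.+1 else 0.
Proof.
move=> lc ld; apply: A_crd_ext => [l|e l|l].
- rewrite vertex_crd_mu !cw_arrow lc ld /=.
  have [->|lj] := eqVneq l j; last first.
    rewrite !andbF !mulr0; case: ifP => _; last by rewrite linear0.
    by rewrite linearZ /= vertex_crd_e eqSS val_eqE (negPf lj) mulr0.
  rewrite andbT (eq_sym d); case: (eqVneq (~~ lift_colour j) d) => [->|_].
    rewrite (eq_sym d c) mulr1; case: ifP => _; last by rewrite mulr0 linear0.
    by rewrite linearZ /= vertex_crd_e eqxx.
  by rewrite !mulr0 andbF linear0.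
- rewrite arrow_crd_mu !cs_arrow mul0r !mulr0 addr0 mulr0.
  case: ifP => _; last by rewrite linear0.
  by rewrite linearZ /= arrow_crd_e mulr0.
- rewrite socle_crd_mu !cs_arrow !mulr0.
  case: ifP => _; last by rewrite linear0.
  by rewrite linearZ /= socle_crd_e mulr0.
Qed.

Lemma mu_arrow_socle c i j : mu (arrow c i) (socle j) =
  if (i == j) && (lift_colour j == c) then sign c *: arrow c i else 0.
Proof.
apply: A_crd_ext => [l|e l|l].
- rewrite vertex_crd_mu cw_socle !mulr0; case: ifP => _; last by rewrite linear0.
  by rewrite linearZ /= ce_arrow mulr0.
- rewrite arrow_crd_mu cw_socle cw_arrow cs_socle !mulr0 addr0.
  have [->|li] := eqVneq l i; last first.
    rewrite !andbF mul0r !mulr0; case: ifP => _; last by rewrite linear0.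
    by rewrite linearZ /= cw_arrow (negPf li) !andbF mulr0.
  have [->|ec] := eqVneq e c; last first.
    rewrite !andbF mul0r !mulr0; case: ifP => _; last by rewrite linear0.
    by rewrite linearZ /= cw_arrow (negPf ec) !andbF mulr0.
  have [<-|ij] := eqVneq i j; last by rewrite !mulr0 linear0.
  rewrite [X in if X then _ else _]/=.
  have [_|_] := eqVneq (lift_colour i) c; last by rewrite mul0r mulr0 linear0.
  by rewrite linearZ /= cw_arrow !eqxx !mulr1 mul1r.
- rewrite socle_crd_mu cs_arrow mul0r mulr0; case: ifP => _; last by rewrite linear0.
  by rewrite linearZ /= cs_arrow mulr0.
Qed.

Lemma mu_socle_arrow c i j : mu (socle i) (arrow c j) =
  if (i == partner c j) && (lift_colour i == c) then sign c *: arrow c j else 0.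
Proof.
apply: A_crd_ext => [l|e l|l].
- rewrite vertex_crd_mu cw_socle mul0r mulr0; case: ifP => _; last by rewrite linear0.
  by rewrite linearZ /= ce_arrow mulr0.
- rewrite arrow_crd_mu cw_socle cw_arrow cs_socle mul0r mulr0 add0r.
  have [->|li] := eqVneq l j; last first.
    rewrite !andbF !mulr0; case: ifP => _; last by rewrite linear0.
    by rewrite linearZ /= cw_arrow (negPf li) !andbF mulr0.
  have [->|ec] := eqVneq e c; last first.
    rewrite !andbF !mulr0; case: ifP => _; last by rewrite linear0.
    by rewrite linearZ /= cw_arrow (negPf ec) !andbF mulr0.
  have [->|ij] := eqVneq i (partner c j); last first.
    by rewrite !(mul0r, mulr0) linear0.
  rewrite [X in if X then _ else _]/=.
  have [_|_] := eqVneq (lift_colour (partner c j)) c; last by rewrite mul0r mulr0 linear0.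
  by rewrite linearZ /= cw_arrow !eqxx !mul1r.
- rewrite socle_crd_mu cs_arrow !mulr0; case: ifP => _; last by rewrite linear0.
  by rewrite linearZ /= cs_arrow mulr0.
Qed.

Lemma mu_socle_socle i j : mu (socle i) (socle j) =
  if i == j then sign (lift_colour j) *: socle j else 0.
Proof.
apply: A_crd_ext => [l|e l|l].
- rewrite vertex_crd_mu (cw_socle hk F _ _ i) mul0r mulr0.
  case: ifP => _; last by rewrite linear0.
  by rewrite linearZ /= ce_socle mulr0.
- rewrite arrow_crd_mu (cw_socle hk F _ _ i) (cw_socle hk F _ _ j).
  rewrite mul0r !mulr0 addr0 mulr0.
  case: ifP => _; last by rewrite linear0.
  by rewrite linearZ /= cw_socle mulr0.
- rewrite socle_crd_mu (cs_socle hk F _ i) (cs_socle hk F _ j).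
  have [->|lj] := eqVneq l j.
    rewrite mulr1 (eq_sym j); case: eqP => _; last by rewrite mulr0 linear0.
    by rewrite linearZ /= cs_socle eqxx.
  rewrite !mulr0; case: ifP => _; last by rewrite linear0.
  by rewrite linearZ /= cs_socle (negPf lj) mulr0.
Qed.

Lemma arrow_a (i : 'I_k) : arrow (~~ odd i) i = A_a hk F i.+1.
Proof. by rewrite A_arrow.unlock /coloured_arrow addNb addbb. Qed.

Lemma arrow_b (i : 'I_k) : arrow (odd i) i = A_b hk F i.
Proof. by rewrite A_arrow.unlock /coloured_arrow addbb. Qed.

Lemma socle_ab (i : 'I_k) : (0 < i)%N -> socle i = A_a hk F i * A_b hk F i.
Proof.
move=> i0; have i_n0 : (nat_of_ord i == 0%N) = false by case: (nat_of_ord i) i0.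
by rewrite A_socle.unlock /socle_elt i_n0.
Qed.

Lemma socle_ba : socle (first_vertex hk) = A_b hk F 1 * A_a hk F 1.
Proof. by rewrite A_socle.unlock. Qed.

Lemma colour_sign_expr n : sign (~~ odd n) = (-1) ^+ n.
Proof. by rewrite -signr_odd; case: (odd n). Qed.

(** The arrows $a_s$ and $b_s$ join the same two vertices and have the colour $x$
    if $s$ is odd; the vertices are numbered from 0 by the ordinals. *)
Variant A_basis_spec : A_basis -> A -> Prop :=
  | Spec_e j of (1 <= j <= k)%N : A_basis_spec (Be j) (A_e hk F j)
  | Spec_a (i : 'I_k) of (i.+1 < k)%N & linked (~~ odd i) i :
      A_basis_spec (Ba i.+1) (arrow (~~ odd i) i)
  | Spec_b (i : 'I_k) of (0 < i)%N & linked (odd i) i :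
      A_basis_spec (Bb i) (arrow (odd i) i)
  | Spec_ab (i : 'I_k) of (0 < i)%N : A_basis_spec (Bab i) (socle i)
  | Spec_ba : A_basis_spec Bba1 (socle (first_vertex hk)).

Lemma A_basisP p : A_basis_ok k p -> A_basis_spec p (A_basis_val hk F p).
Proof.
have lt s : (1 <= s <= k.-1)%N -> (0 < s)%N /\ (s < k)%N.
  by case/andP => s0 sk; split=> //; rewrite -(prednK (ltnW hk)) ltnS.
case: p => [j|s|s|s|] /=; first by move=> h; apply: Spec_e.
- case/lt; case: s => // s _ sk.
  have := Spec_a (i := Ordinal (ltnW sk)) sk; rewrite arrow_a; apply.
  by rewrite linkedE addNb addbb.
- case/lt => s0 sk.
  have := Spec_b (i := Ordinal sk) s0; rewrite arrow_b; apply.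
  by rewrite linkedE addbb.
- case/lt => s0 sk.
  by have := Spec_ab (i := Ordinal sk) s0; rewrite socle_ab.
- by move=> _; rewrite -socle_ba; apply: Spec_ba.
Qed.

Lemma partner_up (i : 'I_k) : (i.+1 < k)%N -> partner (~~ odd i) i = i.+1 :> nat.
Proof. by move=> ik; rewrite partnerE addNb addbb ik. Qed.

Lemma partner_down (i : 'I_k) : partner (odd i) i = i.-1 :> nat.
Proof. by rewrite partnerE addbb. Qed.

Lemma lift_colour_pos (i : 'I_k) : (0 < i)%N -> lift_colour i = ~~ odd i.
Proof. by rewrite /lift_colour => ->. Qed.

(** The coloured conditions become the conditions of the table by comparing
    parities: for instance $b_s\otimes a_s$ contributes only for $s=1$, where the
    socle element is lifted to the loop $y_1$ and not to the path $x_2x_1$. *)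
Lemma mu_tableE p q : A_basis_ok k p -> A_basis_ok k q ->
  mu (A_basis_val hk F p) (A_basis_val hk F q) = mu_table hk F p q.
Proof.
have no_rad_e j : (forall c i, cw c i (A_e hk F j) = 0) /\
    (forall i, cs i (A_e hk F j) = 0).
  by split=> *; rewrite (arrow_crd_e, socle_crd_e).
move=> /A_basisP hp /A_basisP hq.
case: hp => [i0 ?|i ik li|i i_gt0 li|i i_gt0|].
- by rewrite mu_no_rad; [|left].
- case: hq => [j0 ?|j jk lj|j j_gt0 lj|j j_gt0|].
  + by rewrite mu_no_rad; [|right].
  + rewrite mu_arrow_arrow // ifF //; apply/and3P => -[/eqP e _ /eqP pj].
    have := partner_up jk; rewrite pj => ij.
    by move: e; rewrite ij /=; case: odd.
  + rewrite mu_arrow_arrow // (lift_colour_pos j_gt0) negbK eqxx /=.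
    rewrite -val_eqE /= partner_down.
    have [ji|ji] := eqVneq (nat_of_ord j) i.+1.
      by rewrite ji /= !eqxx /= -colour_sign_expr /= negbK.
    rewrite ifF //; apply/andP => -[_ /eqP e]; move: ji.
    by rewrite -e prednK // eqxx.
  + rewrite mu_arrow_socle (lift_colour_pos j_gt0) -val_eqE /= ?eqSS.
    have [ij|_] := eqVneq (nat_of_ord i) j; last by [].
    rewrite -ij eqxx /= colour_sign_expr.
    by rewrite arrow_a.
  + by rewrite mu_arrow_socle -val_eqE /=; case: eqP => //= ->.
- case: hq => [j0 ?|j jk lj|j j_gt0 lj|j j_gt0|].
  + by rewrite mu_no_rad; [|right]; case: i {i_gt0 li} => -[|[|i]].
  + rewrite mu_arrow_arrow // -val_eqE /= partner_up //.
    have [ij|ij] := eqVneq j.+1 i; last first.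
      rewrite !andbF; case: (nat_of_ord i) ij => [|[|n]] //.
      by case: (nat_of_ord j).
    rewrite -ij /= eqxx /= andbT; case: (posnP j) => [j0|j_gt0].
      by rewrite /lift_colour j0 /= scale1r.
    rewrite (lift_colour_pos j_gt0) negbK.
    by case: (nat_of_ord j) j_gt0 => //= n _; case: odd.
  + rewrite mu_arrow_arrow // ifF; first by case: (nat_of_ord i) => [|[|]].
    apply/and3P => -[/eqP e _ /eqP pj].
    have := partner_down j; rewrite pj => ij.
    by move: e; rewrite ij; case: (nat_of_ord j) j_gt0 => //= n _; case: odd.
  + rewrite mu_arrow_socle (lift_colour_pos j_gt0).
    have [->|_] := eqVneq i j; last by case: (nat_of_ord i) => [|[|]].
    by case: (nat_of_ord j) => [|[|]] //= n; case: odd.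
  + rewrite mu_arrow_socle -val_eqE /= eqn0Ngt i_gt0.
    by case: (nat_of_ord i) => [|[|]].
- case: hq => [j0 ?|j jk lj|j j_gt0 lj|j j_gt0|].
  + by rewrite mu_no_rad; [|right].
  + rewrite mu_socle_arrow (lift_colour_pos i_gt0) -val_eqE /= partner_up //.
    by case: eqP => //= ->; rewrite /=; case: odd.
  + rewrite mu_socle_arrow (lift_colour_pos i_gt0) -val_eqE /= partner_down.
    have [ji|ji] := eqVneq (nat_of_ord j) i.+1.
      by rewrite -arrow_b ji /= eqxx eqxx colour_sign_expr.
    rewrite ifF //; apply/andP => -[/eqP e _]; move: ji.
    by rewrite e prednK // eqxx.
  + rewrite mu_socle_socle (lift_colour_pos j_gt0).
    rewrite -val_eqE eq_sym /= -(socle_ab i_gt0).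
    have [/ord_inj ->|_] := eqVneq (nat_of_ord j) i; last by [].
    by rewrite colour_sign_expr.
  + by rewrite mu_socle_socle -val_eqE /= eqn0Ngt i_gt0.
- case: hq => [j0 ?|j jk lj|j j_gt0 lj|j j_gt0|].
  + by rewrite mu_no_rad; [|right].
  + by rewrite mu_socle_arrow -val_eqE /= partner_up.
  + rewrite mu_socle_arrow -val_eqE /= partner_down.
    by case: (nat_of_ord j) j_gt0 => [|[|n]].
  + by rewrite mu_socle_socle -val_eqE /= eq_sym eqn0Ngt j_gt0.
  + by rewrite mu_socle_socle eqxx /= scaleN1r socle_ba.
Qed.

End MuTable.

Theorem Bhat_koszul (k : nat) (hk : (2 <= k)%N) (F : fieldType) :
  koszul (@Bhat_degree k hk F).
Proof.
exact: (koszul_gr (K := Bhat_coordinates hk F) (@Bhat_degreeE k hk F)).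
Qed.

Theorem theorem34 (R : realType) (k : nat) (hk : (2 <= k)%N) :
  let C : fieldType := R[i] in
  let A : algType C := A_alg hk C in
  let B : algType C := B_alg hk C in
  koszul (@Bhat_degree k hk C) /\
  exists mu : {bilinear A -> A -> A}, mu_spec mu /\
  exists hstar : star_unital_assoc mu,
  exists (s : {rmorphism fps C -> B}) (hs : central_morphism s),
    (forall c : C, s (fpsC c) = c%:A) /\
  exists (phi1 : {rmorphism mod_t (star_algebra hstar) -> A})
         (phi2 : {rmorphism mod_t (central_algebra hs) -> A}),
  [/\ forall x : fps A, phi1 (qpi (t_ideal (star_algebra hstar)) x) = fcoef x 0%N,
      is_deformation phi1,
      is_deformation phi2
    & isomorphic_deformations phi2 phi1].
Proof.
move=> C A B; split; first exact: Bhat_koszul.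
exists (mu (A_coordinates hk C)); split; first exact: mu_tableE.
exact: (@coordinatised_deformation k C A (Bhat_alg hk C) (A_coordinates hk C)
  (Bhat_coordinates hk C) (arrow_ideal (@B_rel_triv k hk C))
  (@arrow_ideal_proper _ _ _ (@B_rel_triv k hk C)) (@arrow_idealE k hk C)).
Qed.
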